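(* Let $(A,B)$ satisfy (1.1)-(1.4) of the context, and let $c(t,x,u)=(u+K(t)x)^\top R(t)(u+K(t)x)$ be a canonical cost. Then there exists a canonical cost $\tilde c\neq c$ equivalent to $c$ if and only if the LQ optimal control problem defined by $(A,B)$ and $c$ admits a product structure.
   Context: Notation: $M_{n,m}(\mathbb{R})$ denotes real $n\times m$ matrices, $M_n(\mathbb{R})=M_{n,n}(\mathbb{R})$, $GL_n(\mathbb{R})$ the invertible ones, $\mathrm{Sym}(n)$ the symmetric ones; $Q_1\succ Q_2$ means $Q_1-Q_2$ is positive definite. $\Phi_A(t,\tau)$ is the transition matrix: $\partial_t\Phi_A(t,\tau)=A(t)\Phi_A(t,\tau)$, $\Phi_A(\tau,\tau)=I$. $A$ is exponentially stable if there are $\alpha,\beta>0$ with $\|\Phi_A(t,t_0)\|\le\alpha e^{-\beta(t-t_0)}$ for all $t\ge t_0$. Assumptions on $(A,B)$: (1.1) $A:\mathbb{R}\to M_n(\mathbb{R})$ and $B:\mathbb{R}\to M_{n,m}(\mathbb{R})$ are $C^\infty$ and bounded; (1.2) $B(t)$ is injective for every $t$; (1.3) for every $t$, $\mathrm{span}\{B_i(t)v: v\in\mathbb{R}^m, i\in\mathbb{N}\}=\mathbb{R}^n$, where $B_0=B$, $B_{i+1}=\dot B_i-AB_i$; (1.4) there are constants $s,\beta>0$ such that for every $t$, $\int_t^{t+s}\Phi_A(t,\tau)B(\tau)B(\tau)^\top\Phi_A(t,\tau)^\top d\tau\succ\beta I$. A canonical cost is a cost $c(t,x,u)=(u+K(t)x)^\top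 R(t)(u+K(t)x)$ where $R:\mathbb{R}\to\mathrm{Sym}(m)$ is smooth, bounded, uniformly positive definite ($R(t)\succ\alpha I$ for some $\alpha>0$ and all $t$) with $\det R(0)=1$, and $K:\mathbb{R}\to M_{m,n}(\mathbb{R})$ is smooth, bounded, with $A-BK$ exponentially stable. The optimal synthesis of a cost $c$ is the set of all trajectories, for all data $t_0<t_1$, $x_0,x_1\in\mathbb{R}^n$, minimizing $\int_{t_0}^{t_1}c(t,x_u(t),u(t))\,dt$ among trajectories $x_u$ of $\dot x=A(t)x+B(t)u$ with $x_u(t_0)=x_0$, $x_u(t_1)=x_1$ (square-integrable controls may be taken). Two costs are equivalent if they have the same optimal synthesis (for the fixed $(A,B)$). Product structure: the LQ problem defined by $(A,B)$ and the canonical cost $c=(u+Kx)^\top R(u+Kx)$ admits a product structure if there exist an integer $N>1$, positive integers $m_i\le n_i$ ($i=1,\dots,N$) with $\sum_i m_i=m$, $\sum_i n_i=n$, and smooth mappings $M:\mathbb{R}\to GL_n(\mathbb{R})$, $U:\mathbb{R}\to GL_m(\mathbb{R})$ such that, for every $t$, $\bar A=M^{-1}(-\dot M+(A-BK)M)$, $\bar B=M^{-1}BU$ and $\bar R=U^\top RU$ are block diagonal, $\bar A=\mathrm{diag}(A_1,\dots,A_N)$, $\bar B=\mathrm{diag}(B_1,\dots,B_N)$, $\bar R=\mathrm{diag}(R_1,\dots,R_N)$, with blocks $A_i(t)\in M_{n_i}(\mathbb{R})$, $B_i(t)\in M_{n_i,m_i}(\mathbb{R})$, $R_i(t)\in\mathrm{Sym}(m_i)$.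 *)

(* Defs.v *)
From HB Require Import structures.
From mathcomp Require Import all_boot all_order all_algebra.
From mathcomp Require Import all_classical all_reals all_analysis.

Set Implicit Arguments.
Unset Strict Implicit.
Unset Printing Implicit Defensive.

Import Order.TTheory GRing.Theory Num.Theory.
Import numFieldNormedType.Exports.

Local Open Scope ring_scope.
Local Open Scope classical_set_scope.

Section Matrices.
Variable R : realType.

Definition posdefmx n (Q : 'M[R]_n) : Prop :=
  Q^T = Q /\ forall x : 'cV[R]_n, x != 0 -> 0 < (x^T *m Q *m x) 0 0.

Definition succmx n (Q1 Q2 : 'M[R]_n) : Prop := posdefmx (Q1 - Q2).

Definition smooth n m (F : R -> 'M[R]_(n, m)) : Prop :=
  forall k t, derivable (derive1n k F) t 1.

Definition mx_integral n m (a b : R) (F : R -> 'M[R]_(n, m)) : 'M[R]_(n, m) :=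
  \matrix_(i, j) \int[lebesgue_measure]_(s in `[a, b]) F s i j.

(* Linear span of an arbitrary set of vectors: the union of the spans of its
   finite families. *)
Definition set_span n (S : set 'cV[R]_n) : set 'cV[R]_n :=
  [set y | exists X : seq 'cV[R]_n, [set` X] `<=` S /\ y \in <<X>>%VS].

End Matrices.

Section LinearSystems.
Variable R : realType.

(* For continuous A such a Phi exists and is unique, so that the existential
   quantifications over Phi below merely name the transition matrix of A. *)
Definition is_transition_matrix n (A : R -> 'M[R]_n) (Phi : R -> R -> 'M[R]_n)
    : Prop :=
  (forall tau, Phi tau tau = 1%:M) /\
  (forall t tau : R, is_derive t (1 : R) (fun r : R => Phi r tau) (A t *m Phi t tau)).

Definition exponentially_stable n (A : R -> 'M[R]_n) : Prop :=
  exists2 Phi, is_transition_matrix A Phi &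
    exists alpha beta : R, [/\ 0 < alpha, 0 < beta &
      forall t t0, t0 <= t -> `|Phi t t0| <= alpha * expR (- beta * (t - t0))].

Variables n m : nat.
Implicit Types (A : R -> 'M[R]_n) (B : R -> 'M[R]_(n, m)).

Fixpoint iterB A B (i : nat) : R -> 'M[R]_(n, m) :=
  if i is k.+1 then fun t => derive1 (iterB A B k) t - A t *m iterB A B k t else B.

Definition full_span A B : Prop :=
  forall t, set_span [set y | exists i v, y = iterB A B i t *m v] = setT.

Definition uniformly_controllable A B : Prop :=
  exists2 Phi, is_transition_matrix A Phi &
    exists s beta : R, [/\ 0 < s, 0 < beta & forall t,
      succmx (mx_integral t (t + s) (fun tau =>
                Phi t tau *m B tau *m (B tau)^T *m (Phi t tau)^T))
             beta%:M].

Definition standing_assumptions A B : Prop :=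
  [/\ [/\ smooth A, smooth B, bounded_fun A & bounded_fun B],
      forall t, injective (fun v : 'cV[R]_m => B t *m v),
      full_span A B
    & uniformly_controllable A B].

Definition quadratic_cost (K : R -> 'M[R]_(m, n)) (W : R -> 'M[R]_m)
    (t : R) (x : 'cV[R]_n) (u : 'cV[R]_m) : R :=
  ((u + K t *m x)^T *m W t *m (u + K t *m x)) 0 0.

Definition admissible_weights A B
    (K : R -> 'M[R]_(m, n)) (W : R -> 'M[R]_m) : Prop :=
  [/\ [/\ forall t, (W t)^T = W t,
          smooth W,
          bounded_fun W,
          exists2 alpha : R, 0 < alpha & forall t, succmx (W t) alpha%:M
        & \det (W 0) = 1],
      smooth K,
      bounded_fun K
    & exponentially_stable (fun t => A t - B t *m K t)].

Definition canonical_cost A B (c : R -> 'cV[R]_n -> 'cV[R]_m -> R) : Prop :=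
  exists K W, admissible_weights A B K W /\ c = quadratic_cost K W.

Definition square_integrable (t0 t1 : R) (u : R -> 'cV[R]_m) : Prop :=
  forall i, measurable_fun `[t0, t1] (fun t => u t i 0) /\
    lebesgue_measure.-integrable `[t0, t1] (fun t => (u t i 0 ^+ 2)%:E).

(* Caratheodory solutions of x' = A x + B u on [t0, t1], in integral form. *)
Definition trajectory A B (t0 t1 : R) (x : R -> 'cV[R]_n) (u : R -> 'cV[R]_m)
    : Prop :=
  [/\ square_integrable t0 t1 u,
      {within `[t0, t1], continuous x}
    & forall t, t0 <= t <= t1 ->
        x t = x t0 + mx_integral t0 t (fun s => A s *m x s + B s *m u s)].

Definition total_cost (c : R -> 'cV[R]_n -> 'cV[R]_m -> R) (t0 t1 : R)
    (x : R -> 'cV[R]_n) (u : R -> 'cV[R]_m) : \bar R :=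
  (\int[lebesgue_measure]_(t in `[t0, t1]) (c t (x t) (u t))%:E)%E.

Definition minimizer A B c (t0 t1 : R) (x0 x1 : 'cV[R]_n)
    (x : R -> 'cV[R]_n) (u : R -> 'cV[R]_m) : Prop :=
  [/\ trajectory A B t0 t1 x u, x t0 = x0, x t1 = x1
    & forall y v, trajectory A B t0 t1 y v -> y t0 = x0 -> y t1 = x1 ->
        (total_cost c t0 t1 x u <= total_cost c t0 t1 y v)%E].

(* A trajectory on [t0, t1] is represented by any function R -> R^n that
   extends it; membership only depends on the values on [t0, t1]. *)
Definition optimal_synthesis A B c : set (R * R * (R -> 'cV[R]_n)) :=
  [set p | let: (t0, t1, x) := p in
    t0 < t1 /\ exists x0 x1 u, minimizer A B c t0 t1 x0 x1 x u].

Definition equivalent_costs A B c1 c2 : Prop :=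
  optimal_synthesis A B c1 = optimal_synthesis A B c2.

End LinearSystems.

Section ProductStructure.
Variable R : realType.

(* X is cut into blocks of size p i x q j along the given decompositions of
   its dimensions; the off-diagonal blocks must vanish. *)
Definition block_diagonal a b N (p q : 'I_N -> nat)
    (ea : (\sum_i p i)%N = a) (eb : (\sum_i q i)%N = b) (X : 'M[R]_(a, b))
    : Prop :=
  forall i j, i != j -> submxblock (castmx (esym ea, esym eb) X) i j = 0.

Definition admits_product_structure n m
    (A : R -> 'M[R]_n) (B : R -> 'M[R]_(n, m))
    (K : R -> 'M[R]_(m, n)) (W : R -> 'M[R]_m) : Prop :=
  exists (N : nat) (n_ m_ : 'I_N -> nat)
         (en : (\sum_i n_ i)%N = n) (em : (\sum_i m_ i)%N = m)
         (M : R -> 'M[R]_n) (U : R -> 'M[R]_m),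
  [/\ (1 < N)%N,
      forall i, (0 < m_ i <= n_ i)%N,
      smooth M /\ (forall t, M t \in unitmx),
      smooth U /\ (forall t, U t \in unitmx)
    & forall t,
      [/\ block_diagonal en en
            (invmx (M t) *m (- derive1 M t + (A t - B t *m K t) *m M t)),
          block_diagonal en em (invmx (M t) *m B t *m U t)
        & block_diagonal em em ((U t)^T *m W t *m U t)]].

End ProductStructure.

(* Main.v *)
(* After the feedback [v = u + K x] the extremals of the cost are the
   solutions of x' = F x + B W^-1 B^T p, p' = - F^T p, with F = A - B K, and by
   convexity every extremal is optimal; on windows longer than the
   controllability time the optimal trajectories are extremals.  Two equivalent
   costs thus have the same state curves x, hence the same controls.  Curves
   with p = 0 decay, and observability forces their costate for the second cost
   to vanish, so both costs have the same K.  With V the flow of F and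
   beta = V^-1 B, comparing controls gives a constant matrix P such that
   P beta(t) = beta(t) W(t)^-1 W~(t).  P is self-adjoint for the Gramian, and it
   is not scalar because W <> W~ while det W(0) = det W~(0) = 1; a spectral
   projection of P, transported by V, splits the state space, and the same
   polynomial in W^-1 W~ splits the input space, along a frame moved by Kato's
   transport equation.  Conversely, a product structure splits every competitor
   into independent ones, so the blocks of the cost may be rescaled separately. *)
Require Import Defs.
From HB Require Import structures.
From mathcomp Require Import all_boot all_order all_algebra.
From mathcomp Require Import all_classical all_reals all_analysis.
From mathcomp Require Import measurable_realfun complex ring lra.
Import Order.TTheory GRing.Theory Num.Theory.
Import numFieldNormedType.Exports.
Set Implicit Arguments.
Unset Strict Implicit.
Unset Printing Implicit Defensive.
Local Open Scope ring_scope.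
Local Open Scope classical_set_scope.

(** * Matrix calculus and smoothness *)

Section MatrixDerivatives.
Variable R : realType.

(** Two obstacles shape the proof. Controls are only square integrable and competitors are
    Caratheodory solutions, so a competitor has no pointwise derivative to compute with: everything
    about competitors passes through an integral product rule, and minimizers are identified with
    extremals by testing the difference of two states against all costates, never through
    almost-everywhere equality of controls. Moreover, the equality of the feedbacks needs
    observability in quantitative form, with a constant uniform in the initial time: the implication
    from [B^T p = 0] to [p = 0] would not turn decay of [B^T p] into decay of [p]. The estimate
    comes from the open-loop Gramian bound and a Gronwall comparison of open-loop and closed-loop
    costates. Extremals are smooth on the whole line and parametrized by their data (x, p) at time
    0; the data found on different windows agree, which is why [P] does not depend on time. In the
    converse direction all blocks but one are merged, and the weights [2 ^+ b] and [2 ^- a] on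
    blocks with [a] and [b] inputs keep the determinant equal to 1. *)

Lemma eq_is_derive (V : normedModType R) (f : R -> V) t (D D' : V) :
  is_derive t (1 : R) f D -> D = D' -> is_derive t (1 : R) f D'.
Proof. by move=> + <-. Qed.

Lemma is_derive_mxP n m (F : R -> 'M[R]_(n, m)) t (D : 'M[R]_(n, m)) :
  is_derive t (1 : R) F D <->
  forall i j, is_derive t (1 : R) (fun s => F s i j) (D i j).
Proof.
split=> [[dF <-] i j|dF].
  have dFij := (derivable_mxP F t 1).1 dF.
  apply: DeriveDef; first exact: dFij.
  by rewrite derive_mx// mxE.
have dF' : derivable F t 1 by apply/derivable_mxP => i j; case: (dF i j).
apply: DeriveDef => //; rewrite derive_mx//; apply/matrixP => i j.
by rewrite mxE; case: (dF i j).
Qed.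

Lemma is_derive_sumr n (f : 'I_n -> R -> R) t (df : 'I_n -> R) :
  (forall i, is_derive t (1 : R) (f i) (df i)) ->
  is_derive t (1 : R) (fun s => \sum_i f i s) (\sum_i df i).
Proof.
move=> H; have := is_derive_sum H.
suff -> : \sum_(i < n) f i = (fun s => \sum_i f i s) by [].
by apply/funext => s; rewrite fct_sumE.
Qed.

Lemma is_derive_mulmx n m p (F : R -> 'M[R]_(n, m)) (G : R -> 'M[R]_(m, p)) t
    (dF : 'M[R]_(n, m)) (dG : 'M[R]_(m, p)) :
  is_derive t (1 : R) F dF -> is_derive t (1 : R) G dG ->
  is_derive t (1 : R) (fun s => F s *m G s) (dF *m G t + F t *m dG).
Proof.
move=> /is_derive_mxP hF /is_derive_mxP hG; apply/is_derive_mxP => i j.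
rewrite !mxE -big_split /=.
under [X in is_derive _ _ X]eq_fun do rewrite mxE.
apply: is_derive_sumr => k.
have hFk := hF i k; have hGk := hG k j.
apply: eq_is_derive (is_deriveM hFk hGk) _.
by rewrite addrC; congr (_ + _); exact: mulrC.
Qed.

Lemma is_derive_trmx n m (F : R -> 'M[R]_(n, m)) t (dF : 'M[R]_(n, m)) :
  is_derive t (1 : R) F dF ->
  is_derive t (1 : R) (fun s => (F s)^T) dF^T.
Proof.
move=> /is_derive_mxP hF; apply/is_derive_mxP => i j; rewrite mxE.
by under [X in is_derive _ _ X]eq_fun do rewrite mxE; exact: hF.
Qed.

Lemma is_derive_mxD n m (F G : R -> 'M[R]_(n, m)) t (dF dG : 'M[R]_(n, m)) :
  is_derive t (1 : R) F dF -> is_derive t (1 : R) G dG ->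
  is_derive t (1 : R) (fun s => F s + G s) (dF + dG).
Proof. exact: is_deriveD. Qed.

Lemma is_derive_mxB n m (F G : R -> 'M[R]_(n, m)) t (dF dG : 'M[R]_(n, m)) :
  is_derive t (1 : R) F dF -> is_derive t (1 : R) G dG ->
  is_derive t (1 : R) (fun s => F s - G s) (dF - dG).
Proof. exact: is_deriveB. Qed.

Lemma is_derive_mul1mx n m p (C : 'M[R]_(n, m)) (G : R -> 'M[R]_(m, p)) t
    (dG : 'M[R]_(m, p)) :
  is_derive t (1 : R) G dG -> is_derive t (1 : R) (fun s => C *m G s) (C *m dG).
Proof.
move=> hG; apply: eq_is_derive (is_derive_mulmx (is_derive_cst C t 1) hG) _.
by rewrite mul0mx add0r.
Qed.

Lemma is_derive_mulmx1 n m p (F : R -> 'M[R]_(n, m)) (C : 'M[R]_(m, p)) t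
    (dF : 'M[R]_(n, m)) :
  is_derive t (1 : R) F dF -> is_derive t (1 : R) (fun s => F s *m C) (dF *m C).
Proof.
move=> hF; apply: eq_is_derive (is_derive_mulmx hF (is_derive_cst C t 1)) _.
by rewrite mulmx0 addr0.
Qed.

Lemma is_derive_mx_cst n m (F : R -> 'M[R]_(n, m)) :
  (forall t, is_derive t (1 : R) F 0) -> forall a b, F a = F b.
Proof.
move=> dF a b; apply/matrixP => i j.
apply: (@is_derive_0_is_cst _ (fun s => F s i j)) => t.
by have /is_derive_mxP/(_ i j) := dF t; rewrite mxE.
Qed.

Lemma is_derive_cts n m (F : R -> 'M[R]_(n, m)) t (D : 'M[R]_(n, m)) :
  is_derive t (1 : R) F D -> {for t, continuous F}.
Proof. by case=> dF _; apply/differentiable_continuous/derivable1_diffP. Qed.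

Lemma is_derive_derive1 n m (F : R -> 'M[R]_(n, m)) t (D : 'M[R]_(n, m)) :
  is_derive t (1 : R) F D -> derive1 F t = D.
Proof. by move=> dF; rewrite derive1E derive_val. Qed.

End MatrixDerivatives.

Section Smoothness.
Variable R : realType.
Implicit Types f g : R -> R.

(** Differentiability [k + 1] times. Recursing on the derivative gives closure under products and
    inverses by induction on [k], without a Leibniz formula for higher derivatives. *)
Fixpoint Cn (k : nat) f : Prop :=
  (forall t, derivable f t (1 : R)) /\ if k is j.+1 then Cn j (derive1 f) else True.

Lemma Cn_der k f : Cn k f -> forall t, is_derive t (1 : R) f (derive1 f t).
Proof.
by case: k => [|k] [df _] t; rewrite derive1E; apply: derivableP; exact: df.
Qed.

Lemma CnS k f : Cn k.+1 f -> Cn k f.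
Proof. by elim: k f => [|k IH] f [df Cf]; split => //; exact: IH. Qed.

Lemma CnI k f g : (forall t, is_derive t (1 : R) f (g t)) -> Cn k g -> Cn k.+1 f.
Proof.
move=> fg Cg; split=> [t|]; first by case: (fg t).
by have -> : derive1 f = g by apply/funext => t; rewrite derive1E derive_val.
Qed.

Lemma Cn0I f g : (forall t, is_derive t (1 : R) f (g t)) -> Cn 0 f.
Proof. by move=> fg; split=> // t; case: (fg t). Qed.

Lemma Cn_cst k (c : R) : Cn k (fun=> c).
Proof.
elim: k c => [|k IH] c; first by apply: (@Cn0I _ (fun=> 0)) => t; exact: is_derive_cst.
by apply: CnI (IH 0) => t; exact: is_derive_cst.
Qed.

Lemma CnD k f g : Cn k f -> Cn k g -> Cn k (fun t => f t + g t).
Proof.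
elim: k f g => [|k IH] f g Cf Cg.
  apply: Cn0I => t; exact: is_deriveD (Cn_der Cf t) (Cn_der Cg t).
apply: CnI (IH _ _ Cf.2 Cg.2) => t; exact: is_deriveD (Cn_der Cf t) (Cn_der Cg t).
Qed.

Lemma CnM k f g : Cn k f -> Cn k g -> Cn k (fun t => f t * g t).
Proof.
elim: k f g => [|k IH] f g Cf Cg.
  apply: Cn0I => t; exact: is_deriveM (Cn_der Cf t) (Cn_der Cg t).
apply: (@CnI _ _ (fun t => f t * derive1 g t + g t * derive1 f t)) => [t|].
  exact: is_deriveM (Cn_der Cf t) (Cn_der Cg t).
apply: CnD; apply: IH; [exact: CnS|exact: Cg.2|exact: CnS|exact: Cf.2].
Qed.

Lemma CnV k f : (forall t, f t != 0) -> Cn k f -> Cn k (fun t => (f t)^-1).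
Proof.
move=> f0; elim: k => [|k IH] Cf.
  by apply: Cn0I => t; exact: is_deriveV (f0 t) (Cn_der Cf t).
apply: (@CnI _ _ (fun t => (- 1) * ((f t)^-1 * (f t)^-1) * derive1 f t)) => [t|].
  apply: eq_is_derive (is_deriveV (f0 t) (Cn_der Cf t)) _.
  by rewrite /GRing.scale /= mulN1r expr2 invfM.
have CV := IH (CnS Cf).
by apply: CnM Cf.2; apply: CnM (CnM CV CV); exact: Cn_cst.
Qed.

Lemma Cn_sum k (I : Type) (r : seq I) (P : pred I) (f : I -> R -> R) :
  (forall i, P i -> Cn k (f i)) -> Cn k (fun t => \sum_(i <- r | P i) f i t).
Proof.
move=> Cf; elim: r => [|i r IH].
  by under eq_fun do rewrite big_nil; exact: Cn_cst.
under eq_fun do rewrite big_cons.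
case Pi: (P i) => //; exact: CnD (Cf _ Pi) IH.
Qed.

Lemma Cn_prod k (I : Type) (r : seq I) (P : pred I) (f : I -> R -> R) :
  (forall i, P i -> Cn k (f i)) -> Cn k (fun t => \prod_(i <- r | P i) f i t).
Proof.
move=> Cf; elim: r => [|i r IH].
  by under eq_fun do rewrite big_nil; exact: Cn_cst.
under eq_fun do rewrite big_cons.
case Pi: (P i) => //; exact: CnM (Cf _ Pi) IH.
Qed.

Lemma smooth_Cn n m (F : R -> 'M[R]_(n, m)) :
  smooth F <-> forall k i j, Cn k (fun t => F t i j).
Proof.
have der1 (G : R -> 'M[R]_(n, m)) : (forall t, derivable G t 1) -> forall i j,
    (fun t => derive1 G t i j) = derive1 (fun t => G t i j).
  move=> dG i j; apply/funext => t; rewrite !derive1E.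
  by rewrite derive_mx ?mxE//; exact: dG.
split=> [sF k|CF k].
  elim: k F sF => [|k IH] F sF i j; have dF := sF 0%N.
    split=> // t; exact: (derivable_mxP F t 1).1 (dF t) i j.
  split=> [t|]; first exact: (derivable_mxP F t 1).1 (dF t) i j.
  by rewrite -der1//; apply: IH => l t; rewrite -derive1Sn; exact: (sF l.+1).
elim: k F CF => [|k IH] F CF t.
  by apply/derivable_mxP => i j; have [+ _] := CF 0%N i j; exact.
rewrite derive1Sn; apply: IH => l i j.
rewrite der1 => [|s]; first by have [] := CF l.+1 i j.
by apply/derivable_mxP => a b; have [+ _] := CF 0%N a b; exact.
Qed.

Lemma smooth_derive n m (F : R -> 'M[R]_(n, m)) : smooth F ->
  forall t, is_derive t (1 : R) F (derive1 F t).
Proof. by move=> sF t; rewrite derive1E; apply: derivableP; exact: (sF 0%N). Qed.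

Lemma smooth_derive1 n m (F : R -> 'M[R]_(n, m)) : smooth F -> smooth (derive1 F).
Proof. by move=> sF k t; rewrite -derive1Sn; exact: (sF k.+1). Qed.

Lemma smooth_cts n m (F : R -> 'M[R]_(n, m)) : smooth F -> continuous F.
Proof. by move=> sF t; apply: is_derive_cts (smooth_derive sF t). Qed.

Lemma smooth_cst n m (C : 'M[R]_(n, m)) : smooth (fun=> C).
Proof. by apply/smooth_Cn => k i j; exact: Cn_cst. Qed.

Lemma smoothD n m (F G : R -> 'M[R]_(n, m)) :
  smooth F -> smooth G -> smooth (fun t => F t + G t).
Proof.
move=> /smooth_Cn sF /smooth_Cn sG; apply/smooth_Cn => k i j.
by under eq_fun do rewrite mxE; exact: CnD.
Qed.

Lemma smoothZ n m c (F : R -> 'M[R]_(n, m)) : smooth F -> smooth (fun t => c *: F t).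
Proof.
move=> /smooth_Cn sF; apply/smooth_Cn => k i j.
under eq_fun do rewrite mxE.
by apply: CnM => //; exact: Cn_cst.
Qed.

Lemma smoothB n m (F G : R -> 'M[R]_(n, m)) :
  smooth F -> smooth G -> smooth (fun t => F t - G t).
Proof.
move=> sF sG; apply: smoothD; first exact: sF.
by under eq_fun do rewrite -scaleN1r; exact: smoothZ.
Qed.

Lemma smoothM n m p (F : R -> 'M[R]_(n, m)) (G : R -> 'M[R]_(m, p)) :
  smooth F -> smooth G -> smooth (fun t => F t *m G t).
Proof.
move=> /smooth_Cn sF /smooth_Cn sG; apply/smooth_Cn => k i j.
under eq_fun do rewrite mxE.
by apply: Cn_sum => l _; exact: CnM.
Qed.

Lemma smooth_tr n m (F : R -> 'M[R]_(n, m)) : smooth F -> smooth (fun t => (F t)^T).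
Proof.
move=> /smooth_Cn sF; apply/smooth_Cn => k i j.
by under eq_fun do rewrite mxE; exact: sF.
Qed.

Lemma Cn_det k n (F : R -> 'M[R]_n) :
  (forall i j, Cn k (fun t => F t i j)) -> Cn k (fun t => \det (F t)).
Proof.
move=> CF; apply: Cn_sum => s _; apply: CnM; first exact: Cn_cst.
by apply: Cn_prod => i _; exact: CF.
Qed.

Lemma smooth_inv n (F : R -> 'M[R]_n) :
  (forall t, F t \in unitmx) -> smooth F -> smooth (fun t => invmx (F t)).
Proof.
move=> uF /smooth_Cn sF; apply/smooth_Cn => k i j.
under eq_fun do rewrite /invmx uF !mxE.
apply: CnM; first by apply: CnV; [move=> t; rewrite -unitfE -unitmxE|exact: Cn_det].
rewrite /cofactor; apply: CnM; first exact: Cn_cst.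
by apply: Cn_det => a b; under eq_fun do rewrite !mxE; exact: sF.
Qed.

(** Bootstrapping: the derivative is a polynomial in the entries of [A] and [F], so it is as regular
    as [F] is already known to be, and [F] gains one order. *)
Lemma smooth_ode n m (A : R -> 'M[R]_n) (F : R -> 'M[R]_(n, m)) : smooth A ->
  (forall t, is_derive t (1 : R) F (A t *m F t)) -> smooth F.
Proof.
move=> /smooth_Cn sA dF; apply/smooth_Cn.
have dFij t i j : is_derive t (1 : R) (fun s => F s i j) (\sum_l A t i l * F t l j).
  by have /is_derive_mxP/(_ i j) := dF t; rewrite mxE.
elim=> [|k IH] i j; first exact: (Cn0I (fun t => dFij t i j)).
apply: (CnI (fun t => dFij t i j)).
by apply: Cn_sum => l _; apply: CnM; [exact: sA|exact: IH].
Qed.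

(** Differentiability comes from the cofactor formula; the value then follows by differentiating
    [F F^-1 = 1]. *)
Lemma is_derive_invmx n (F : R -> 'M[R]_n) (D : R -> 'M[R]_n) :
  (forall t, F t \in unitmx) -> smooth F ->
  (forall t, is_derive t (1 : R) F (D t)) ->
  forall t, is_derive t (1 : R) (fun s => invmx (F s))
    (- (invmx (F t) *m D t *m invmx (F t))).
Proof.
move=> uF sF dF t.
have dV := smooth_derive (smooth_inv uF sF) t.
apply: eq_is_derive dV _; set V := derive1 _ t.
have dFV : is_derive t (1 : R) (fun s => F s *m invmx (F s)) 0.
  by under [X in is_derive _ _ X]eq_fun do rewrite mulmxV//; exact: is_derive_cst.
have := is_derive_mulmx (dF t) (smooth_derive (smooth_inv uF sF) t).
move=> /(@derive_val _ _ _ _ _ _ _); rewrite (@derive_val _ _ _ _ _ _ _ dFV) => /esym/eqP.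
rewrite addrC addr_eq0 => /eqP/(congr1 (mulmx (invmx (F t)))).
by rewrite mulKmx// mulmxN mulmxA.
Qed.

End Smoothness.

(** * Integrals on segments *)

Section IntegralsOnSegments.
Variable R : realType.
Local Notation mu := (@lebesgue_measure R).
Implicit Types (a b c t : R) (f g : R -> R).

Definition L1 a b f := mu.-integrable `[a, b] (EFin \o f).
Definition L2 a b f :=
  measurable_fun `[a, b] f /\ mu.-integrable `[a, b] (fun t => (f t ^+ 2)%:E).

Local Notation J a b f := (\int[mu]_(s in `[a, b]) f s).

Lemma within_bounded a b f : {within `[a, b], continuous f} ->
  exists2 M : R, 0 < M & forall t, a <= t <= b -> `|f t| <= M.
Proof.
move=> cf; have [M [Mr HM]] := compact_bounded (continuous_compact cf (@segment_compact R a b)).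
exists (`|M| + 1) => [|t tab]; first by rewrite ltr_wpDl.
apply: HM; first by rewrite ltr_pwDr// ler_norm.
by exists t => //=; rewrite in_itv.
Qed.

Lemma cts_L1 a b f : {within `[a, b], continuous f} -> L1 a b f.
Proof. move=> cf; exact: continuous_compact_integrable (@segment_compact R a b) cf. Qed.

Lemma cts_measurable a b f : {within `[a, b], continuous f} -> measurable_fun `[a, b] f.
Proof. by move=> cf; exact: subspace_continuous_measurable_fun. Qed.

Lemma L1_sub a b c d f : a <= c -> d <= b -> L1 a b f -> L1 c d f.
Proof.
move=> ac db; apply: integrableS => //.
by apply: subset_itv; rewrite bnd_simp.
Qed.

Lemma within_sub a b c d (T : topologicalType) (f : R -> T) : a <= c -> d <= b ->
  {within `[a, b], continuous f} -> {within `[c, d], continuous f}.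
Proof.
move=> ac db; apply: continuous_subspaceW.
by apply: subset_itv; rewrite bnd_simp.
Qed.

Lemma L2_le a b f g : measurable_fun `[a, b] f -> L1 a b g ->
  (forall t, a <= t <= b -> f t ^+ 2 <= g t) -> L2 a b f.
Proof.
move=> mf ig fg; split=> //.
apply: le_integrable ig => //.
  by apply/measurable_EFinP; exact: measurable_funX.
move=> t /=; rewrite in_itv/= => /fg fgt.
by rewrite lee_fin ger0_norm ?sqr_ge0// (le_trans fgt)// ler_norm.
Qed.

Lemma L1_le a b f g : measurable_fun `[a, b] f -> L1 a b g ->
  (forall t, a <= t <= b -> `|f t| <= g t) -> L1 a b f.
Proof.
move=> mf ig fg; apply: le_integrable ig => //; first exact/measurable_EFinP.
move=> t /=; rewrite in_itv/= => /fg fgt.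
by rewrite lee_fin (le_trans fgt)// ler_norm.
Qed.

Lemma L1D a b f g : L1 a b f -> L1 a b g -> L1 a b (fun t => f t + g t).
Proof. by move=> If Ig; apply: eq_integrable (integrableD _ If Ig). Qed.

Lemma L1Z a b k f : L1 a b f -> L1 a b (fun t => k * f t).
Proof. by move=> If; apply: eq_integrable (integrableZl _ k If). Qed.

Lemma L1_sum a b n (f : 'I_n -> R -> R) :
  (forall i, L1 a b (f i)) -> L1 a b (fun t => \sum_i f i t).
Proof.
move=> If; rewrite /L1.
apply: eq_integrable (integrable_sum _ (index_enum 'I_n) (fun i (_ : predT i) => If i)) => //.
by move=> t _ /=; rewrite sumEFin.
Qed.

Lemma Rintegral_sum a b n (f : 'I_n -> R -> R) : (forall i, L1 a b (f i)) ->
  J a b (fun t => \sum_i f i t) = \sum_i J a b (f i).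
Proof.
elim: n f => [|n IH] f If.
  under eq_Rintegral do rewrite big_ord0.
  by rewrite big_ord0 /Rintegral integral0.
under eq_Rintegral do rewrite big_ord_recl.
rewrite big_ord_recl RintegralD//; [|exact: If|by apply: L1_sum => i; exact: If].
by congr (_ + _); apply: IH => i.
Qed.

Lemma L2_cts a b f : {within `[a, b], continuous f} -> L2 a b f.
Proof.
move=> cf; have [M M0 fM] := within_bounded cf.
apply: (@L2_le _ _ _ (fun=> M ^+ 2)); first exact: cts_measurable.
  by apply: cts_L1; apply: continuous_subspaceT => t; exact: cvg_cst.
by move=> t /fM fMt; rewrite -real_normK ?num_real// lerXn2r ?nnegrE// ltW.
Qed.

Lemma L2_mul a b f g : L2 a b f -> L2 a b g -> L1 a b (fun t => f t * g t).
Proof.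
move=> [mf If] [mg Ig].
apply: (@L1_le _ _ _ (fun t => f t ^+ 2 + g t ^+ 2)); first exact: measurable_funM.
  exact: L1D.
move=> t _; rewrite normrM -[f t ^+ 2]real_normK ?num_real//.
rewrite -[g t ^+ 2]real_normK ?num_real//.
have := sqr_ge0 (`|f t| - `|g t|); nra.
Qed.

Lemma L2D a b f g : L2 a b f -> L2 a b g -> L2 a b (fun t => f t + g t).
Proof.
move=> [mf If] [mg Ig].
apply: (@L2_le _ _ _ (fun t => 2 * f t ^+ 2 + 2 * g t ^+ 2)); first exact: measurable_funD.
  by apply: L1D; exact: L1Z.
by move=> t _; have := sqr_ge0 (f t - g t); nra.
Qed.

Lemma L2_ctsM a b f g :
  {within `[a, b], continuous f} -> L2 a b g -> L2 a b (fun t => f t * g t).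
Proof.
move=> cf [mg Ig]; have [M M0 fM] := within_bounded cf.
apply: (@L2_le _ _ _ (fun t => M ^+ 2 * g t ^+ 2)).
- by apply: measurable_funM => //; exact: cts_measurable.
- exact: L1Z.
- move=> t /fM fMt; rewrite exprMn ler_wpM2r ?sqr_ge0//.
  by rewrite -real_normK ?num_real// lerXn2r ?nnegrE// ltW.
Qed.

Lemma L2_cst a b k : L2 a b (fun=> k).
Proof. by apply: L2_cts; apply: continuous_subspaceT => t; exact: cvg_cst. Qed.

Lemma L2_L1 a b f : L2 a b f -> L1 a b f.
Proof.
move=> fL2; have := L2_mul fL2 (L2_cst a b 1).
by rewrite (_ : (fun t => f t * 1) = f)//; apply/funext => t; rewrite mulr1.
Qed.

Lemma L2_sum a b n (f : 'I_n -> R -> R) :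
  (forall i, L2 a b (f i)) -> L2 a b (fun t => \sum_i f i t).
Proof.
elim: n f => [|n IH] f Hf; first by under eq_fun do rewrite big_ord0; exact: L2_cst.
under eq_fun do rewrite big_ord_recl.
by apply: L2D => //; apply: IH => i.
Qed.

Lemma L1_ctsM a b f g :
  {within `[a, b], continuous f} -> L1 a b g -> L1 a b (fun t => f t * g t).
Proof.
move=> cf Ig; have [M M0 fM] := within_bounded cf.
apply: (@L1_le _ _ _ (fun t => M * `|g t|)).
- apply: measurable_funM; first exact: cts_measurable.
  by apply/measurable_EFinP; exact: measurable_int Ig.
- by apply: L1Z; exact: integrable_norm.
- by move=> t /fM fMt; rewrite normrM ler_wpM2r.
Qed.

Lemma RintegralD_chasles a b c f : a <= c <= b -> L1 a b f ->
  J a b f = J a c f + J c b f.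
Proof.
move=> /andP[ac cb] If.
have := @Rintegral_itvB R f (BLeft a) (BRight b) c If.
rewrite !bnd_simp => /(_ ac cb) /eqP; rewrite subr_eq addrC => /eqP ->.
congr (_ + _); apply: Rintegral_itv_obnd_cbnd.
apply: integrableS If => //.
by apply: subset_itv; rewrite bnd_simp.
Qed.

Lemma Rintegral_le a b f g : L1 a b f -> L1 a b g ->
  (forall t, a <= t <= b -> f t <= g t) -> J a b f <= J a b g.
Proof.
by move=> If Ig fg; apply: le_Rintegral => // t /=; rewrite in_itv/=; exact: fg.
Qed.

Lemma Rintegral_nneg a b f : (forall t, a <= t <= b -> 0 <= f t) -> 0 <= J a b f.
Proof. by move=> f0; apply: Rintegral_ge0 => t /=; rewrite in_itv/=; exact: f0. Qed.

Lemma Rintegral_eq a b f g : (forall t, a <= t <= b -> f t = g t) -> J a b f = J a b g.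
Proof. by move=> fg; apply: eq_Rintegral => t; rewrite inE/= in_itv/=; exact: fg. Qed.

Lemma Rintegral_ftc a b (F : R -> R) f : a <= b ->
  (forall t, is_derive t (1 : R) F (f t)) -> continuous f -> J a b f = F b - F a.
Proof.
rewrite le_eqVlt => /predU1P[<-|ab] dF cf.
  by rewrite set_itv1 Rintegral_set1 subrr.
have cF : continuous F.
  by move=> t; apply/differentiable_continuous/derivable1_diffP; case: (dF t).
rewrite /Rintegral (@continuous_FTC2 _ f F)//.
- exact: continuous_subspaceT.
- split.
  + by move=> t _; case: (dF t).
  + exact/cvg_at_right_filter/cF.
  + exact/cvg_at_left_filter/cF.
- by move=> t _; rewrite derive1E derive_val.
Qed.

(* Over [N] equal pieces the increments of [D] add up to [O(1/N)]. *)
Lemma eq_of_increment_le a b (D H : R -> R) C : a <= b ->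
  (forall t t', a <= t -> t <= t' -> t' <= b ->
     `|D t' - D t| <= C * (t' - t) * (H t' - H t)) -> D b = D a.
Proof.
move=> ab HD.
suff small N : `|D b - D a| <= C * (b - a) * (H b - H a) / N.+1%:R.
  apply/eqP; rewrite -subr_eq0 -normr_le0; apply/ler_addgt0Pr => e e0; rewrite add0r.
  set K := C * (b - a) * (H b - H a) in small.
  have K0 : 0 <= K.
    by apply: le_trans (normr_ge0 _) _; have := small 0%N; rewrite divr1; exact.
  apply: le_trans (small (Num.truncn (K / e))) _.
  rewrite ler_pdivrMr// mulrC -ler_pdivrMr//.
  by rewrite ltW// truncnS_gt.
pose p (k : nat) := a + (b - a) * (k%:R / N.+1%:R).
have p0 : p 0%N = a by rewrite /p mul0r mulr0 addr0.
have pN : p N.+1 = b by rewrite /p divff ?pnatr_eq0// mulr1 addrC subrK.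
have ba0 : 0 <= b - a by rewrite subr_ge0.
have step k : p k.+1 - p k = (b - a) / N.+1%:R.
  by rewrite /p opprD addrACA subrr add0r -mulrBr -mulrBl -natrB// subSnn mul1r.
have pmono k : p k <= p k.+1 by rewrite -subr_ge0 step divr_ge0.
have pa k : a <= p k by rewrite lerDl mulr_ge0// divr_ge0.
have pb k : (k <= N.+1)%N -> p k <= b.
  move=> kN; rewrite -pN lerD2l ler_wpM2l// ler_wpM2r ?invr_ge0// ler_nat//.
have : forall k, (k <= N.+1)%N ->
    `|D (p k) - D a| <= C * ((b - a) / N.+1%:R) * (H (p k) - H a).
  elim=> [_|k IH kN]; first by rewrite p0 !subrr mulr0 normr0.
  have -> : D (p k.+1) - D a = (D (p k.+1) - D (p k)) + (D (p k) - D a) by ring.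
  have -> : H (p k.+1) - H a = (H (p k.+1) - H (p k)) + (H (p k) - H a) by ring.
  apply: le_trans (ler_normD _ _) _; rewrite mulrDr lerD//; last exact/IH/ltnW.
  by rewrite -(step k); apply: HD => //; exact: pb.
move=> /(_ N.+1 (leqnn _)); rewrite pN => /le_trans; apply.
by rewrite le_eqVlt; apply/orP; left; apply/eqP; ring.
Qed.

End IntegralsOnSegments.

(** * Integration by parts against Caratheodory solutions *)

Section ProductRule.
Variable R : realType.
Local Notation mu := (@lebesgue_measure R).
Local Notation J a b f := (\int[mu]_(s in `[a, b]) f s).

Lemma Rintegral_const (a b k : R) : a <= b -> J a b (fun=> k) = k * (b - a).
Proof.
move=> ab; rewrite Rintegral_cst//; congr (_ * _).
rewrite /= lebesgue_measure_itv /= lte_fin.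
move: ab; rewrite le_eqVlt => /predU1P[->|->]; last by rewrite -EFinB.
by rewrite ltxx subrr.
Qed.

Lemma normr_Rintegral_le (a b : R) f : L1 a b f ->
  `|J a b f| <= J a b (fun s => `|f s|).
Proof. by move=> If; exact: le_normr_Rintegral. Qed.

Lemma L1_norm (a b : R) f : L1 a b f -> L1 a b (fun s => `|f s|).
Proof. exact: integrable_norm. Qed.

(** Here [z] is only a primitive of an integrable [g], so [p z] cannot be differentiated pointwise.
    Instead the defect [D = p z - J q] has increments bounded by the length of the interval times
    the increment of [H], the variation of [z]; such a function takes the same value at both
    ends. *)
Lemma Rintegral_product (a b : R) (p p' z g : R -> R) : a <= b ->
    (forall t, is_derive t (1 : R) p (p' t)) -> continuous p' ->
    {within `[a, b], continuous z} -> L1 a b g ->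
    (forall t, a <= t <= b -> z t = z a + J a t g) ->
  p b * z b = p a * z a + J a b (fun s => p' s * z s + p s * g s).
Proof.
move=> ab dp cp' cz Ig zE.
have cp : continuous p.
  by move=> t; apply/differentiable_continuous/derivable1_diffP; case: (dp t).
set q := (X in J a b X).
have Iq : L1 a b q.
  apply: L1D; last by apply: L1_ctsM => //; exact: continuous_subspaceT.
  by apply: L1_ctsM; [exact: continuous_subspaceT|exact: cts_L1].
have [M M0 p'M] := within_bounded (continuous_subspaceT (A := `[a, b]) cp').
pose H t := J a t (fun s => `|g s|).
pose D t := p t * z t - J a t q.
suff : D b = D a.
  rewrite /D set_itv1 Rintegral_set1 subr0 => /eqP; rewrite subr_eq => /eqP ->.
  by [].
apply: (@eq_of_increment_le _ _ _ D H (2 * M) ab) => t t' at_ tt' t'b.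
have at' := le_trans at_ tt'; have tb := le_trans tt' t'b.
have zd s : t <= s <= t' -> z t' - z s = J s t' g.
  move=> /andP[ts st'].
  have as_ := le_trans at_ ts; have sb := le_trans st' t'b.
  rewrite (zE t') ?at'// (zE s) ?as_// (@RintegralD_chasles _ _ _ s) ?as_//.
    by ring.
  exact: L1_sub Ig.
have Hd s : t <= s <= t' -> H t' - H s = J s t' (fun r => `|g r|).
  move=> /andP[ts st'].
  have as_ := le_trans at_ ts; have sb := le_trans st' t'b.
  rewrite /H (@RintegralD_chasles _ _ _ s) ?as_//; first by ring.
  by apply: (L1_sub _ _ (L1_norm Ig)).
have IgS s : t <= s <= t' -> L1 s t' g.
  by move=> /andP[ts st']; apply: (L1_sub _ _ Ig) => //; exact: le_trans ts.
have zb s : t <= s <= t' -> `|z t' - z s| <= H t' - H t.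
  move=> tst'; rewrite zd//; apply: le_trans (normr_Rintegral_le (IgS _ tst')) _.
  rewrite -Hd// lerD2l lerN2 -subr_ge0.
  move/andP: tst' => [ts st']; have as_ := le_trans at_ ts.
  rewrite /H (@RintegralD_chasles _ _ _ t) ?at_//.
    by rewrite [X in 0 <= X](_ : _ = J t s (fun s0 => `|g s0|)) ?Rintegral_nneg//; ring.
  apply: (L1_sub _ _ (L1_norm Ig)) => //; exact: le_trans st' t'b.
have pb s : t <= s <= t' -> `|p t - p s| <= M * (t' - t).
  move=> /andP[ts st']; rewrite distrC -(Rintegral_ftc ts dp cp').
  have Ip' : L1 t s p' by apply: cts_L1; exact: continuous_subspaceT.
  apply: le_trans (normr_Rintegral_le Ip') _.
  apply: (@le_trans _ _ (J t s (fun=> M))).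
    apply: Rintegral_le; [exact: L1_norm|exact/L2_L1/L2_cst|].
    move=> r /andP[tr rs]; apply: p'M; rewrite (le_trans at_ tr)/=.
    by rewrite (le_trans rs)// (le_trans st').
  by rewrite Rintegral_const// ler_wpM2l// ?lerD2r// ltW.
have Ip' : L1 t t' p' by apply: cts_L1; exact: continuous_subspaceT.
have Igt : L1 t t' g by apply: IgS; rewrite lexx.
have Iqt : L1 t t' q by apply: (L1_sub _ _ Iq).
(* Comparing [z s] with its value at the right end and [p s] with its value at the left end leaves a
   product of two small quantities in each term; each contributes [M], whence the constant
   [2 * M]. *)
have DE : D t' - D t =
    J t t' (fun s => p' s * (z t' - z s) + (p t - p s) * g s).
  have -> : D t' - D t = z t' * (p t' - p t) + p t * (z t' - z t) - J t t' q.
    rewrite /D (@RintegralD_chasles _ a t' t) ?at_//; first by ring.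
    exact: (L1_sub _ _ Iq).
  rewrite -(Rintegral_ftc tt' dp cp') zd ?lexx// -!RintegralZl//.
  rewrite -RintegralD//; [|exact: L1Z|exact: L1Z].
  rewrite -RintegralB//; last by apply: L1D; exact: L1Z.
  by apply: Rintegral_eq => s _; rewrite /q; ring.
pose B s := M * (H t' - H t) + M * (t' - t) * `|g s|.
have IB : L1 t t' B by apply: L1D; [exact/L2_L1/L2_cst|exact/L1Z/L1_norm].
have IE : L1 t t' (fun s => p' s * (z t' - z s) + (p t - p s) * g s).
  apply: L1D.
    apply: L1_ctsM; first exact: continuous_subspaceT.
    apply: L1D; first exact/L2_L1/L2_cst.
    rewrite (_ : (fun t0 => - z t0) = (fun t0 => (-1) * z t0)); last first.
      by apply/funext => s; rewrite mulN1r.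
    by apply: L1Z; apply: (L1_sub _ _ (cts_L1 cz)).
  apply: L1_ctsM => //; apply: continuous_subspaceT => s.
  by apply: cvgB; [exact: cvg_cst|exact: cp].
rewrite DE; apply: le_trans (normr_Rintegral_le IE) _.
apply: (@le_trans _ _ (J t t' B)); last first.
  rewrite /B RintegralD//; [|exact/L2_L1/L2_cst|exact/L1Z/L1_norm].
  rewrite Rintegral_const// RintegralZl//; last exact: L1_norm.
  rewrite -Hd ?lexx//.
  by rewrite le_eqVlt; apply/orP; left; apply/eqP; ring.
apply: Rintegral_le => //; first exact: L1_norm.
move=> s /[dup] /andP[ts st'] tst'; apply: le_trans (ler_normD _ _) _.
rewrite !normrM lerD//.
  by apply: ler_pM => //; [apply: p'M; rewrite (le_trans at_ ts)/= (le_trans st')|exact: zb].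
by apply: ler_wpM2r => //; exact: pb.
Qed.

Definition mxL1 n m (a b : R) (F : R -> 'M[R]_(n, m)) :=
  forall i j, L1 a b (fun s => F s i j).

Lemma eq_mx_integral n m (a b : R) (F G : R -> 'M[R]_(n, m)) :
  (forall t, a <= t <= b -> F t = G t) -> mx_integral a b F = mx_integral a b G.
Proof.
by move=> FG; apply/matrixP => i j; rewrite !mxE; apply: Rintegral_eq => t /FG ->.
Qed.

Lemma mx_integralD n m (a b : R) (F G : R -> 'M[R]_(n, m)) :
  mxL1 a b F -> mxL1 a b G ->
  mx_integral a b (fun s => F s + G s) = mx_integral a b F + mx_integral a b G.
Proof.
move=> IF IG; apply/matrixP => i j; rewrite !mxE -RintegralD//; [|exact: IF|exact: IG].
by apply: Rintegral_eq => t _; rewrite mxE.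
Qed.

Lemma mx_integralZ n m (a b k : R) (F : R -> 'M[R]_(n, m)) : mxL1 a b F ->
  mx_integral a b (fun s => k *: F s) = k *: mx_integral a b F.
Proof.
move=> IF; apply/matrixP => i j; rewrite !mxE -RintegralZl//; last exact: IF.
by apply: Rintegral_eq => t _; rewrite mxE.
Qed.

Lemma within_coord n m (A : set R) (F : R -> 'M[R]_(n, m)) i j :
  {within A, continuous F} -> {within A, continuous (fun t => F t i j)}.
Proof.
move=> cF x.
apply: (@continuous_comp _ _ _ (F : subspace A -> 'M[R]_(n, m))
  (fun M : 'M[R]_(n, m) => M i j)); first exact: cF.
exact: coord_continuous.
Qed.

Lemma coord_cts n m (F : R -> 'M[R]_(n, m)) i j :
  continuous F -> continuous (fun t => F t i j).
Proof.
move=> cF x; apply: (@continuous_comp _ _ _ F (fun M : 'M[R]_(n, m) => M i j)).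
  exact: cF.
exact: coord_continuous.
Qed.

Lemma mxL1_ctsM n m p (a b : R) (P : R -> 'M[R]_(n, m)) (F : R -> 'M[R]_(m, p)) :
  {within `[a, b], continuous P} -> mxL1 a b F -> mxL1 a b (fun t => P t *m F t).
Proof.
move=> cP IF i j; under eq_fun do rewrite mxE.
by apply: L1_sum => k; apply: L1_ctsM (IF _ _); exact: within_coord.
Qed.

Lemma mxL1_cts n m (a b : R) (F : R -> 'M[R]_(n, m)) :
  {within `[a, b], continuous F} -> mxL1 a b F.
Proof. by move=> cF i j; apply: cts_L1; exact: within_coord. Qed.

Lemma mxL1D n m (a b : R) (F G : R -> 'M[R]_(n, m)) :
  mxL1 a b F -> mxL1 a b G -> mxL1 a b (fun t => F t + G t).
Proof. by move=> IF IG i j; under eq_fun do rewrite mxE; apply: L1D. Qed.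

Lemma mx_integral_product n m p (a b : R) (P P' : R -> 'M[R]_(n, m))
    (z g : R -> 'M[R]_(m, p)) : a <= b ->
    (forall t, is_derive t (1 : R) P (P' t)) -> continuous P' ->
    {within `[a, b], continuous z} -> mxL1 a b g ->
    (forall t, a <= t <= b -> z t = z a + mx_integral a t g) ->
  P b *m z b = P a *m z a + mx_integral a b (fun s => P' s *m z s + P s *m g s).
Proof.
move=> ab dP cP' cz Ig zE.
have cP : continuous P by move=> t; apply: is_derive_cts (dP t).
apply/matrixP => i j; rewrite !mxE.
under Rintegral_eq do rewrite !mxE -big_split.
rewrite Rintegral_sum; last first.
  move=> k; apply: L1D.
    by apply: L1_ctsM; [apply/continuous_subspaceT/coord_cts|apply/cts_L1/within_coord].
  by apply: L1_ctsM (Ig _ _); apply/continuous_subspaceT/coord_cts.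
rewrite -big_split; apply: eq_bigr => k _.
apply: (@Rintegral_product a b (fun t => P t i k) (fun t => P' t i k)
  (fun t => z t k j) (fun t => g t k j)) => //.
- by move=> t; have /is_derive_mxP := dP t; exact.
- exact: coord_cts.
- exact: within_coord.
- by move=> t tab; rewrite {1}(zE t tab) !mxE.
Qed.

End ProductRule.

(** * Linear differential equations *)

Section LinearODE.
Variable R : realType.
Local Notation mu := (@lebesgue_measure R).
Local Notation J a b f := (\int[mu]_(s in `[a, b]) f s).

Lemma mvt_between (f df : R -> R) (a b : R) :
  (forall t, is_derive t (1 : R) f (df t)) ->
  exists2 c, (a <= c <= b) || (b <= c <= a) & f b - f a = df c * (b - a).
Proof.
move=> df1; have cf : continuous f.
  by move=> t; apply/differentiable_continuous/derivable1_diffP; case: (df1 t).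
have [ab|ba] := leP a b.
  have [|c + ->] := @MVT_segment _ f df a b ab (fun t _ => df1 t); first exact: continuous_subspaceT.
  by rewrite in_itv /= => cab; exists c; rewrite ?cab.
have [|c + E] := @MVT_segment _ f df b a (ltW ba) (fun t _ => df1 t); first exact: continuous_subspaceT.
rewrite in_itv /= => cab; exists c; first by rewrite cab orbT.
by rewrite -opprB E -mulrN opprB.
Qed.

(** A non-strict inequality between values survives pointwise limits, unlike differentiability
    itself; this form lets the derivative of a limit of partial sums be read off. *)
Lemma is_derive_quadratic (f : R -> R) (t d L : R) :
  (forall s, `|s - t| <= 1 -> `|f s - f t - (s - t) * d| <= L * (s - t) ^+ 2) ->
  is_derive t (1 : R) f d.
Proof.
move=> H; suff Hc : (fun h => h^-1 *: ((f \o shift t) (h *: 1) - f t)) @ 0^' --> (d : R).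
  by apply: DeriveDef; [apply: cvgP Hc|apply: cvg_lim Hc].
apply/cvgrPdist_le => /= e e0.
near=> h.
have h0 : h != 0 by near: h; exact: nbhs_dnbhs_neq.
have h1 : `|h| <= 1.
  near: h; apply: dnbhs0_le; exact: ltr01.
have hL : `|h| <= e / (`|L| + 1).
  by near: h; apply: dnbhs0_le; rewrite divr_gt0// ltr_wpDl.
rewrite /GRing.scale /= mulr1.
have := H (h + t); rewrite addrK => /(_ h1) Hh.
have -> : d - h^-1 * (f (h + t) - f t) = - (h^-1 * (f (h + t) - f t - h * d)).
  by rewrite [h^-1 * (_ - h * d)]mulrBr mulKf//; ring.
rewrite normrN normrM normfV ler_pdivrMl ?normr_gt0//.
apply: le_trans Hh _; rewrite -real_normK ?num_real// expr2.
apply: le_trans (_ : `|L| * (`|h| * `|h|) <= _); first by rewrite ler_wpM2r ?ler_norm ?mulr_ge0.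
rewrite mulrCA ler_wpM2l//.
apply: le_trans (_ : `|L| * (e / (`|L| + 1)) <= _); first by rewrite ler_wpM2l.
rewrite mulrCA ger_pMr// ler_pdivrMr ?ltr_wpDl// mul1r lerDl//.
Unshelve. all: by end_near. Qed.

Lemma Rintegral_empty (a b : R) f : b < a -> J a b f = 0.
Proof. by move=> ba; rewrite set_itv_ge ?Rintegral_set0// bnd_simp -ltNge. Qed.

(** The integral from 0 to [t] with its sign: an integral over an empty segment is 0, so at most one
    of the two terms contributes. *)
Definition primitive (f : R -> R) t := J 0 t f - J t 0 f.

Lemma is_derive_primitive f : continuous f ->
  forall t, is_derive t (1 : R) (primitive f) (f t).
Proof.
(* A base point to the left of both 0 and [t] replaces the signed integral near [t] by an ordinary
   one minus a constant. *)
move=> cf t; pose a := - `|t| - 1.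
have at_ : a < t by have := ler_norm (- t); rewrite normrN /a; lra.
have a0 : a < 0 by have := normr_ge0 t; rewrite /a; lra.
have If b c : L1 b c f by apply: cts_L1; exact: continuous_subspaceT.
apply: (@near_eq_is_derive _ _ _ (fun s => J a s f - J a 0 f)).
  near=> s; have as_ : a < s by near: s; exact: lt_nbhsr.
  rewrite /primitive; have [s0|s0] := leP 0 s.
    rewrite (@RintegralD_chasles _ a s 0) ?(ltW a0)//.
    move: s0; rewrite le_eqVlt => /predU1P[<-|s0].
      by rewrite set_itv1 Rintegral_set1; ring.
    by rewrite (@Rintegral_empty s 0)//; ring.
    rewrite (@RintegralD_chasles _ a 0 s) ?(ltW as_) ?(ltW s0)//.
  by rewrite (@Rintegral_empty 0 s)//; ring.
have t1 : t < t + 1 by rewrite ltrDl.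
have [d E] := @continuous_FTC1_closed _ f a t (t + 1) t1 (If _ _) at_ (cf t).
have d1 : is_derive t (1 : R) (fun s => J a s f) (f t).
  by apply: DeriveDef; [exact: d|rewrite -derive1E; exact: E].
by apply: eq_is_derive (is_deriveB d1 (is_derive_cst (J a 0 f) t 1)) (subr0 _).
Unshelve. all: by end_near. Qed.

Lemma primitive0 f : primitive f 0 = 0.
Proof. by rewrite /primitive subrr. Qed.

Definition mxprimitive n m (F : R -> 'M[R]_(n, m)) t : 'M[R]_(n, m) :=
  \matrix_(i, j) primitive (fun s => F s i j) t.

Lemma is_derive_mxprimitive n m (F : R -> 'M[R]_(n, m)) : continuous F ->
  forall t, is_derive t (1 : R) (mxprimitive F) (F t).
Proof.
move=> cF t; apply/is_derive_mxP => i j.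
under [X in is_derive _ _ X]eq_fun do rewrite mxE.
exact: (is_derive_primitive (coord_cts cF)).
Qed.

Lemma mxprimitive0 n m (F : R -> 'M[R]_(n, m)) : mxprimitive F 0 = 0.
Proof. by apply/matrixP => i j; rewrite !mxE primitive0. Qed.

(* [chexp l] majorizes the Picard iterates: its primitive vanishing at 0 is
   bounded by [chexp l / l] on both sides of 0. *)
Definition chexp (l t : R) : R := expR (l * t) + expR (- (l * t)).

Lemma chexp_ge1 l t : 1 <= chexp l t.
Proof.
have := expR_ge1Dx (l * t); have := expR_ge1Dx (- (l * t)); rewrite /chexp; lra.
Qed.

(** With [sh] the primitive of [chexp l] vanishing at 0, the functions [k sh + f] and [k sh - f]
    have nonnegative derivatives on [[-T, T]] and vanish at 0; hence [|f|] is at most [k |sh|] on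
    both sides of 0. Integration thus gains a factor [1 / l]. *)
Lemma primitive_bound (l T k : R) (f df : R -> R) : 0 < l -> 0 <= k -> f 0 = 0 ->
  (forall t, is_derive t (1 : R) f (df t)) ->
  (forall t, `|t| <= T -> `|df t| <= k * chexp l t) ->
  forall t, `|t| <= T -> `|f t| <= k / l * chexp l t.
Proof.
move=> l0 k0 f0 df1 dfk t tT.
pose sh s := (expR (l * s) - expR (- (l * s))) / l.
have dlin s : is_derive s (1 : R) (fun r => l * r) l.
  by apply: eq_is_derive (is_deriveZ l (is_derive_id s 1)) _; rewrite /GRing.scale /= mulr1.
have dsh s : is_derive s (1 : R) sh (chexp l s).
  have e1 : is_derive s (1 : R) (fun r => expR (l * r)) (l * expR (l * s)).
    rewrite mulrC; exact: (@is_derive1_comp _ (@expR R) (fun r => l * r)).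
  have e2 : is_derive s (1 : R) (fun r => expR (- (l * r))) (- l * expR (- (l * s))).
    have dl := is_deriveN (dlin s).
    rewrite mulrC; exact: (@is_derive1_comp _ (@expR R) (fun r => - (l * r))).
  have e3 := is_deriveZ l^-1 (is_deriveB e1 e2).
  rewrite (_ : sh = l^-1 \*: (fun r => expR (l * r) - expR (- (l * r)))); last first.
    by apply/funext => r; rewrite /sh mulrC.
  apply: eq_is_derive e3 _; rewrite /chexp /GRing.scale /=.
  by field; rewrite gt_eqF.
have sh0 : sh 0 = 0 by rewrite /sh mulr0 oppr0 subrr mul0r.
have shch : `|sh t| <= chexp l t / l.
  have aux : `|expR (l * t) - expR (- (l * t))| <= chexp l t.
    have := expR_gt0 (l * t); have := expR_gt0 (- (l * t)).
    by rewrite ler_norml /chexp => h1 h2; apply/andP; split; lra.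
  have l1 : 0 < l^-1 by rewrite invr_gt0.
  by rewrite /sh normrM (gtr0_norm l1) ler_wpM2r// ltW.
suff H : `|f t| <= k * `|sh t|.
  by apply: le_trans H _; rewrite -mulrA [l^-1 * _]mulrC ler_wpM2l.
have dk s : is_derive s (1 : R) (fun r => k * sh r) (k * chexp l s) by exact: is_deriveZ.
have [c1 c1t] := mvt_between 0 t (fun s => is_deriveD (df1 s) (dk s)).
have [c2 c2t] := mvt_between 0 t (fun s => is_deriveB (df1 s) (dk s)).
have inT c : (0 <= c <= t) || (t <= c <= 0) -> `|c| <= T.
  move=> ct; apply: le_trans tT; case/orP: ct => /andP[h1 h2].
    by rewrite !ger0_norm// (le_trans h1).
  by rewrite !ler0_norm// ?lerN2// (le_trans h1).
have := dfk _ (inT _ c1t); have := dfk _ (inT _ c2t).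
rewrite !ler_norml => /andP[h1 h2] /andP[h3 h4].
rewrite -[(f - _) t]/(f t - k * sh t) -[(f - _) 0]/(f 0 - k * sh 0).
rewrite -[(f + _) t]/(f t + k * sh t) -[(f + _) 0]/(f 0 + k * sh 0).
rewrite f0 sh0 mulr0 !subr0 addr0 => E2 E1.
have ksh : `|k * sh t| = k * `|sh t| by rewrite normrM [`|k|]ger0_norm.
rewrite -ksh; have [t0|t0] := leP 0 t.
  have u1 : 0 <= (df c1 + k * chexp l c1) * t by rewrite mulr_ge0//; lra.
  have u2 : (df c2 - k * chexp l c2) * t <= 0 by rewrite mulr_le0_ge0//; lra.
  by have := ler_norm (k * sh t); have := ler_norm (- (k * sh t)); rewrite normrN => ? ?; apply/andP; split; lra.
have u1 : (df c1 + k * chexp l c1) * t <= 0 by rewrite mulr_ge0_le0//; lra.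
have u2 : 0 <= (df c2 - k * chexp l c2) * t by rewrite mulr_le0//; lra.
by have := ler_norm (k * sh t); have := ler_norm (- (k * sh t)); rewrite normrN => ? ?; apply/andP; split; lra.
Qed.

End LinearODE.

(** * Picard iteration for linear equations with smooth coefficients *)

Section LinearODEexistence.
Variable R : realType.

Lemma coord_le_norm n m (M : 'M[R]_(n, m)) i j : `|M i j| <= `|M|.
Proof. by rewrite [leRHS]mx_normrE; exact: (le_bigmax _ (fun ij => `|M ij.1 ij.2|) (i, j)). Qed.

Lemma norm_le_coord n m (M : 'M[R]_(n, m)) c : 0 <= c ->
  (forall i j, `|M i j| <= c) -> `|M| <= c.
Proof. by move=> c0 Mc; rewrite [leLHS]mx_normrE; apply: bigmax_le => // -[i j] _; exact: Mc. Qed.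

Lemma mx_within_bounded n m (a b : R) (F : R -> 'M[R]_(n, m)) : continuous F ->
  exists2 M : R, 0 < M & forall t, a <= t <= b -> forall i j, `|F t i j| <= M.
Proof.
move=> cF; have [M [Mr HM]] :=
  compact_bounded (continuous_compact (continuous_subspaceT cF) (@segment_compact R a b)).
exists (`|M| + 1) => [|t tab i j]; first by rewrite ltr_wpDl.
apply: le_trans (coord_le_norm _ _ _) _; apply: HM.
  by rewrite ltr_pwDr// ler_norm.
by exists t => //=; rewrite in_itv.
Qed.

Lemma mulmx_coord_le n m p (M : 'M[R]_(n, m)) (N : 'M[R]_(m, p)) c d : 0 <= c ->
  (forall i j, `|M i j| <= c) -> (forall i j, `|N i j| <= d) ->
  forall i j, `|(M *m N) i j| <= m%:R * (c * d).
Proof.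
move=> c0 Mc Nd i j; rewrite mxE; apply: le_trans (ler_norm_sum _ _ _) _.
apply: le_trans (_ : \sum_(k < m) c * d <= _).
  by apply: ler_sum => k _; rewrite normrM ler_pM.
by rewrite sumr_const card_ord mulr_natl.
Qed.

Section Picard.
Variables (n : nat) (A A' : R -> 'M[R]_n).
Hypothesis dA : forall t, is_derive t (1 : R) A (A' t).
Hypothesis cA' : continuous A'.

Fixpoint picard (k : nat) : R -> 'M[R]_n :=
  if k is l.+1 then mxprimitive (fun t => A t *m picard l t) else fun=> 1%:M.

Definition dpicard k t : 'M[R]_n := if k is l.+1 then A t *m picard l t else 0.

Fixpoint picard_sum (N : nat) : R -> 'M[R]_n :=
  if N is M.+1 then fun t => picard_sum M t + picard M t else fun=> 0.

Lemma is_derive_picard k t : is_derive t (1 : R) (picard k) (dpicard k t).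
Proof.
elim: k t => [|k IH] t; first exact: is_derive_cst.
apply: is_derive_mxprimitive => s.
exact: is_derive_cts (is_derive_mulmx (dA s) (IH s)).
Qed.

Lemma is_derive_picard_sum N t :
  is_derive t (1 : R) (picard_sum N.+1) (A t *m picard_sum N t).
Proof.
elim: N t => [|N IH] t.
  apply: eq_is_derive (is_derive_mxD (is_derive_cst 0 t 1) (is_derive_cst 1%:M t 1)) _.
  by rewrite mulmx0 addr0.
apply: eq_is_derive (is_derive_mxD (IH t) (is_derive_picard N.+1 t)) _.
by rewrite mulmxDr.
Qed.

Lemma picard0 k : picard k 0 = if k is 0%N then 1%:M else 0.
Proof. by case: k => //= k; rewrite mxprimitive0. Qed.

Lemma picard_sum0 N : picard_sum N.+1 0 = 1%:M.
Proof. by elim: N => [|N IH]; rewrite /= ?add0r// -/(picard_sum N.+1 0) IH mxprimitive0 addr0. Qed.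

Lemma picard_bound T : exists2 M : R, 0 < M & forall t, `|t| <= T ->
  forall k i j, `|picard k t i j| <= M / 2 ^+ k.
Proof.
have cA : continuous A by move=> t; exact: is_derive_cts (dA t).
have [C C0 AC] := mx_within_bounded (- T) T cA.
(* Multiplication by [A] costs a factor [n C] and integration gains [1 / l]; this [l] makes the
   product at most 1/2. *)
pose l := 2 * (n%:R * C + 1).
have nC : 0 <= n%:R * C by rewrite mulr_ge0// ltW.
have l0 : 0 < l by rewrite mulr_gt0// ltr_wpDl.
pose ch t : R := expR (l * t) + expR (- (l * t)).
have ch0 t : 0 < ch t by rewrite addr_gt0// expR_gt0.
have H k t : `|t| <= T -> forall i j, `|picard k t i j| <= ch t / 2 ^+ k.
  elim: k t => [|k IH] t tT i j.
    rewrite mxE divr1; apply: le_trans (chexp_ge1 l t).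
    by case: (i == j); rewrite ?normr1// normr0.
  have dP s : is_derive s (1 : R) (fun r => picard k.+1 r i j) ((A s *m picard k s) i j).
    by have /is_derive_mxP := is_derive_picard k.+1 s; exact.
  have B s : `|s| <= T -> `|(A s *m picard k s) i j| <= n%:R * C / 2 ^+ k * ch s.
    move=> sT; apply: le_trans (mulmx_coord_le (ltW C0) _ (IH s sT) i j) _.
      by apply: AC; rewrite -ler_norml.
    by rewrite le_eqVlt; apply/orP; left; apply/eqP; ring.
  have := primitive_bound l0 _ _ dP B tT; rewrite picard0 mxE.
  move=> /(_ _ erefl)/le_trans; apply; first by rewrite divr_ge0// exprn_ge0.
  have q : n%:R * C / l <= 2^-1.
    by rewrite ler_pdivrMr// /l mulrA mulVf// mul1r lerDl.
  have x0 : 0 <= ch t / 2 ^+ k by rewrite divr_ge0 ?exprn_ge0// ltW.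
  rewrite exprS [(2 * 2 ^+ k)^-1]invfM.
  rewrite (_ : _ / l * _ = n%:R * C / l * (ch t / 2 ^+ k)); last by rewrite /ch /chexp; ring.
  by rewrite [leRHS]mulrCA ler_wpM2r.
have cch : continuous ch.
  move=> t; apply: cvgD; apply: continuous_comp; try exact: continuous_expR.
    by apply: cvgMr; exact: cvg_id.
  by apply: cvgN; apply: cvgMr; exact: cvg_id.
have [M M0 chM] := within_bounded (continuous_subspaceT (A := `[- T, T]) cch).
exists M => // t tT k i j; apply: le_trans (H _ _ tT _ _) _.
rewrite ler_wpM2r ?invr_ge0 ?exprn_ge0//.
by apply: le_trans (ler_norm _) _; apply: chM; rewrite -ler_norml.
Qed.

Lemma picard_sum_bound T : exists2 M : R, 0 < M & forall t, `|t| <= T ->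
  (forall N i j, `|picard_sum N t i j| <= M) /\
  (forall i j, cvgn (fun N => picard_sum N t i j)).
Proof.
have [M M0 H] := picard_bound T.
have sE N t i j : picard_sum N t i j = series (fun k => picard k t i j) N.
  elim: N => [|N IH]; first by rewrite mxE /series /= big_geq.
  by rewrite seriesSr -IH mxE.
exists (2 * M); first exact: mulr_gt0.
move=> t tT; split=> [N i j|i j]; last first.
  under eq_fun do rewrite sE.
  apply: normed_cvg; apply: series_le_cvg (@is_cvg_geometric_series _ M 2^-1 _) => //.
  - by move=> k; exact: normr_ge0.
  - by move=> k; rewrite /geometric /= mulr_ge0 ?ltW// exprn_ge0.
  - by move=> k; apply: le_trans (H _ tT k i j) _; rewrite /geometric /= exprVn.
  - by rewrite ger0_norm// invf_lt1// ltr1n.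
(* The exact partial sum of the geometric majorant, which is stable under induction, unlike the
   bound [2 * M] alone. *)
have : `|picard_sum N t i j| <= 2 * M - 2 * M / 2 ^+ N.
  elim: N => [|N IH]; first by rewrite mxE normr0 divr1 subrr.
  rewrite mxE; apply: le_trans (ler_normD _ _) _.
  apply: le_trans (lerD IH (H _ tT N i j)) _.
  rewrite exprS invfM.
  by rewrite le_eqVlt; apply/orP; left; apply/eqP; field; rewrite expf_neq0.
move/le_trans; apply; rewrite gerBl divr_ge0 ?exprn_ge0// mulr_ge0// ltW//.
Qed.

Definition ode_solution (t : R) : 'M[R]_n :=
  \matrix_(i, j) limn (fun N => picard_sum N t i j).

(* The partial sums have second derivatives bounded uniformly on compacts, so
   their first-order expansions survive the pointwise limit. *)
Lemma is_derive_ode_solution t :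
  is_derive t (1 : R) ode_solution (A t *m ode_solution t).
Proof.
have cA : continuous A by move=> s; exact: is_derive_cts (dA s).
pose T := `|t| + 1.
have [M M0 HM] := picard_sum_bound T.
have [C C0 AC] := mx_within_bounded (- T) T cA.
have [C' C'0 AC'] := mx_within_bounded (- T) T cA'.
have inT s : `|s - t| <= 1 -> `|s| <= T.
  move=> st; rewrite (_ : s = t + (s - t)); last by ring.
  by apply: le_trans (ler_normD _ _) _; rewrite lerD2l.
apply/is_derive_mxP => i j.
(* A bound, uniform in the index, on the second derivatives of the partial sums, which have the form
   [A' S + A (A S)]. *)
pose L := n%:R * (C' * M) + n%:R * (C * (n%:R * (C * M))).
apply: (@is_derive_quadratic _ _ _ _ L) => s st.
have cvg_s r : `|r| <= T -> forall i j, picard_sum N r i j @[N --> \oo] --> ode_solution r i j.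
  by move=> rT a b; rewrite mxE; exact: (HM r rT).2.
have tT : `|t| <= T by rewrite lerDl.
have sT := inT _ st.
pose E N := picard_sum N.+2 s i j - picard_sum N.+2 t i j
  - (s - t) * (A t *m picard_sum N.+1 t) i j.
have shiftS (u : nat -> R) (l : R) : u N @[N --> \oo] --> l -> u N.+1 @[N --> \oo] --> l.
  by move=> ul; rewrite (cvg_shiftS u).
have cE : E N @[N --> \oo] -->
    ode_solution s i j - ode_solution t i j - (s - t) * (A t *m ode_solution t) i j.
  apply: cvgB.
    apply: cvgB.
      apply: (shiftS (fun N => picard_sum N.+1 s i j)).
      by apply: (shiftS (fun N => picard_sum N s i j)); exact: cvg_s.
    apply: (shiftS (fun N => picard_sum N.+1 t i j)).
    by apply: (shiftS (fun N => picard_sum N t i j)); exact: cvg_s.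
  apply: cvgMr; rewrite mxE; under eq_fun do rewrite mxE.
  apply: cvg_big; first exact: add_continuous.
  move=> k _; apply: cvgMr.
  by apply: (shiftS (fun N => picard_sum N t k j)); exact: cvg_s.
apply: cvgr_to_le (cvg_norm cE) _.
apply: nearW => N.
pose f r : R := picard_sum N.+2 r i j.
pose df r : R := (A r *m picard_sum N.+1 r) i j.
pose ddf r : R := (A' r *m picard_sum N.+1 r + A r *m (A r *m picard_sum N r)) i j.
have d1 r : is_derive r (1 : R) f (df r).
  by have /is_derive_mxP := is_derive_picard_sum N.+1 r; exact.
have d2 r : is_derive r (1 : R) df (ddf r).
  by have /is_derive_mxP := is_derive_mulmx (dA r) (is_derive_picard_sum N r); exact.
have [c cst Ec] := mvt_between t s d1.
have [d dct Ed] := mvt_between t c d2.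
have btw (x y z : R) : (x <= y <= z) || (z <= y <= x) -> `|y - x| <= `|z - x|.
  by case/orP => /andP[h1 h2]; [rewrite !ger0_norm ?subr_ge0 ?lerD2r// (le_trans h1)|
    rewrite !ler0_norm ?subr_le0 ?lerN2 ?lerD2r// (le_trans h1)].
have cs := btw _ _ _ cst; have dc := btw _ _ _ dct.
have dT : `|d| <= T by apply: inT; apply: le_trans dc (le_trans cs st).
have ddL : `|ddf d| <= L.
  rewrite /ddf mxE; apply: le_trans (ler_normD _ _) _; apply: lerD.
    apply: mulmx_coord_le; [exact: ltW|by apply: AC'; rewrite -ler_norml|exact: (HM d dT).1].
  apply: mulmx_coord_le; [exact: ltW|by apply: AC; rewrite -ler_norml|].
  apply: mulmx_coord_le; [exact: ltW|by apply: AC; rewrite -ler_norml|exact: (HM d dT).1].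
rewrite -[E N]/(f s - f t - (s - t) * df t) Ec [df c * _]mulrC -mulrBr Ed !normrM.
rewrite -[_ ^+ 2]real_normK ?num_real// expr2 mulrCA.
by rewrite ler_pM ?mulr_ge0 ?ler_wpM2l.
Qed.

Lemma ode_solution0 : ode_solution 0 = 1%:M.
Proof.
apply/matrixP => i j; rewrite mxE; apply: cvg_lim => //.
rewrite -(cvg_shiftS (fun N => picard_sum N 0 i j)).
under eq_fun do rewrite picard_sum0.
exact: cvg_cst.
Qed.

End Picard.

(** The inverse of the flow is produced as the transpose of a solution of the adjoint equation:
    [W V] then has zero derivative and equals 1 at time 0, so invertibility needs no separate
    argument. *)
Lemma linear_ode_exists n (A : R -> 'M[R]_n) : smooth A ->
  exists V W : R -> 'M[R]_n, [/\ V 0 = 1%:M, forall t, W t *m V t = 1%:M,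
    forall t, is_derive t (1 : R) V (A t *m V t)
  & forall t, is_derive t (1 : R) W (- (W t *m A t))].
Proof.
move=> sA.
have dA := smooth_derive sA; have cA' := smooth_cts (smooth_derive1 sA).
have sNT : smooth (fun t => - (A t)^T).
  by under eq_fun do rewrite -scaleN1r; apply: smoothZ; exact: smooth_tr.
have dNT := smooth_derive sNT; have cNT := smooth_cts (smooth_derive1 sNT).
pose V := ode_solution A; pose W t := (ode_solution (fun t => - (A t)^T) t)^T.
have dV t : is_derive t (1 : R) V (A t *m V t) by exact: (is_derive_ode_solution dA cA').
have dW t : is_derive t (1 : R) W (- (W t *m A t)).
  apply: eq_is_derive (is_derive_trmx (is_derive_ode_solution dNT cNT t)) _.
  by rewrite trmx_mul linearN /= trmxK mulmxN.
exists V, W; split=> //; first exact: ode_solution0.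
move=> t; have -> : W t *m V t = W 0 *m V 0.
  apply: (@is_derive_mx_cst _ _ _ (fun t => W t *m V t)) => s.
  apply: eq_is_derive (is_derive_mulmx (dW s) (dV s)) _.
  by rewrite mulNmx mulmxA addNr.
by rewrite /W /V !ode_solution0 trmx1 mulmx1.
Qed.

End LinearODEexistence.

(** * Linear algebra *)

Section LinearAlgebra.

Lemma unitmx_ker0 (F : fieldType) n (T : 'M[F]_n) :
  (forall v : 'cV[F]_n, T *m v = 0 -> v = 0) -> T \in unitmx.
Proof.
move=> T0; rewrite -unitmx_tr -row_free_unit; apply: inj_row_free => v vT.
by apply: trmx_inj; rewrite trmx0; apply: T0; rewrite -[T]trmxK -trmx_mul vT trmx0.
Qed.

Lemma pid_mulmx_coef (F : pzRingType) n m k (X : 'M[F]_(n, m)) i j :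
  (pid_mx k *m X) i j = (i < k)%N%:R * X i j.
Proof.
rewrite mxE (bigD1 i) //= big1 ?addr0 => [|l li]; first by rewrite mxE eqxx.
by have /negPf h : (l != i :> nat) by []; rewrite mxE eq_sym h mul0r.
Qed.

Lemma mulmx_pid_coef (F : pzRingType) n m k (X : 'M[F]_(n, m)) i j :
  (X *m pid_mx k) i j = X i j * (j < k)%N%:R.
Proof.
rewrite mxE (bigD1 j) //= big1 ?addr0 => [|l li]; first by rewrite mxE eqxx.
by have /negPf h : (l != j :> nat) by []; rewrite mxE h mulr0.
Qed.

Lemma idempotent_pid (F : fieldType) n (E : 'M[F]_n) : E *m E = E ->
  exists2 M, M \in unitmx & E *m M = M *m pid_mx (\rank E).
Proof.
move=> EE; set r := \rank E.
pose C := col_ebase E; pose L := row_ebase E.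
have EC : C *m pid_mx r *m L = E := mulmx_ebase E.
have uC : C \in unitmx := col_ebase_unit E.
have uL : L \in unitmx := row_ebase_unit E.
(* Coordinates adapted to the splitting into image and kernel of [E]: the first term reads off the
   component in the image, the second the component in the kernel, so [T] conjugates [E] to
   [pid_mx r]. *)
pose T := pid_mx r *m L *m E + copid_mx r *m invmx C *m (1%:M - E).
have pp : pid_mx r *m (pid_mx r : 'M[F]_n) = pid_mx r :> 'M[F]_n by rewrite pid_mx_id// rank_leq_row.
have pc : pid_mx r *m (copid_mx r : 'M[F]_n) = 0 :> 'M[F]_n by rewrite mul_pid_mx_copid// rank_leq_row.
have TE : T *m E = pid_mx r *m T.
  rewrite /T mulmxDl mulmxDr !mulmxA pp pc !mul0mx addr0 -!mulmxA EE.
  by rewrite [(1%:M - E) *m E]mulmxBl mul1mx EE subrr !mulmx0 addr0.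
have uT : T \in unitmx.
  apply: unitmx_ker0 => v Tv0.
  have E0 : E *m v = 0.
    have : (pid_mx r : 'M[F]_n) *m (T *m v) = 0 by rewrite Tv0 mulmx0.
    rewrite /T mulmxA mulmxDr !mulmxA pp pc !mul0mx addr0 => /(congr1 (mulmx C)).
    by rewrite mulmx0 !mulmxA EC EE.
  have cv : copid_mx r *m (invmx C *m v) = 0.
    by move: Tv0; rewrite /T mulmxDl -!mulmxA [(1%:M - E) *m v]mulmxBl mul1mx E0 subr0 !mulmx0 add0r.
  (* A vector killed by both terms of [T] is in the kernel of [E], and also in its image because the
     first [r] columns of [C] span that image; hence it is 0. *)
  have vE : v = E *m (invmx L *m (invmx C *m v)).
    rewrite -EC -!mulmxA (mulKVmx uL) -{1}[v](mulKVmx uC); congr (C *m _).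
    by apply/eqP; rewrite -subr_eq0 -{1}[invmx C *m v]mul1mx -mulmxBl; apply/eqP.
  by rewrite vE -EE -mulmxA -vE E0.
exists (invmx T); first by rewrite unitmx_inv.
by rewrite -{1}[E](mulKmx uT) TE -!mulmxA mulmxV// mulmx1.
Qed.

Lemma rank_compl_idempotent (F : fieldType) n (E : 'M[F]_n) : E *m E = E ->
  \rank (1%:M - E) = (n - \rank E)%N.
Proof.
move=> EE; have [M uM EM] := idempotent_pid EE.
have -> : 1%:M - E = M *m copid_mx (\rank E) *m invmx M.
  by rewrite mulmxBr mulmxBl mulmx1 mulmxV// -EM mulmxK.
rewrite mxrankMfree ?row_free_unit ?unitmx_inv// -mxrank_tr trmx_mul.
by rewrite mxrankMfree ?mxrank_tr ?rank_copid_mx ?rank_leq_row// row_free_unit unitmx_tr.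
Qed.

Lemma horner_mx_intertwine (F : comNzRingType) n m (P : 'M[F]_n.+1) (Q : 'M[F]_m.+1)
    (b : 'M[F]_(n.+1, m.+1)) (q : {poly F}) :
  P *m b = b *m Q -> horner_mx P q *m b = b *m horner_mx Q q.
Proof.
move=> PQ; elim/poly_ind: q => [|q c IH]; first by rewrite !rmorph0 mul0mx mulmx0.
rewrite !rmorphD !rmorphM /= !horner_mx_X !horner_mx_C.
by rewrite mulmxDl mulmxDr -mulmxA PQ mulmxA IH -mulmxA scalar_mxC.
Qed.

Lemma horner_mx_tr (F : comNzRingType) n (P : 'M[F]_n.+1) (q : {poly F}) :
  (horner_mx P q)^T = horner_mx P^T q.
Proof.
elim/poly_ind: q => [|q c IH]; first by rewrite !rmorph0 trmx0.
rewrite !rmorphD !rmorphM /= !horner_mx_X !horner_mx_C linearD /= tr_scalar_mx.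
have -> : (horner_mx P q * P)^T = P^T * horner_mx P^T q by rewrite -IH; exact: trmx_mul.
congr (_ + _); rewrite -[X in X * _ = _](horner_mx_X P^T).
by rewrite -[X in _ = _ * X](horner_mx_X P^T) -!rmorphM /= mulrC.
Qed.

Section BlockDiagonal.
Variable R : realType.

(** Commutation with the coordinate projection is an identity between matrices, easier to establish
    than the vanishing of submatrices; on an off-diagonal coefficient one side has the factor 1 and
    the other the factor 0. *)
Lemma block_diagonal2 n m (n_ m_ : 'I_2 -> nat) (en : (\sum_i n_ i)%N = n)
    (em : (\sum_i m_ i)%N = m) (X : 'M[R]_(n, m)) :
  pid_mx (n_ ord0) *m X = X *m pid_mx (m_ ord0) -> block_diagonal en em X.
Proof.
move=> pX i j ij; apply/matrixP => a b; rewrite !mxE castmxE /=.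
set r := cast_ord _ _; set c := cast_ord _ _.
have := congr1 (fun Y : 'M[R]_(n, m) => Y r c) pX.
rewrite pid_mulmx_coef mulmx_pid_coef.
have vr : r = (\sum_(k < 2 | (k < i)%N) n_ k + a)%N :> nat by rewrite -tagnat.RankEsum.
have vc : c = (\sum_(k < 2 | (k < j)%N) m_ k + b)%N :> nat by rewrite -tagnat.RankEsum.
have I2 (k : 'I_2) : k = ord0 \/ k = lift ord0 ord0.
  by case: k => -[|[|k]] // kP; [left|right]; exact: val_inj.
have s0 (p : 'I_2 -> nat) : (\sum_(k < 2 | (k < (ord0 : 'I_2))%N) p k = 0)%N.
  by rewrite big_pred0.
have s1 (p : 'I_2 -> nat) :
    (\sum_(k < 2 | (k < (lift ord0 ord0 : 'I_2))%N) p k = p ord0)%N.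
  by rewrite big_mkcond /= !big_ord_recl big_ord0 /= !addn0.
move: (r) (c) vr vc => {}r {}c; move: ij a b; case: (I2 i) => ->; case: (I2 j) => -> // _ a b.
    rewrite s0 s1 add0n => -> ->.
  by rewrite ltn_ord ltnNge leq_addr mul1r mulr0.
rewrite s0 s1 add0n => -> ->.
by rewrite ltn_ord ltnNge leq_addr mulr1 mul0r => <-.
Qed.

Definition block_of n N (n_ : 'I_N -> nat) (en : (\sum_i n_ i)%N = n) (k : 'I_n) : 'I_N :=
  tagnat.sig1 (cast_ord (esym en) k).

(** All blocks other than [i0] are treated as one, which reduces any [N] to two blocks. With [c = 1]
    and [d = 0] this is the coordinate projection onto block [i0]. *)
Definition block_scaling n N (n_ : 'I_N -> nat) (en : (\sum_i n_ i)%N = n) (i0 : 'I_N)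
    (c d : R) : 'M[R]_n :=
  diag_mx (\row_k (if block_of en k == i0 then c else d)).

Lemma block_diagonal_scaling n m N (n_ m_ : 'I_N -> nat) (en : (\sum_i n_ i)%N = n)
    (em : (\sum_i m_ i)%N = m) (X : 'M[R]_(n, m)) i0 c d :
  block_diagonal en em X ->
  block_scaling en i0 c d *m X = X *m block_scaling em i0 c d.
Proof.
move=> bX; apply/matrixP => r s; rewrite mul_diag_mx mul_mx_diag !mxE.
have [<-|rs] := eqVneq (block_of en r) (block_of em s); first by rewrite mulrC.
suff -> : X r s = 0 by rewrite mulr0 mul0r.
have /matrixP := bX _ _ rs.
move=> /(_ (tagnat.sig2 (cast_ord (esym en) r)) (tagnat.sig2 (cast_ord (esym em) s))).
by rewrite !mxE castmxE /block_of !tagnat.sig2K /= !esymK !cast_ordKV.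
Qed.

Lemma block_of_surj n N (n_ : 'I_N -> nat) (en : (\sum_i n_ i)%N = n) i0 :
  (0 < n_ i0)%N -> exists k, block_of en k = i0.
Proof.
move=> n0; exists (cast_ord en (tagnat.Rank i0 (Ordinal n0))).
by rewrite /block_of cast_ordK tagnat.Rank1K.
Qed.

Lemma det_block_scaling n N (n_ : 'I_N -> nat) (en : (\sum_i n_ i)%N = n) i0 c d :
  \det (block_scaling en i0 c d) =
  c ^+ #|[pred k | block_of en k == i0]| * d ^+ #|[pred k | block_of en k != i0]|.
Proof.
rewrite det_diag (bigID (fun k => block_of en k == i0)) /=; congr (_ * _).
  by rewrite -prodr_const; apply: eq_bigr => k; rewrite !mxE => ->.
by rewrite -prodr_const; apply: eq_bigr => k /negPf; rewrite !mxE => ->.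
Qed.

Lemma block_scalingM n N (n_ : 'I_N -> nat) (en : (\sum_i n_ i)%N = n) i0 c d c' d' :
  block_scaling en i0 c d *m block_scaling en i0 c' d' =
  block_scaling en i0 (c * c') (d * d').
Proof.
rewrite /block_scaling mulmx_diag; congr diag_mx; apply/rowP => k; rewrite !mxE.
by case: ifP.
Qed.

Lemma block_scalingE n N (n_ : 'I_N -> nat) (en : (\sum_i n_ i)%N = n) i0 c d :
  block_scaling en i0 c d =
  c *: block_scaling en i0 1 0 + d *: (1%:M - block_scaling en i0 1 0).
Proof.
apply/matrixP => i j; rewrite !mxE; case: (i == j) => /=.
  by rewrite !mulr1n; case: ifP => _; ring.
by rewrite !mulr0n; ring.
Qed.

End BlockDiagonal.

End LinearAlgebra.

(** * Spectral projections of matrices self-adjoint for an inner product *)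

Section SpectralProjection.
Variable R : realType.

(** The diagonal of [Y G Y^T] consists of the squared [G]-norms of the rows of [Y]. *)
Lemma posdef_row0 n p (G : 'M[R]_n) (Y : 'M[R]_(p, n)) :
  posdefmx G -> Y *m G *m Y^T = 0 -> Y = 0.
Proof.
move=> [_ G0] YG; apply/row_matrixP => i; rewrite row0.
apply: contraTeq (lexx (0 : R)) => Yi; rewrite -ltNge.
have := G0 (row i Y)^T; rewrite trmx_eq0 => /(_ Yi); rewrite trmxK.
have -> : row i Y *m G *m (row i Y)^T = 0; last by rewrite mxE.
apply/matrixP => a b; rewrite !ord1 !mxE.
have /matrixP/(_ i i) := YG; rewrite !mxE => {2}<-.
by apply: eq_bigr => k _; rewrite !mxE; congr (_ * _); apply: eq_bigr => l _; rewrite !mxE.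
Qed.

(** Take a complex eigenvalue [a + i b] with row eigenvector [x + i y]. Comparing [x P G y^T] with
    [x G (y P)^T] gives [b] times the sum of the squared [G]-norms of [x] and [y] equal to 0, so
    [b = 0] and whichever of [x], [y] is nonzero is a real eigenvector. *)
Lemma selfadjoint_real_eigenvector n (P G : 'M[R]_n.+1) :
  posdefmx G -> P *m G = G *m P^T ->
  exists a, exists2 v : 'rV[R]_n.+1, v != 0 & v *m P = a *: v.
Proof.
move=> posG PG; pose PC := map_mx (real_complex R) P.
have [l rl] : exists l, root (char_poly PC) l.
  by apply/closed_rootP; rewrite size_char_poly.
move: rl; rewrite -eigenvalue_root_char => /eigenvalueP[v vP v0].
pose x := map_mx (@complex.Re R) v; pose y := map_mx (@complex.Im R) v.
pose a := complex.Re l; pose b := complex.Im l.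
have ReM (z : R[i]) (r : R) : complex.Re (z * r%:C%C) = complex.Re z * r.
  by case: z => u w /=; rewrite mulr0 subr0.
have ImM (z : R[i]) (r : R) : complex.Im (z * r%:C%C) = complex.Im z * r.
  by case: z => u w /=; rewrite mulr0 add0r.
have vPj j : \sum_k v 0 k * (P k j)%:C%C = l * v 0 j.
  have /rowP/(_ j) := vP; rewrite !mxE => <-.
  by apply: eq_bigr => k _; rewrite mxE.
have xP : x *m P = a *: x - b *: y.
  apply/rowP => j; transitivity (complex.Re (\sum_k v 0 k * (P k j)%:C%C)).
    by rewrite mxE raddf_sum; apply: eq_bigr => k _; rewrite mxE -ReM.
  by rewrite vPj !mxE /a /b; case: (l) => ? ?; case: (v 0 j).
have yP : y *m P = b *: x + a *: y.
  apply/rowP => j; transitivity (complex.Im (\sum_k v 0 k * (P k j)%:C%C)).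
    by rewrite mxE raddf_sum; apply: eq_bigr => k _; rewrite mxE -ImM.
  by rewrite vPj !mxE /a /b; case: (l) => ? ?; case: (v 0 j) => ? ? /=; rewrite addrC.
have [GT Gpos] := posG.
have adj (u w : 'rV[R]_n.+1) : u *m P *m G *m w^T = u *m G *m (w *m P)^T.
  by rewrite trmx_mul -!mulmxA [P *m (G *m _)]mulmxA PG !mulmxA.
have Gge0 (u : 'rV[R]_n.+1) : 0 <= (u *m G *m u^T) 0 0.
  have [->|u0] := eqVneq u 0; first by rewrite !mul0mx mxE.
  by have := Gpos u^T; rewrite trmx_eq0 trmxK => /(_ u0)/ltW.
have Gsym : x *m G *m y^T = y *m G *m x^T.
  have -> : x *m G *m y^T = (y *m G *m x^T)^T by rewrite !trmx_mul trmxK GT mulmxA.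
  by apply/matrixP => i j; rewrite mxE !ord1.
have := adj x y; rewrite xP yP.
rewrite [(_ + _)^T]linearD /= ![(_ *: _)^T]linearZ /=.
rewrite !mulmxBl -!scalemxAl mulmxDr -!scalemxAr Gsym.
have [X xE] : exists X, X = x *m G *m x^T by exists (x *m G *m x^T).
have [Y yE] : exists Y, Y = y *m G *m y^T by exists (y *m G *m y^T).
have [Z zE] : exists Z, Z = y *m G *m x^T by exists (y *m G *m x^T).
rewrite -xE -yE -zE => /matrixP/(_ 0 0); rewrite !mxE => E.
pose xx := X 0 0; pose yy := Y 0 0.
have {E}b0 : b * (xx + yy) = 0 by rewrite /xx /yy; lra.
have xy0 : xx + yy != 0.
  apply: contraNneq v0 => s0.
  have hx := Gge0 x; have hy := Gge0 y; rewrite -xE -/xx in hx; rewrite -yE -/yy in hy.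
  have xx0 : x *m G *m x^T = 0.
    by rewrite -xE; apply/matrixP => i j; rewrite !ord1 mxE -/xx; lra.
  have yy0 : y *m G *m y^T = 0.
    by rewrite -yE; apply/matrixP => i j; rewrite !ord1 mxE -/yy; lra.
  have := posdef_row0 posG xx0; have := posdef_row0 posG yy0.
  move=> /rowP y0 /rowP x0; apply/eqP/rowP => j; have := x0 j; have := y0 j.
  by rewrite !mxE; case: (v 0 j) => /= ? ? -> ->.
have {}b0 : b = 0 by apply/eqP; have /eqP := b0; rewrite mulf_eq0 (negPf xy0) orbF.
exists a; have [x0|x0] := eqVneq x 0; last first.
  by exists x => //; rewrite xP b0 scale0r subr0.
exists y; last by rewrite yP b0 scale0r add0r.
apply: contraNneq v0 => y0; apply/eqP/rowP => j.
have /rowP/(_ j) := x0; have /rowP/(_ j) := y0.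
by rewrite !mxE; case: (v 0 j) => /= ? ? -> ->.
Qed.

(* Write [char_poly P = r * ('X - a) ^ k] with [r.[a] != 0]; self-adjointness
   makes [P] semisimple, so [(P - a) r(P) = 0] and [r(P) / r(a)] is idempotent. *)
Lemma selfadjoint_projection n (P G : 'M[R]_n.+1) :
  posdefmx G -> P *m G = G *m P^T -> (forall a, P <> a%:M) ->
  exists q : {poly R}, let E := horner_mx P q in [/\ E *m E = E, E <> 0 & E <> 1%:M].
Proof.
move=> posG PG Pns; have [a [v v0 vP]] := selfadjoint_real_eigenvector posG PG.
have [k [r]] := multiplicity_XsubC (char_poly P) a.
have ch0 : char_poly P != 0 by rewrite -size_poly_gt0 size_char_poly.
rewrite ch0 /= => rra chE.
pose N := P - a%:M.
have NE : horner_mx P ('X - a%:P) = N by rewrite rmorphB /= horner_mx_X horner_mx_C.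
have NG : N *m G = G *m N^T.
  by rewrite mulmxBl PG linearB /= tr_scalar_mx mulmxBr scalar_mxC.
(* No Jordan block at [a]: if two factors [N] kill a row, moving one of them across [G] shows that
   the row with a single factor has [G]-norm 0. *)
have semi (Y : 'M[R]_n.+1) j : Y *m N ^+ j = 0 -> Y *m N = 0.
  elim: j Y => [|j IH] Y; first by rewrite expr0 mulmx1 => ->; rewrite mul0mx.
  case: j IH => [|j] IH; first by rewrite expr1.
  rewrite exprSr exprSr => YN; apply: IH; rewrite exprSr.
  apply: (posdef_row0 posG).
  rewrite !trmx_mul !mulmxA -[_ *m G *m _]mulmxA -NG.
  have -> : Y *m N ^+ j *m N *m (N *m G) = Y *m (N ^+ j * N * N) *m G by rewrite !mulmxA.
  by rewrite YN !mul0mx.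
have YN : horner_mx P r *m N = 0.
  apply: (semi _ k); rewrite -NE -rmorphXn /=.
  by have := Cayley_Hamilton P; rewrite chE rmorphM.
have /factor_theorem[s sE] : root (r - r.[a]%:P) a by rewrite rootE !hornerE subrr.
have rE : horner_mx P r = (r.[a])%:M + horner_mx P s *m N.
  by rewrite -NE -[_ *m _]/(_ * _) -rmorphM -sE rmorphB /= horner_mx_C addrC subrK.
have ra0 : r.[a] != 0 by [].
have sN : horner_mx P s *m N = N *m horner_mx P s.
  by rewrite -NE -[LHS]rmorphM mulrC rmorphM.
exists (r.[a]^-1 *: r); set E := horner_mx P _ => /=.
have EE : E = r.[a]^-1 *: horner_mx P r by rewrite /E linearZ.
have EN : E *m N = 0 by rewrite EE -scalemxAl YN scaler0.
have E1 : E = 1%:M + r.[a]^-1 *: (N *m horner_mx P s).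
  by rewrite EE rE scalerDr scale_scalar_mx mulVf// sN.
split.
- by rewrite {2}E1 mulmxDr mulmx1 -scalemxAr mulmxA EN mul0mx scaler0 addr0.
(* [E] is the identity modulo [N], hence fixes the eigenvector [v]; dually [E N = 0], so [E = 1]
   would force [P = a]. *)
- move=> E0; have : v *m E = v.
    rewrite E1 mulmxDr mulmx1 -scalemxAr mulmxA mulmxBr vP mul_mx_scalar subrr.
    by rewrite mul0mx scaler0 addr0.
  by rewrite E0 mulmx0 => /esym/eqP; apply/negP.
- move=> E1'; apply: (Pns a); apply/eqP; rewrite -subr_eq0 -/N.
  by rewrite -[N]mul1mx -E1' EN.
Qed.

End SpectralProjection.

(** * Trajectories and costs *)

Section MatrixContinuity.
Variable R : realType.

Lemma cvg_mx (T : Type) (F : set_system T) (FF : Filter F) k l (X : T -> 'M[R]_(k, l))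
    (Y : 'M[R]_(k, l)) :
  (forall i j, X s i j @[s --> F] --> Y i j) -> X s @[s --> F] --> Y.
Proof.
move=> cX; apply/cvg_ballP => e e0.
have : \forall s \near F, forall i j, ball (Y i j) e (X s i j).
  apply: filter_forall => i; apply: filter_forall => j.
  by have /cvg_ballP/(_ e e0) := cX i j.
by apply: filterS => s Hs; split.
Qed.

Lemma within_mx (A : set R) k l (X : R -> 'M[R]_(k, l)) :
  (forall i j, {within A, continuous (fun t => X t i j)}) -> {within A, continuous X}.
Proof. by move=> cX t; apply: cvg_mx => i j; exact: cX. Qed.

Lemma within_sum (A : set R) k (f : 'I_k -> R -> R) :
  (forall i, {within A, continuous (f i)}) ->
  {within A, continuous (fun t => \sum_i f i t)}.
Proof.
move=> cf t; apply: cvg_big; first exact: add_continuous.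
by move=> i _; exact: cf.
Qed.

Lemma within_mulmx (A : set R) k l p (X : R -> 'M[R]_(k, l)) (Y : R -> 'M[R]_(l, p)) :
  {within A, continuous X} -> {within A, continuous Y} ->
  {within A, continuous (fun t => X t *m Y t)}.
Proof.
move=> cX cY; apply: within_mx => i j; under eq_fun do rewrite mxE.
apply: within_sum => r t; apply: cvgM.
  exact: (within_coord (i := i) (j := r) cX).
exact: (within_coord (i := r) (j := j) cY).
Qed.

Lemma cts_mulmx k l p (X : R -> 'M[R]_(k, l)) (Y : R -> 'M[R]_(l, p)) :
  continuous X -> continuous Y -> continuous (fun t => X t *m Y t).
Proof.
move=> cX cY t; apply: cvg_mx => i j; under eq_fun do rewrite mxE.
rewrite mxE; apply: cvg_big; first exact: add_continuous.
move=> r _; apply: cvgM; [exact: (@coord_cts _ _ _ X)|exact: (@coord_cts _ _ _ Y)].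
Qed.

Lemma cts_trmx k l (X : R -> 'M[R]_(k, l)) : continuous X -> continuous (fun t => (X t)^T).
Proof.
move=> cX t; apply: cvg_mx => i j; under eq_fun do rewrite mxE.
by rewrite mxE; exact: (@coord_cts _ _ _ X).
Qed.

End MatrixContinuity.

Section Trajectories.
Variable R : realType.
Local Notation mu := (@lebesgue_measure R).
Local Notation J a b f := (\int[mu]_(s in `[a, b]) f s).

Definition mxL2 k (a b : R) (v : R -> 'cV[R]_k) := forall i, L2 a b (fun t => v t i 0).

Lemma mxL2_L1 k (a b : R) (v : R -> 'cV[R]_k) : mxL2 a b v -> mxL1 a b v.
Proof. by move=> vL2 i j; rewrite ord1; exact: L2_L1. Qed.

Lemma mxL2_ctsM k l (a b : R) (X : R -> 'M[R]_(k, l)) (v : R -> 'cV[R]_l) :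
  {within `[a, b], continuous X} -> mxL2 a b v -> mxL2 a b (fun t => X t *m v t).
Proof.
move=> cX vL2 i; under eq_fun do rewrite mxE.
apply: L2_sum => j; apply: L2_ctsM; [exact: within_coord|exact: vL2].
Qed.

Lemma mxL2D k (a b : R) (v w : R -> 'cV[R]_k) :
  mxL2 a b v -> mxL2 a b w -> mxL2 a b (fun t => v t + w t).
Proof. by move=> vL2 wL2 i; under eq_fun do rewrite mxE; exact: L2D. Qed.

Lemma mxL2Z k (a b c : R) (v : R -> 'cV[R]_k) : mxL2 a b v -> mxL2 a b (fun t => c *: v t).
Proof.
move=> vL2 i; under eq_fun do rewrite mxE.
by apply: L2_ctsM (vL2 i); apply: continuous_subspaceT => t; exact: cvg_cst.
Qed.

Lemma mxL2_cts k (a b : R) (v : R -> 'cV[R]_k) :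
  {within `[a, b], continuous v} -> mxL2 a b v.
Proof. by move=> cv i; apply: L2_cts; exact: within_coord. Qed.

Variables n m : nat.
Implicit Types (F A : R -> 'M[R]_n) (B : R -> 'M[R]_(n, m)) (K : R -> 'M[R]_(m, n)).
Implicit Types (x y z : R -> 'cV[R]_n) (u v w : R -> 'cV[R]_m).

Lemma trajectory_mxL2 F B a b x v : trajectory F B a b x v -> mxL2 a b v.
Proof. by case. Qed.

Lemma trajectory_L1 F B a b x v : continuous F -> continuous B ->
  trajectory F B a b x v -> mxL1 a b (fun s => F s *m x s + B s *m v s).
Proof.
move=> cF cB [vL2 cx _]; apply: mxL1D.
  by apply: mxL1_ctsM; [exact: continuous_subspaceT|exact: mxL1_cts].
by apply: mxL1_ctsM; [exact: continuous_subspaceT|exact: mxL2_L1].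
Qed.

Lemma mxL1_sub k l (a b c d : R) (X : R -> 'M[R]_(k, l)) : a <= c -> d <= b ->
  mxL1 a b X -> mxL1 c d X.
Proof. by move=> ac db IX i j; exact: L1_sub (IX i j). Qed.

Lemma trajectory_sub F B a b b' x v : b' <= b ->
  trajectory F B a b x v -> trajectory F B a b' x v.
Proof.
move=> bb [vL2 cx xE]; split.
- move=> i; have [mv Iv] := vL2 i; split; last first.
    by apply: integrableS Iv => //; apply: subset_itv; rewrite bnd_simp.
  by apply: measurable_funS mv => //; apply: subset_itv; rewrite bnd_simp.
- exact: within_sub cx.
- by move=> t /andP[at_ tb]; apply: xE; rewrite at_ (le_trans tb).
Qed.

Lemma trajectory_comb F B a b c x v y w : continuous F -> continuous B ->
  trajectory F B a b x v -> trajectory F B a b y w ->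
  trajectory F B a b (fun t => x t + c *: y t) (fun t => v t + c *: w t).
Proof.
move=> cF cB tx ty; have Ix := trajectory_L1 cF cB tx; have Iy := trajectory_L1 cF cB ty.
have [vL2 cx xE] := tx; have [wL2 cy yE] := ty; split.
- by apply: mxL2D => //; exact: mxL2Z.
- by move=> t; apply: cvgD; [exact: cx|apply: cvgZr; exact: cy].
- move=> t tab; have /andP[_ tb] := tab.
  rewrite {1}(xE t tab) {1}(yE t tab) scalerDr.
  rewrite -mx_integralZ; last exact: mxL1_sub Iy.
  rewrite addrACA -mx_integralD; [|exact: mxL1_sub Ix|]; last first.
    move=> i j; under eq_fun do rewrite mxE.
    by apply: L1Z; exact: mxL1_sub Iy i j.
  congr (_ + _); apply: eq_mx_integral => s _.
  by rewrite !mulmxDr -!scalemxAr scalerDr addrACA.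
Qed.

Lemma trajectory_feedback A B K a b x u : continuous K ->
  trajectory A B a b x u ->
  trajectory (fun t => A t - B t *m K t) B a b x (fun t => u t + K t *m x t).
Proof.
move=> cK [uL2 cx xE]; split=> //.
  apply: mxL2D => //; apply: mxL2_cts; apply: within_mulmx => //.
  exact: continuous_subspaceT.
move=> t tab; rewrite {1}(xE t tab); congr (_ + _); apply: eq_mx_integral => s _.
by rewrite mulmxBl mulmxDr mulmxA addrACA [- _ + _]addrC subrr addr0.
Qed.

Lemma trajectory_feedback_inv A B K a b x u : continuous K ->
  trajectory (fun t => A t - B t *m K t) B a b x (fun t => u t + K t *m x t) ->
  trajectory A B a b x u.
Proof.
move=> cK [uL2 cx xE]; split=> //.
  have cKx : mxL2 a b (fun t => (-1) *: (K t *m x t)).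
    apply/mxL2Z/mxL2_cts; apply: within_mulmx => //; exact: continuous_subspaceT.
  have := mxL2D uL2 cKx; congr (mxL2 _ _ _); apply/funext => t.
  by rewrite scaleN1r addrK.
move=> t tab; rewrite {1}(xE t tab); congr (_ + _); apply: eq_mx_integral => s _.
by rewrite mulmxBl mulmxDr mulmxA addrACA [- _ + _]addrC subrr addr0.
Qed.

(** The drift cancels from [p^T z] because the costate solves the adjoint equation; the pairing only
    sees the control. *)
Lemma trajectory_duality F B a b (p : R -> 'cV[R]_n) z w : a <= b ->
  continuous F -> continuous B ->
  (forall t, is_derive t (1 : R) p (- (F t)^T *m p t)) ->
  trajectory F B a b z w ->
  (p b)^T *m z b = (p a)^T *m z a + mx_integral a b (fun s => (p s)^T *m B s *m w s).
Proof.
move=> ab cF cB dp tz; have [wL2 cz zE] := tz.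
have cp : continuous p by move=> t; exact: is_derive_cts (dp t).
have dpT t : is_derive t (1 : R) (fun s => (p s)^T) (- ((p t)^T *m F t)).
  apply: eq_is_derive (is_derive_trmx (dp t)) _.
  by rewrite trmx_mul linearN /= trmxK mulmxN.
have cdp : continuous (fun t => - ((p t)^T *m F t)).
  by move=> t; apply: cvgN; apply: cts_mulmx => //; exact: cts_trmx.
rewrite (mx_integral_product ab dpT cdp cz (trajectory_L1 cF cB tz) zE).
congr (_ + _); apply: eq_mx_integral => s _.
by rewrite mulmxDr !mulNmx !mulmxA addKr.
Qed.

Lemma trajectory_derive F B x v a b : continuous F -> continuous B -> continuous v ->
  (forall t, is_derive t (1 : R) x (F t *m x t + B t *m v t)) ->
  trajectory F B a b x v.
Proof.
move=> cF cB cv dx.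
have cx : continuous x by move=> t; exact: is_derive_cts (dx t).
split; [exact/mxL2_cts/continuous_subspaceT|exact: continuous_subspaceT|].
move=> t /andP[at_ _]; apply/matrixP => i j; rewrite !mxE.
have cxv : continuous (fun t => F t *m x t + B t *m v t).
  by move=> s; apply: cvgD; exact: cts_mulmx.
have dxij s : is_derive s (1 : R) (fun s => x s i j) ((F s *m x s + B s *m v s) i j).
  by have /is_derive_mxP := dx s; exact.
by rewrite (Rintegral_ftc at_ dxij (coord_cts cxv)) addrC subrK.
Qed.

(** The equation [P' = F P - P F] says that [P] commutes with the flow of [F], and [P B = B S] says
    that the projected control drives the projected state. This is how a competitor is split into
    independent competitors. *)
Lemma trajectory_intertwine F B (P P' : R -> 'M[R]_n) (S : R -> 'M[R]_m) a b z w :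
  continuous F -> continuous B -> continuous S -> continuous P' ->
  (forall t, is_derive t (1 : R) P (P' t)) ->
  (forall t, P' t = F t *m P t - P t *m F t) ->
  (forall t, P t *m B t = B t *m S t) ->
  trajectory F B a b z w ->
  trajectory F B a b (fun t => P t *m z t) (fun t => S t *m w t).
Proof.
move=> cF cB cS cP' dP P'E PB tz; have [wL2 cz zE] := tz.
have cP : continuous P by move=> t; exact: is_derive_cts (dP t).
split.
- by apply: mxL2_ctsM => //; exact: continuous_subspaceT.
- by apply: within_mulmx => //; exact: continuous_subspaceT.
- move=> t /andP[at_ tb].
  have [wL2t czt zEt] := trajectory_sub tb tz.
  rewrite (mx_integral_product at_ dP cP' czt (trajectory_L1 cF cB (trajectory_sub tb tz)) zEt).
  congr (_ + _); apply: eq_mx_integral => s _.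
  by rewrite P'E mulmxBl mulmxDr !mulmxA PB addrA addrNK.
Qed.

Definition quad (Q : 'M[R]_m) (v w : 'cV[R]_m) : R := (v^T *m Q *m w) 0 0.

Lemma quadE Q (v w : 'cV[R]_m) : quad Q v w = \sum_i \sum_j v i 0 * (Q i j * w j 0).
Proof.
rewrite /quad -mulmxA mxE; apply: eq_bigr => i _.
by rewrite !mxE mulr_sumr.
Qed.

Lemma quad_L1 a b (Q : R -> 'M[R]_m) v w : continuous Q -> mxL2 a b v -> mxL2 a b w ->
  L1 a b (fun t => quad (Q t) (v t) (w t)).
Proof.
move=> cQ vL2 wL2; under eq_fun do rewrite quadE.
apply: L1_sum => i; apply: L1_sum => j; apply: L2_mul; first exact: vL2.
by apply: L2_ctsM; [apply/continuous_subspaceT/coord_cts|exact: wL2].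
Qed.

Lemma quadDl Q (v v' w : 'cV[R]_m) : quad Q (v + v') w = quad Q v w + quad Q v' w.
Proof. by rewrite /quad linearD /= !mulmxDl mxE. Qed.

Lemma quadDr Q (v w w' : 'cV[R]_m) : quad Q v (w + w') = quad Q v w + quad Q v w'.
Proof. by rewrite /quad !mulmxDr mxE. Qed.

Lemma quadC Q (v w : 'cV[R]_m) : Q^T = Q -> quad Q v w = quad Q w v.
Proof.
move=> Qs; rewrite /quad -[in RHS]Qs.
have -> : w^T *m Q^T *m v = (v^T *m Q *m w)^T by rewrite !trmx_mul trmxK mulmxA.
by rewrite [RHS]mxE.
Qed.

Lemma total_costE (Q : R -> 'M[R]_m) K a b x u : continuous K -> continuous Q ->
  {within `[a, b], continuous x} -> mxL2 a b u ->
  total_cost (quadratic_cost K Q) a b x u =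
  (J a b (fun t => quad (Q t) (u t + K t *m x t) (u t + K t *m x t)))%:E.
Proof.
move=> cK cQ cx uL2; rewrite /total_cost /Rintegral fineK//.
apply: integrable_fin_num => //; apply: quad_L1 => //.
  apply: mxL2D => //; apply: mxL2_cts; apply: within_mulmx => //; exact: continuous_subspaceT.
apply: mxL2D => //; apply: mxL2_cts; apply: within_mulmx => //; exact: continuous_subspaceT.
Qed.

End Trajectories.

(** * Observability of the costate *)

Section Observability.
Variable R : realType.
Local Notation mu := (@lebesgue_measure R).
Local Notation J a b f := (\int[mu]_(s in `[a, b]) f s).

Lemma mxBE k l (X Y : 'M[R]_(k, l)) i j : (X - Y) i j = X i j - Y i j.
Proof. by rewrite !mxE. Qed.

Definition fundamental_pair n (F V Vi : R -> 'M[R]_n) : Prop :=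
  [/\ V 0 = 1%:M, forall t, Vi t *m V t = 1%:M,
      forall t, is_derive t (1 : R) V (F t *m V t)
    & forall t, is_derive t (1 : R) Vi (- (Vi t *m F t))].

Lemma fundamental_mulV n (F V Vi : R -> 'M[R]_n) : fundamental_pair F V Vi ->
  forall t, V t *m Vi t = 1%:M.
Proof. by case=> _ VV _ _ t; exact/mulmx1C. Qed.

(** Uniqueness of the transition matrix, since [Vi] times it is constant: the matrices whose
    existence is assumed in the stability and controllability hypotheses become the constructed
    flow. *)
Lemma transition_fundamental n (F V Vi : R -> 'M[R]_n) Phi : fundamental_pair F V Vi ->
  is_transition_matrix F Phi -> forall t tau, Phi t tau = V t *m Vi tau.
Proof.
move=> FP [Phi1 dPhi] t tau; have [_ _ dV dVi] := FP.
have E : Vi t *m Phi t tau = Vi tau *m Phi tau tau.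
  apply: (@is_derive_mx_cst _ _ _ (fun t => Vi t *m Phi t tau)) => s.
  apply: eq_is_derive (is_derive_mulmx (dVi s) (dPhi s tau)) _.
  by rewrite mulNmx mulmxA addNr.
by rewrite -[Phi t tau]mul1mx -(fundamental_mulV FP t) -mulmxA E Phi1 mulmx1.
Qed.

Lemma is_derive_expR_lin (c t : R) :
  is_derive t (1 : R) (fun s => expR (c * s)) (c * expR (c * t)).
Proof.
have dl : is_derive t (1 : R) (fun r => c * r) c.
  by apply: eq_is_derive (is_deriveZ c (is_derive_id t 1)) _; rewrite /GRing.scale /= mulr1.
by rewrite mulrC; exact: (@is_derive1_comp _ (@expR R) (fun r => c * r)).
Qed.

Lemma gronwall (f df : R -> R) (t0 s c k : R) : 0 < c -> 0 <= k ->
  (forall t, is_derive t (1 : R) f (df t)) -> f t0 = 0 ->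
  (forall t, t0 <= t <= t0 + s -> df t <= c * f t + k) ->
  forall t, t0 <= t <= t0 + s -> f t <= k / c * expR (c * s).
Proof.
move=> c0 k0 dfE f0 Hf t /andP[t0t tts].
have kc0 : 0 <= k / c by rewrite divr_ge0// ltW.
have dM r : is_derive r (1 : R) (fun r => expR ((- c) * r) * (f r + k / c))
    (expR ((- c) * r) * (df r - (c * f r + k))).
  have d1 : is_derive r (1 : R) (fun r => f r + k / c) (df r).
    by apply: eq_is_derive (is_deriveD (dfE r) (is_derive_cst (k / c) r 1)) (addr0 _).
  apply: eq_is_derive (is_deriveM (is_derive_expR_lin (- c) r) d1) _.
  by rewrite /GRing.scale /=; field; rewrite gt_eqF.
have [xi] := mvt_between t0 t dM.
have -> : (t0 <= xi <= t) || (t <= xi <= t0) = (t0 <= xi <= t).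
  apply/orb_idr => /andP[h1 h2]; apply/andP; split; first exact: le_trans t0t h1.
  exact: le_trans h2 t0t.
move=> /andP[h1 h2] E.
have M_le : expR ((- c) * t) * (f t + k / c) <= expR ((- c) * t0) * (f t0 + k / c).
  rewrite -subr_le0 E mulr_le0_ge0 ?subr_ge0//.
  rewrite mulr_ge0_le0 ?expR_ge0// subr_le0 Hf// h1/=.
  exact: le_trans tts.
have : f t + k / c <= k / c * expR (c * (t - t0)).
  have := ler_wpM2l (expR_ge0 (c * t)) M_le.
  rewrite !mulrA -!expRD f0 add0r mulNr subrr expR0 mul1r => /le_trans; apply.
  by rewrite mulrC mulrBr mulNr.
move=> H; apply: le_trans (_ : k / c * expR (c * (t - t0)) <= _).
  by apply: le_trans H; rewrite lerDl.
by rewrite ler_wpM2l// ler_expR ler_pM2l// lerBlDl.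
Qed.

Lemma bounded_fun_coord n m (F : R -> 'M[R]_(n, m)) : bounded_fun F ->
  exists2 M : R, 0 < M & forall t i j, `|F t i j| <= M.
Proof.
move=> [M [Mr HM]]; exists (`|M| + 1) => [|t i j]; first by rewrite ltr_wpDl.
apply: le_trans (coord_le_norm _ _ _) _; apply: HM => //.
by rewrite ltr_pwDr// ler_norm.
Qed.

Lemma mx_integral_quad n (a b : R) (X : R -> 'M[R]_n) (x : 'cV[R]_n) : mxL1 a b X ->
  (x^T *m mx_integral a b X *m x) 0 0 = J a b (fun s => (x^T *m X s *m x) 0 0).
Proof.
move=> IX.
have E (Y : 'M[R]_n) : (x^T *m Y *m x) 0 0 = \sum_i \sum_j (x i 0 * x j 0) * Y i j.
  rewrite -mulmxA mxE; apply: eq_bigr => i _; rewrite !mxE mulr_sumr.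
  by apply: eq_bigr => j _; rewrite mulrA mulrAC.
under [RHS]eq_Rintegral do rewrite E.
rewrite E Rintegral_sum; last by move=> i; apply: L1_sum => j; apply: L1Z; exact: IX.
apply: eq_bigr => i _; rewrite Rintegral_sum; last by move=> j; apply: L1Z; exact: IX.
by apply: eq_bigr => j _; rewrite mxE RintegralZl//; exact: IX.
Qed.

Lemma normsq_coef k (x : 'cV[R]_k) : (x^T *m x) 0 0 = \sum_i x i 0 ^+ 2.
Proof. by rewrite mxE; apply: eq_bigr => i _; rewrite mxE expr2. Qed.

Variables (n m : nat) (A : R -> 'M[R]_n) (B : R -> 'M[R]_(n, m)).
Hypotheses (sA : smooth A) (sB : smooth B) (bA : bounded_fun A) (bB : bounded_fun B).

(* [p - q] solves the equation of [q] forced by [K^T B^T p]. *)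
Lemma costate_perturbation (K : R -> 'M[R]_(m, n)) (s : R) : bounded_fun K ->
  exists2 D : R, 0 <= D & forall (p q : R -> 'cV[R]_n) (t0 e : R), 0 <= e ->
    (forall t, is_derive t (1 : R) p (- (A t - B t *m K t)^T *m p t)) ->
    (forall t, is_derive t (1 : R) q (- (A t)^T *m q t)) -> p t0 = q t0 ->
    (forall t, t0 <= t <= t0 + s -> forall j, `|((B t)^T *m p t) j 0| <= e) ->
  forall t, t0 <= t <= t0 + s -> forall i, `|(p t - q t) i 0| <= D * e.
Proof.
move=> bK; have [a a0 Aa] := bounded_fun_coord bA.
have [k k0 Kk] := bounded_fun_coord bK.
(* For the squared norm of the difference [r], the drift contributes at most [2 n a] times that
   norm, and twice the product of [r] and the forcing [h] at most the sum of the two squared norms.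
   Gronwall over length [s] then yields [D1] as the factor of [e ^+ 2]. *)
pose c := 2 * (n%:R * a) + 1.
have c0 : 0 < c by rewrite ltr_wpDl// mulr_ge0// mulr_ge0// ltW.
pose D1 := n%:R * (m%:R * k) ^+ 2 / c * expR (c * s).
exists (Num.sqrt D1); first exact: sqrtr_ge0.
move=> p q t0 e e0 dp dq pq He t tt i.
pose h t := (K t)^T *m ((B t)^T *m p t).
pose r t := p t - q t.
pose dr t := - (A t)^T *m r t + h t.
have drE t' : is_derive t' (1 : R) r (dr t').
  apply: eq_is_derive (is_derive_mxB (dp t') (dq t')) _.
  rewrite /dr /r /h linearB /= trmx_mul mulmxBr !mulNmx mulmxBl mulmxA.
  by rewrite opprB !opprK [RHS]addrC addrA.
pose N t := \sum_j r t j 0 ^+ 2.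
pose dN t := \sum_j 2 * (r t j 0 * dr t j 0).
have dNE t' : is_derive t' (1 : R) N (dN t').
  apply: is_derive_sumr => j.
  have dj : is_derive t' (1 : R) (fun s => r s j 0) (dr t' j 0).
    by have /is_derive_mxP := drE t'; exact.
  under [X in is_derive _ _ X]eq_fun do rewrite expr2.
  by apply: eq_is_derive (is_deriveM dj dj) _; rewrite /GRing.scale /=; ring.
have hb t' : t0 <= t' <= t0 + s -> forall j, `|h t' j 0| <= m%:R * (k * e).
  move=> tt' j; apply: mulmx_coord_le; first exact: ltW.
    by move=> i' j'; rewrite mxE; exact: Kk.
  by move=> i' j'; rewrite ord1; exact: He.
have Nb t' : t0 <= t' <= t0 + s -> dN t' <= c * N t' + n%:R * (m%:R * (k * e)) ^+ 2.
  move=> tt'.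
  have H1 j : 2 * (r t' j 0 * dr t' j 0) <=
      (\sum_l a * (r t' j 0 ^+ 2 + r t' l 0 ^+ 2)) + r t' j 0 ^+ 2
      + (m%:R * (k * e)) ^+ 2.
    have -> : dr t' j 0 = \sum_l - (A t' l j * r t' l 0) + h t' j 0.
      rewrite /dr mulNmx mxE; congr (_ + _); rewrite mxE mxE -sumrN.
      by apply: eq_bigr => l _; rewrite mxE.
    rewrite mulrDr mulrDr -addrA; apply: lerD.
      rewrite !mulr_sumr; apply: ler_sum => l _; have := Aa t' l j; rewrite ler_norml => /andP[h1 h2].
      set x := r t' j 0; set y := r t' l 0; set w := A t' l j.
      have w1 : 0 <= a - w by rewrite /w; lra.
      have w2 : 0 <= a + w by rewrite /w; lra.
      have := mulr_ge0 w1 (sqr_ge0 (x - y)); have := mulr_ge0 w2 (sqr_ge0 (x + y)).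
      nra.
    have := hb _ tt' j; rewrite -[(m%:R * (k * e))]/(m%:R * (k * e)).
    set z := m%:R * _ => hz.
    have : h t' j 0 ^+ 2 <= z ^+ 2.
      rewrite -real_normK ?num_real// lerXn2r ?nnegrE//.
      exact: le_trans (normr_ge0 _) hz.
    by have := sqr_ge0 (r t' j 0 - h t' j 0); nra.
  apply: le_trans (ler_sum _ (fun j _ => H1 j)) _.
  rewrite !big_split /= sumr_const card_ord -[X in _ + X <= _]mulr_natl.
  rewrite lerD2r -/(N t').
  have -> : \sum_(j < n) \sum_(l < n) a * (r t' j 0 ^+ 2 + r t' l 0 ^+ 2) =
      2 * (n%:R * a) * N t'.
    transitivity (\sum_(j < n) a * (n%:R * r t' j 0 ^+ 2 + N t')).
      apply: eq_bigr => j _.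
      by rewrite -mulr_sumr big_split /= sumr_const card_ord mulr_natl.
    rewrite -mulr_sumr big_split /= sumr_const card_ord.
 rewrite -mulr_sumr -/(N t').
    rewrite -[N t' *+ n]mulr_natl; ring.
  by rewrite /c [(_ + 1) * _]mulrDl mul1r.
have N0 : N t0 = 0.
  by rewrite /N big1// => j _; rewrite /r pq subrr mxE expr0n.
have Nle := gronwall c0 _ dNE N0 Nb tt.
have {}Nle : N t <= D1 * e ^+ 2.
  apply: le_trans (Nle _) _; first by rewrite mulr_ge0// sqr_ge0.
  by rewrite le_eqVlt; apply/orP; left; apply/eqP; rewrite /D1; ring.
have ri : r t i 0 ^+ 2 <= D1 * e ^+ 2.
  apply: le_trans Nle; rewrite /N (bigD1 i)//= lerDl.
  by apply: sumr_ge0 => j _; exact: sqr_ge0.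
rewrite -[`|_|]sqrtr_sqr -(ger0_norm e0) -sqrtr_sqr -sqrtrM.
  by rewrite ler_wsqrtr.
by rewrite /D1 mulr_ge0 ?expR_ge0// divr_ge0 ?(ltW c0)// mulr_ge0// sqr_ge0.
Qed.

Hypothesis ctrlAB : uniformly_controllable A B.

(** Bounded feedback preserves observability, on the same window: a closed-loop costate with output
    at most [e] stays within [O(e)] of the open-loop costate with the same initial value, whose
    output is therefore [O(e)] too, and the Gramian of [A] bounds that value. The constant does not
    depend on [t0]. *)
Lemma costate_observability : exists2 s : R, 0 < s &
  forall K : R -> 'M[R]_(m, n), bounded_fun K ->
  exists2 D : R, 0 <= D & forall (p : R -> 'cV[R]_n) (t0 e : R), 0 <= e ->
    (forall t, is_derive t (1 : R) p (- (A t - B t *m K t)^T *m p t)) ->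
    (forall t, t0 <= t <= t0 + s -> forall j, `|((B t)^T *m p t) j 0| <= e) ->
  forall i, (p t0 i 0) ^+ 2 <= D * e ^+ 2.
Proof.
have [Phi PhiT [s [b [s0 b0 gram]]]] := ctrlAB.
exists s => // K bK.
have [D D0 HD] := costate_perturbation s bK.
have [V [Vi FP]] := linear_ode_exists sA.
have [bb bb0 Bb] := bounded_fun_coord bB.
pose E := 1 + n%:R * (bb * D).
exists (m%:R * E ^+ 2 * s / b).
  by apply: divr_ge0; [apply: mulr_ge0; [rewrite mulr_ge0 ?sqr_ge0|exact: ltW]|exact: ltW].
move=> p t0 e e0 dp He i; have [_ VV dV dVi] := FP.
have VVi := fundamental_mulV FP.
(* [q] is the open-loop costate that agrees with [p] at [t0]; its output is at most [E * e], and the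
   integral of its squared output is the Gramian evaluated at [x]. *)
pose x := p t0; pose q t := (Vi t)^T *m ((V t0)^T *m x).
have dq t : is_derive t (1 : R) q (- (A t)^T *m q t).
  apply: eq_is_derive (is_derive_mulmx1 _ (is_derive_trmx (dVi t))) _.
  by rewrite /q linearN /= trmx_mul !mulNmx !mulmxA.
have pq : p t0 = q t0 by rewrite /q mulmxA -trmx_mul VVi trmx1 mul1mx.
have PhiE t : (Phi t0 t)^T *m x = q t.
  by rewrite (transition_fundamental FP PhiT) trmx_mul -mulmxA.
have qb t : t0 <= t <= t0 + s -> forall j, `|((B t)^T *m q t) j 0| <= E * e.
  move=> tt j.
  have -> : (B t)^T *m q t = (B t)^T *m p t - (B t)^T *m (p t - q t).
    by rewrite mulmxBr opprB addrC subrK.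
  rewrite mxBE; apply: le_trans (ler_normB _ _) _.
  rewrite /E mulrDl mul1r -mulrA -mulrA; apply: lerD; first exact: He.
  apply: mulmx_coord_le; first exact: ltW.
    by move=> i' j'; rewrite mxE; exact: Bb.
  by move=> i' j'; rewrite ord1; apply: (HD p q t0 e).
pose X tau := Phi t0 tau *m B tau *m (B tau)^T *m (Phi t0 tau)^T.
have cX : continuous X.
  have cB := smooth_cts sB.
  have cP : continuous (Phi t0).
    rewrite (_ : Phi t0 = fun t => V t0 *m Vi t); last first.
      by apply/funext => t; exact: transition_fundamental FP PhiT _ _.
    apply: cts_mulmx; first by move=> t; exact: cvg_cst.
    by move=> t; exact: is_derive_cts (dVi t).
  by apply: cts_mulmx; [apply: cts_mulmx; [exact: cts_mulmx|exact: cts_trmx]|exact: cts_trmx].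
have IX : mxL1 t0 (t0 + s) X by apply: mxL1_cts; exact: continuous_subspaceT.
have XE t : (x^T *m X t *m x) 0 0 = \sum_j ((B t)^T *m q t) j 0 ^+ 2.
  by rewrite -normsq_coef -PhiE !trmx_mul !trmxK !mulmxA.
have up : (x^T *m mx_integral t0 (t0 + s) X *m x) 0 0 <= m%:R * (E * e) ^+ 2 * s.
  rewrite mx_integral_quad//.
  apply: le_trans (_ : J t0 (t0 + s) (fun=> m%:R * (E * e) ^+ 2) <= _).
    apply: Rintegral_le; [|exact/L2_L1/L2_cst|].
      have cx : continuous (fun t => x^T *m X t *m x).
        apply: cts_mulmx; last by move=> t; exact: cvg_cst.
        by apply: cts_mulmx => //; move=> t; exact: cvg_cst.
      exact/cts_L1/continuous_subspaceT/coord_cts.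
    move=> t tt; rewrite XE; apply: le_trans (_ : \sum_(j < m) (E * e) ^+ 2 <= _).
      apply: ler_sum => j _; rewrite -real_normK ?num_real// lerXn2r ?nnegrE//.
        exact: le_trans (normr_ge0 _) (qb t tt j).
      exact: qb.
    by rewrite sumr_const card_ord mulr_natl.
  by rewrite Rintegral_const ?lerDl ?(ltW s0)// addrC addKr.
have low : b * \sum_j x j 0 ^+ 2 <= (x^T *m mx_integral t0 (t0 + s) X *m x) 0 0.
  have [->|x0] := eqVneq x 0.
    by rewrite mulmx0 mxE big1 ?mulr0// => j _; rewrite mxE expr0n.
  have [_ /(_ x x0)] := gram t0; rewrite mulmxBr mulmxBl mxBE subr_gt0.
  by rewrite mul_mx_scalar -scalemxAl mxE normsq_coef => /ltW.
have xi : x i 0 ^+ 2 <= \sum_j x j 0 ^+ 2.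
  by rewrite (bigD1 i)//= lerDl; apply: sumr_ge0 => j _; exact: sqr_ge0.
have xb : b * x i 0 ^+ 2 <= m%:R * (E * e) ^+ 2 * s.
  by apply: le_trans up; apply: le_trans low; rewrite ler_pM2l.
rewrite -(ler_pM2l b0); apply: le_trans xb _.
by rewrite le_eqVlt; apply/orP; left; apply/eqP; field; rewrite gt_eqF.
Qed.

End Observability.

(** * Extremals *)

Section Extremals.
Variable R : realType.
Local Notation mu := (@lebesgue_measure R).
Local Notation J a b f := (\int[mu]_(s in `[a, b]) f s).

Lemma quad_ge0 k (Q : 'M[R]_k) : posdefmx Q -> forall x, 0 <= quad Q x x.
Proof.
move=> [_ Q0] x; have [->|x0] := eqVneq x 0; first by rewrite /quad mulmx0 mxE.
by apply/ltW; exact: Q0.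
Qed.

Lemma quad_sqrD k (Q : 'M[R]_k) v w : Q^T = Q ->
  quad Q (v + w) (v + w) = quad Q v v + (2 * quad Q v w + quad Q w w).
Proof. by move=> Qs; rewrite quadDl !quadDr (quadC w v Qs); ring. Qed.

Lemma posdefmx_unit k (Q : 'M[R]_k) : posdefmx Q -> Q \in unitmx.
Proof.
move=> [_ Q0]; apply: unitmx_ker0 => v Qv; apply: contraTeq (lexx (0 : R)) => v0.
by have := Q0 v v0; rewrite -mulmxA Qv mulmx0 mxE -ltNge.
Qed.

Lemma succmx_scalar_quad k (Q : 'M[R]_k) a : succmx Q a%:M ->
  forall x : 'cV[R]_k, a * \sum_i x i 0 ^+ 2 <= quad Q x x.
Proof.
move=> [_ Q0] x; have [->|x0] := eqVneq x 0.
  by rewrite /quad mulmx0 mxE big1 ?mulr0// => i _; rewrite mxE expr0n.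
have := Q0 x x0; rewrite mulmxBr mulmxBl mxBE subr_gt0.
by rewrite mul_mx_scalar -scalemxAl mxE normsq_coef => /ltW.
Qed.

Lemma normsq_gt0 k (x : 'cV[R]_k) : x != 0 -> 0 < \sum_i x i 0 ^+ 2.
Proof.
move=> x0; rewrite lt_def sumr_ge0 ?andbT => [|i _]; last exact: sqr_ge0.
apply: contra_neq x0 => s0; apply/colP => i; rewrite mxE; apply/eqP.
rewrite -sqrf_eq0 -[_ == 0]/(x i 0 ^+ 2 == 0); apply/eqP.
by apply: (psumr_eq0P _ s0) => // j _; exact: sqr_ge0.
Qed.

Lemma succmx_scalar_posdef k (Q : 'M[R]_k) a : 0 <= a -> Q^T = Q ->
  succmx Q a%:M -> posdefmx Q.
Proof.
move=> a0 Qs Qa; split=> // x x0; have [_ /(_ x x0)] := Qa.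
rewrite mulmxBr mulmxBl mxBE subr_gt0; apply: le_lt_trans.
by rewrite mul_mx_scalar -scalemxAl mxE normsq_coef mulr_ge0// ltW// normsq_gt0.
Qed.

Variables (n m : nat) (A : R -> 'M[R]_n) (B : R -> 'M[R]_(n, m)).
Hypotheses (sA : smooth A) (sB : smooth B).

Section Extremal.
Variables (K : R -> 'M[R]_(m, n)) (Q : R -> 'M[R]_m) (V Vi : R -> 'M[R]_n).
Hypotheses (sK : smooth K) (sQ : smooth Q) (posQ : forall t, posdefmx (Q t)).

Definition closed_loop t := A t - B t *m K t.

Hypothesis FP : fundamental_pair closed_loop V Vi.

Definition ext_control (p : 'cV[R]_n) t := invmx (Q t) *m ((Vi t *m B t)^T *m p).

Definition ext_gramian :=
  mxprimitive (fun t => Vi t *m B t *m invmx (Q t) *m (Vi t *m B t)^T).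

(** Variation of constants: since [V] is 1 and the signed Gramian is 0 at time 0, [x] and [p] are
    the state and the costate at time 0. *)
Definition ext_state (x p : 'cV[R]_n) t := V t *m (x + ext_gramian t *m p).

Definition costate (p : 'cV[R]_n) t := (Vi t)^T *m p.

Let cB := smooth_cts sB.

Lemma smooth_closed_loop : smooth closed_loop.
Proof. by apply: smoothB; [exact: sA|apply: smoothM; [exact: sB|exact: sK]]. Qed.

Let cF := smooth_cts smooth_closed_loop.

Lemma cts_fundamental_inv : continuous Vi.
Proof. by case: FP => _ _ _ dVi t; exact: is_derive_cts (dVi t). Qed.

Let cVB : continuous (fun t => Vi t *m B t).
Proof. by apply: cts_mulmx => //; exact: cts_fundamental_inv. Qed.

Lemma cts_inv_weight : continuous (fun t => invmx (Q t)).
Proof. by apply/smooth_cts/smooth_inv => // t; exact/posdefmx_unit/posQ. Qed.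

Lemma is_derive_gramian t :
  is_derive t (1 : R) ext_gramian (Vi t *m B t *m invmx (Q t) *m (Vi t *m B t)^T).
Proof.
apply: is_derive_mxprimitive; apply: cts_mulmx; last exact: cts_trmx.
by apply: cts_mulmx => //; exact: cts_inv_weight.
Qed.

Lemma is_derive_costate p t :
  is_derive t (1 : R) (costate p) (- (closed_loop t)^T *m costate p t).
Proof.
have [_ _ _ dVi] := FP.
apply: eq_is_derive (is_derive_mulmx1 _ (is_derive_trmx (dVi t))) _.
by rewrite /costate linearN /= trmx_mul !mulNmx !mulmxA.
Qed.

Lemma control_costate p t : Q t *m ext_control p t = (B t)^T *m costate p t.
Proof.
by rewrite /ext_control mulKVmx ?posdefmx_unit// trmx_mul mulmxA.
Qed.

Lemma cts_control p : continuous (ext_control p).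
Proof.
apply: cts_mulmx; first exact: cts_inv_weight.
by apply: cts_mulmx; [exact: cts_trmx|move=> t; exact: cvg_cst].
Qed.

Lemma is_derive_state x p t : is_derive t (1 : R) (ext_state x p)
  (closed_loop t *m ext_state x p t + B t *m ext_control p t).
Proof.
have [_ VV dV _] := FP.
have dG : is_derive t (1 : R) (fun t => x + ext_gramian t *m p)
    (Vi t *m B t *m invmx (Q t) *m (Vi t *m B t)^T *m p).
  apply: eq_is_derive (is_derive_mxD (is_derive_cst x t 1)
    (is_derive_mulmx1 p (is_derive_gramian t))) (add0r _).
apply: eq_is_derive (is_derive_mulmx (dV t) dG) _.
rewrite /ext_state /ext_control !mulmxA; congr (_ + _).
by rewrite (fundamental_mulV FP) mul1mx.
Qed.

Lemma extremal_trajectory a b x p :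
  trajectory closed_loop B a b (ext_state x p) (ext_control p).
Proof. by apply: trajectory_derive => //; [exact: cts_control|exact: is_derive_state]. Qed.

(* The cross term vanishes: [Q v = B^T p] turns it into the increment of the
   pairing of the costate with the difference of the two trajectories. *)
Lemma cost_split a b x p y w : a <= b ->
  trajectory closed_loop B a b y w ->
  y a = ext_state x p a -> y b = ext_state x p b ->
  let v := ext_control p in
  J a b (fun t => quad (Q t) (w t) (w t)) =
  J a b (fun t => quad (Q t) (v t) (v t)) +
  J a b (fun t => quad (Q t) (w t - v t) (w t - v t)).
Proof.
move=> ab ty ya yb v.
have tx := extremal_trajectory a b x p; rewrite -/v in tx.
have td := trajectory_comb (-1) cF cB ty tx.
have vL2 := trajectory_mxL2 tx; have dL2 := trajectory_mxL2 td.
have cQ := smooth_cts sQ.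
have da : y a + (-1) *: ext_state x p a = 0 by rewrite ya scaleN1r subrr.
have db : y b + (-1) *: ext_state x p b = 0 by rewrite yb scaleN1r subrr.
have := trajectory_duality ab cF cB (is_derive_costate p) td.
rewrite da db !mulmx0 add0r => /esym/matrixP/(_ 0 0).
rewrite !mxE => cross.
have cross0 : J a b (fun t => quad (Q t) (v t) (w t + (-1) *: v t)) = 0.
  rewrite -[RHS]cross; apply: Rintegral_eq => t _; rewrite /quad.
  have <- : (Q t *m v t)^T = (costate p t)^T *m B t.
    by rewrite control_costate trmx_mul trmxK.
  by rewrite [(Q t *m v t)^T]trmx_mul (posQ t).1.
have -> : J a b (fun t => quad (Q t) (w t) (w t)) =
    J a b (fun t => quad (Q t) (v t) (v t) + (2 * quad (Q t) (v t) (w t + (-1) *: v t) +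
      quad (Q t) (w t + (-1) *: v t) (w t + (-1) *: v t))).
  apply: Rintegral_eq => t _; rewrite -(quad_sqrD _ _ (posQ t).1).
  by rewrite addrC scaleN1r subrK.
have Ic := quad_L1 cQ vL2 dL2; have Id := quad_L1 cQ dL2 dL2.
rewrite RintegralD//; [|exact: quad_L1|by apply: L1D => //; exact: L1Z].
rewrite RintegralD//; last exact: L1Z.
rewrite RintegralZl// cross0 mulr0 add0r; congr (_ + _).
by apply: Rintegral_eq => t _; rewrite scaleN1r.
Qed.

Lemma feedback_costE a b x u : trajectory A B a b x u ->
  total_cost (quadratic_cost K Q) a b x u =
  (J a b (fun t => quad (Q t) (u t + K t *m x t) (u t + K t *m x t)))%:E.
Proof.
by move=> [uL2 cx _]; apply: total_costE => //; exact: smooth_cts.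
Qed.

Lemma extremal_minimizer a b x p : a <= b ->
  let u t := ext_control p t - K t *m ext_state x p t in
  minimizer A B (quadratic_cost K Q) a b (ext_state x p a) (ext_state x p b)
    (ext_state x p) u.
Proof.
move=> ab u; have cK := smooth_cts sK; have cQ := smooth_cts sQ.
have uE : (fun t => u t + K t *m ext_state x p t) = ext_control p.
  by apply/funext => t; rewrite /u subrK.
have tu : trajectory A B a b (ext_state x p) u.
  apply: (trajectory_feedback_inv cK); rewrite uE; exact: extremal_trajectory.
split=> // y w ty ya yb.
rewrite !feedback_costE// lee_fin.
have tfy := trajectory_feedback cK ty.
rewrite (cost_split ab tfy ya yb) /u; under Rintegral_eq do rewrite subrK.
by rewrite lerDl; apply: Rintegral_nneg => t _; apply: quad_ge0.
Qed.

Definition costate_observable s := forall (p : R -> 'cV[R]_n) t0,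
  (forall t, is_derive t (1 : R) p (- (closed_loop t)^T *m p t)) ->
  (forall t, t0 <= t <= t0 + s -> (B t)^T *m p t = 0) -> p t0 = 0.

Variable s : R.
Hypothesis obs : costate_observable s.

Lemma costate_inj p t : costate p t = 0 -> p = 0.
Proof.
have [_ VV _ _] := FP.
by move=> /(congr1 (mulmx (V t)^T)); rewrite mulmxA -trmx_mul VV trmx1 mul1mx mulmx0.
Qed.

Lemma costate_observable_open p a b : s < b - a ->
  (forall t, a < t < b -> (B t)^T *m costate p t = 0) -> p = 0.
Proof.
(* The strict inequality leaves room for a closed window of length [s] centred inside the open
   interval; only interior times are available where vanishing is deduced from derivatives. *)
move=> sab Bp; pose d := (b - a - s) / 2.
apply: (@costate_inj p (a + d)); apply: obs => [t|t /andP[h1 h2]].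
  exact: is_derive_costate.
by apply: Bp; rewrite /d in h1 h2; apply/andP; split; lra.
Qed.

Lemma gramian_quad_derive p t :
  is_derive t (1 : R) (fun t => (p^T *m ext_gramian t *m p) 0 0)
    (quad (Q t) (ext_control p t) (ext_control p t)).
Proof.
have /is_derive_mxP/(_ 0 0) := is_derive_mulmx1 p (is_derive_mul1mx p^T (is_derive_gramian t)).
move=> H; apply: eq_is_derive H _; rewrite /quad.
rewrite -[in RHS]mulmxA control_costate /ext_control /costate !trmx_mul !trmxK.
by rewrite trmx_inv (posQ t).1 !mulmxA.
Qed.

(** The derivative of [p^T G p] is the running cost of the extremal control. If its increment
    vanishes, so does that control inside the window, hence also [B^T] times the costate, and
    observability gives [p = 0]. *)
Lemma gramian_posdef a b : 0 <= s -> s < b - a -> posdefmx (ext_gramian b - ext_gramian a).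
Proof.
move=> s0 sab; have ab : a < b by lra.
split.
  have dT t : is_derive t (1 : R) (fun t => ext_gramian t - (ext_gramian t)^T) 0.
    apply: eq_is_derive (is_derive_mxB (is_derive_gramian t)
      (is_derive_trmx (is_derive_gramian t))) _.
    by rewrite !trmx_mul !trmxK trmx_inv (posQ t).1 !mulmxA subrr.
  have := is_derive_mx_cst dT b a.
  move: (ext_gramian b) (ext_gramian a) => Y X /matrixP E.
  by apply/matrixP => i j; have := E i j; rewrite !mxE; lra.
move=> p p0.
pose h t := (p^T *m ext_gramian t *m p) 0 0.
pose dh t := quad (Q t) (ext_control p t) (ext_control p t).
have dhE t : is_derive t (1 : R) h (dh t) by exact: gramian_quad_derive.
have dh0 t : 0 <= dh t by apply: quad_ge0.
have hmono x y : x <= y -> h x <= h y.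
  move=> xy; have [c _ E] := mvt_between x y dhE.
  by rewrite -subr_ge0 E mulr_ge0// subr_ge0.
rewrite mulmxBr mulmxBl mxBE -/(h b) -/(h a) lt_def subr_ge0 hmono ?ltW// andbT.
rewrite subr_eq0; apply: contra_neq p0 => hba.
apply: (@costate_observable_open p a b sab) => t /andP[at_ tb].
(* [h] is monotone with equal values at [a] and [b], hence constant between them, so its derivative
   vanishes at interior points. *)
have dht : dh t = 0.
  have c1 : is_derive t (1 : R) (cst (h a)) (0 : R) by exact: is_derive_cst.
  have c2 : is_derive t (1 : R) h (0 : R).
    apply: near_eq_is_derive c1; near=> r.
    have ar : a <= r by apply/ltW; near: r; exact: lt_nbhsr.
    have rb : r <= b by apply/ltW; near: r; exact: lt_nbhsl.
    by apply: le_anti; rewrite /cst hmono// -hba; exact: hmono.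
  by have := @derive_val _ _ _ _ _ _ _ c2; rewrite (@derive_val _ _ _ _ _ _ _ (dhE t)).
rewrite -control_costate.
have [->|v0] := eqVneq (ext_control p t) 0; first by rewrite mulmx0.
by have := (posQ t).2 _ v0; rewrite -[X in 0 < X]/(dh t) dht ltxx.
Unshelve. all: by end_near. Qed.

Lemma extremal_through a b xa xb : 0 <= s -> s < b - a ->
  exists x p, ext_state x p a = xa /\ ext_state x p b = xb.
Proof.
move=> s0 sab; have uG := posdefmx_unit (gramian_posdef s0 sab).
pose D := ext_gramian b - ext_gramian a.
(* Subtracting the two endpoint equations, pulled back to time 0 by [Vi], eliminates [x] and leaves
   [D p]. *)
pose p := invmx D *m (Vi b *m xb - Vi a *m xa).
exists (Vi a *m xa - ext_gramian a *m p), p; rewrite /ext_state; split.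
  by rewrite subrK mulmxA (fundamental_mulV FP) mul1mx.
rewrite addrAC -addrA -mulmxBl -/D /p mulKVmx// addrC subrK.
by rewrite mulmxA (fundamental_mulV FP) mul1mx.
Qed.

Hypothesis injB : forall t, injective (fun v : 'cV[R]_m => B t *m v).

(** An extremal curve seen on a long enough window determines its data: differentiating and using
    the injectivity of [B] gives a zero control, observability gives [p = 0], and the flow gives
    [x = 0]. It serves to glue windows. *)
Lemma ext_state_zero x p a b : 0 <= s -> s < b - a ->
  (forall t, a < t < b -> ext_state x p t = 0) -> x = 0 /\ p = 0.
Proof.
move=> s0 sab x0.
have p0 : p = 0.
  apply: (@costate_observable_open p a b sab) => t /[dup] tab /andP[at_ tb].
  rewrite -control_costate; suff -> : ext_control p t = 0 by rewrite mulmx0.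
  apply: (@injB t); rewrite mulmx0.
  have c1 : is_derive t (1 : R) (cst (0 : 'cV[R]_n)) (0 : 'cV[R]_n) by exact: is_derive_cst.
  have c2 : is_derive t (1 : R) (ext_state x p) (0 : 'cV[R]_n).
    apply: near_eq_is_derive c1; near=> r.
    have ar : a < r by near: r; exact: lt_nbhsr.
    have rb : r < b by near: r; exact: lt_nbhsl.
    by rewrite x0 ?ar ?rb.
  have := @derive_val _ _ _ _ _ _ _ c2.
  rewrite (@derive_val _ _ _ _ _ _ _ (is_derive_state x p t)) x0// mulmx0 add0r.
  by [].
split=> //; have [_ VV _ _] := FP; pose c := (a + b) / 2.
have : ext_state x p c = 0 by apply: x0; rewrite /c; apply/andP; split; lra.
rewrite /ext_state p0 mulmx0 addr0 => /(congr1 (mulmx (Vi c))).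
by rewrite mulmxA VV mul1mx mulmx0.
Unshelve. all: by end_near. Qed.

Lemma ext_stateB x p x' p' t :
  ext_state (x - x') (p - p') t = ext_state x p t - ext_state x' p' t.
Proof.
rewrite /ext_state -mulmxBr; congr (_ *m _); rewrite mulmxBr opprD addrACA.
by [].
Qed.

Hypothesis coercQ : exists2 al : R, 0 < al & forall t, succmx (Q t) al%:M.

(** The case of Cauchy-Schwarz with a null factor: the product is at most [e g^2 + f^2 / e] for
    every [e > 0], and the second term integrates to 0. *)
Lemma L2_orthogonal a b (f g : R -> R) : L2 a b f -> L2 a b g ->
  J a b (fun t => f t ^+ 2) = 0 -> J a b (fun t => g t * f t) = 0.
Proof.
move=> Lf Lg f0; have If := Lf.2; have Ig := Lg.2.
have Ifg := L2_mul Lg Lf.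
set G := J a b (fun t => g t ^+ 2).
have bound e : 0 < e -> `|J a b (fun t => g t * f t)| <= e * G.
  move=> e0; apply: le_trans (normr_Rintegral_le Ifg) _.
  have -> : e * G = J a b (fun t => e * g t ^+ 2 + e^-1 * f t ^+ 2).
    rewrite RintegralD//; [|exact: L1Z|exact: L1Z].
    by rewrite !RintegralZl// f0 mulr0 addr0.
  apply: Rintegral_le; [exact: L1_norm|by apply: L1D; exact: L1Z|].
  move=> t _; rewrite normrM.
  have -> : e * g t ^+ 2 + e^-1 * f t ^+ 2 = (e * `|g t| - `|f t|) ^+ 2 / e + 2 * (`|g t| * `|f t|).
    rewrite -[g t ^+ 2]real_normK ?num_real// -[f t ^+ 2]real_normK ?num_real//.
    by field; rewrite gt_eqF.
  have h1 : 0 <= (e * `|g t| - `|f t|) ^+ 2 / e by rewrite divr_ge0 ?sqr_ge0// ltW.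
  have h2 : 0 <= `|g t| * `|f t| by rewrite mulr_ge0.
  lra.
apply/eqP; rewrite -normr_le0; apply/ler_addgt0Pr => e e0; rewrite add0r.
have G0 : 0 <= G by apply: Rintegral_nneg => t _; exact: sqr_ge0.
apply: le_trans (bound (e / (G + 1)) _) _; first by rewrite divr_gt0// ltr_wpDl.
by rewrite mulrAC ler_pdivrMr ?ltr_wpDl// ler_pM2l// lerDl.
Qed.

(** The extremal with the same endpoints costs no more, and [cost_split] measures the excess by the
    quadratic form of the difference [d] of controls. Coercivity makes every coordinate of [d] null
    in square mean, which must then be converted into equality of the states at every time. *)
Lemma minimizer_extremal a b xa xb y w : 0 <= s -> s < b - a ->
  minimizer A B (quadratic_cost K Q) a b xa xb y w ->
  exists x p, forall t, a <= t <= b -> y t = ext_state x p t.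
Proof.
move=> s0 sab [ty ya yb ymin]; have ab : a <= b by lra.
have cK := smooth_cts sK; have cQ := smooth_cts sQ.
have [x [p [xE pE]]] := extremal_through xa xb s0 sab.
exists x, p; have [te _ _ _] := extremal_minimizer x p ab.
have := ymin _ _ te; rewrite xE pE => /(_ erefl erefl).
rewrite !feedback_costE// lee_fin; under [leRHS]Rintegral_eq do rewrite subrK.
have tfy := trajectory_feedback cK ty.
have ya' : y a = ext_state x p a by rewrite xE.
have yb' : y b = ext_state x p b by rewrite pE.
rewrite (cost_split ab tfy ya' yb') gerDl => dle.
have td := trajectory_comb (-1) cF cB tfy (extremal_trajectory a b x p).
set d := fun t => w t + K t *m y t - ext_control p t.
have dE : (fun t => w t + K t *m y t + (-1) *: ext_control p t) = d.
  by apply/funext => t; rewrite scaleN1r.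
rewrite dE in td; have dL2 := trajectory_mxL2 td.
have [al al0 Qal] := coercQ.
have d0 i : J a b (fun t => d t i 0 ^+ 2) = 0.
  apply/eqP; rewrite eq_le Rintegral_nneg ?andbT => [|t _]; last exact: sqr_ge0.
  rewrite -(pmulr_rle0 _ al0) -RintegralZl//; last exact: (dL2 i).2.
  apply: le_trans dle; apply: Rintegral_le; [apply: L1Z; exact: (dL2 i).2|exact: quad_L1|].
  move=> t _; apply: le_trans (succmx_scalar_quad (Qal t) (d t)).
  by rewrite ler_pM2l// (bigD1 i)//= lerDl; apply: sumr_ge0 => j _; exact: sqr_ge0.
have da : y a + (-1) *: ext_state x p a = 0 by rewrite ya' scaleN1r subrr.
move=> t /andP[at_ tb].
have tdt := trajectory_sub tb td; have dL2t := trajectory_mxL2 tdt.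
have d0t i : J a t (fun t => d t i 0 ^+ 2) = 0.
  apply/eqP; rewrite eq_le Rintegral_nneg ?andbT => [|r _]; last exact: sqr_ge0.
  have := d0 i; rewrite (@RintegralD_chasles _ a b t) ?at_//; last exact: (dL2 i).2.
  have : 0 <= J t b (fun t => d t i 0 ^+ 2) by apply: Rintegral_nneg => r _; exact: sqr_ge0.
  by move=> ? ?; lra.
(* Duality expresses the pairing with any costate as an integral of products with [d], all zero; at
   time [t] costates take every value, in particular the difference of the states itself. *)
have z0 (q : 'cV[R]_n) : (costate q t)^T *m (y t - ext_state x p t) = 0.
  have := trajectory_duality at_ cF cB (is_derive_costate q) tdt.
  rewrite da mulmx0 add0r scaleN1r => ->.
  apply/matrixP => i j; rewrite !mxE !ord1.
  under eq_Rintegral do rewrite mxE.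
  have cqB : continuous (fun r => (costate q r)^T *m B r).
    apply: cts_mulmx => //; apply: cts_trmx => r; exact: is_derive_cts (is_derive_costate q r).
  have qBL2 k : L2 a t (fun r => ((costate q r)^T *m B r) 0 k).
    by apply/L2_cts/continuous_subspaceT/coord_cts.
  rewrite Rintegral_sum => [|k]; last by apply: L2_mul; [exact: qBL2|exact: dL2t].
  by rewrite big1// => k _; apply: L2_orthogonal => //; exact: dL2t.
apply/eqP; rewrite -subr_eq0; apply/eqP; set z := y t - _.
have cz : costate ((V t)^T *m z) t = z.
  by rewrite /costate mulmxA -trmx_mul (fundamental_mulV FP) trmx1 mul1mx.
have := z0 ((V t)^T *m z); rewrite cz -/z => /matrixP/(_ 0 0).
rewrite normsq_coef mxE => zz; apply: contra_eq zz => z_neq.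
by rewrite gt_eqF// normsq_gt0.
Qed.

End Extremal.

End Extremals.

(** * Equivalent costs *)

Section EquivalentCosts.
Variable R : realType.
Variables (n m : nat) (A : R -> 'M[R]_n) (B : R -> 'M[R]_(n, m)).
Hypotheses (sA : smooth A) (sB : smooth B).
Hypothesis injB : forall t, injective (fun v : 'cV[R]_m => B t *m v).

Lemma stable_fundamental (F V Vi : R -> 'M[R]_n) : fundamental_pair F V Vi ->
  exponentially_stable F ->
  exists al la : R, [/\ 0 < al, 0 < la &
    forall t, 0 <= t -> forall i j, `|V t i j| <= al * expR (- (la * t))].
Proof.
move=> FP [Phi PhiT [al [la [al0 la0 H]]]]; exists al, la; split=> // t t0 i j.
have [V0 VV _ _] := FP.
have VE : Phi t 0 = V t.
  rewrite (transition_fundamental FP PhiT).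
  by have := VV 0; rewrite V0 mulmx1 => ->; rewrite mulmx1.
rewrite -VE; apply: le_trans (coord_le_norm _ _ _) _.
by have := H t 0 t0; rewrite subr0 mulNr.
Qed.

Lemma exp_small_eq0 (x C la : R) : 0 < la -> 0 <= C ->
  (forall t, 0 <= t -> `|x| <= C * expR (- (la * t))) -> x = 0.
Proof.
move=> la0 C0 H; apply/eqP; rewrite -normr_eq0; apply/negPn/negP => x0.
have {}x0 : 0 < `|x| by rewrite lt_def x0 normr_ge0.
(* At this time [expR (la * t)] is at least [1 + C / |x|], so [|x| * expR (la * t)] exceeds [C]. *)
pose t := C / `|x| / la.
have t0 : 0 <= t by rewrite /t !divr_ge0// ltW.
have e0 := expR_gt0 (la * t).
have := H t t0; rewrite expRN ler_pdivlMr//.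
have := expR_ge1Dx (la * t).
have -> : la * t = C / `|x| by rewrite /t; field; rewrite !gt_eqF.
move=> /(ler_wpM2l (ltW x0)); rewrite mulrDr mulr1 mulrCA divff ?gt_eqF// mulr1.
move=> h1 h2; have := le_trans h1 h2; rewrite gerDr.
by move=> /le_lt_trans/(_ x0); rewrite ltxx.
Qed.

Section TwoCosts.
Variables (K1 K2 : R -> 'M[R]_(m, n)) (Q1 Q2 : R -> 'M[R]_m) (V1 Vi1 V2 Vi2 : R -> 'M[R]_n).
Hypotheses (sK1 : smooth K1) (sK2 : smooth K2) (sQ1 : smooth Q1) (sQ2 : smooth Q2).
Hypotheses (posQ1 : forall t, posdefmx (Q1 t)) (posQ2 : forall t, posdefmx (Q2 t)).
Hypothesis coercQ2 : exists2 al : R, 0 < al & forall t, succmx (Q2 t) al%:M.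
Hypothesis FP1 : fundamental_pair (closed_loop A B K1) V1 Vi1.
Hypothesis FP2 : fundamental_pair (closed_loop A B K2) V2 Vi2.
Variable s : R.
Hypothesis s0 : 0 < s.
Hypothesis obs2 : costate_observable A B K2 s.

Local Notation state1 := (ext_state B Q1 V1 Vi1).
Local Notation state2 := (ext_state B Q2 V2 Vi2).

(** Equality of syntheses only concerns compact windows, and the data (x', p') could vary with the
    window. All windows contain [[-s, s]], of length greater than [s], where the curve already
    determines its data. *)
Lemma extremal_transfer :
  optimal_synthesis A B (quadratic_cost K1 Q1) `<=` optimal_synthesis A B (quadratic_cost K2 Q2) ->
  forall x p, exists x' p', forall t, state1 x p t = state2 x' p' t.
Proof.
move=> syn x p.
have win (T : R) : s <= T -> exists x' p', forall t, - T <= t <= T -> state1 x p t = state2 x' p' t.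
  move=> sT; have T0 : - T < T by have := s0; lra.
  have : optimal_synthesis A B (quadratic_cost K1 Q1) (- T, T, state1 x p).
    split=> //; exists (state1 x p (- T)), (state1 x p T).
    eexists; apply: extremal_minimizer => //; exact: ltW.
  move=> /syn[_ [xa [xb [u umin]]]].
  by apply: (minimizer_extremal sA sB sK2 sQ2 posQ2 FP2 obs2 coercQ2 _ _ umin); have := s0; lra.
have [x' [p' E]] := win s (lexx s).
exists x', p' => t; pose T := s + `|t|.
have sT : s <= T by rewrite lerDl.
have [x2 [p2 E2]] := win T sT.
suff [/eqP] : x2 - x' = 0 /\ p2 - p' = 0.
  rewrite subr_eq0 => /eqP <- /eqP; rewrite subr_eq0 => /eqP <-; apply: E2.
  by rewrite -ler_norml /T lerDr ltW.
have sw : s < s - - s by have := s0; lra.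
apply: (ext_state_zero sB sQ2 posQ2 FP2 obs2 injB (ltW s0) sw) => r /andP[r1 r2].
rewrite ext_stateB -E2 -?E ?subrr//; apply/andP; split; have := s0; lra.
Qed.

Lemma state_eq_control x p x' p' : (forall t, state1 x p t = state2 x' p' t) ->
  forall t, ext_control B Q1 Vi1 p t - K1 t *m state1 x p t =
            ext_control B Q2 Vi2 p' t - K2 t *m state1 x p t.
Proof.
move=> E t; apply: (@injB t) => /=.
have E' : state1 x p = state2 x' p' by apply/funext.
have := @derive_val _ _ _ _ _ _ _ (is_derive_state sB sQ2 posQ2 FP2 x' p' t) .
have := @derive_val _ _ _ _ _ _ _ (is_derive_state sB sQ1 posQ1 FP1 x p t).
rewrite -E' => ->; rewrite /closed_loop !mulmxBl -!addrA => /addrI H.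
rewrite !mulmxBr [B t *m (K1 t *m _)]mulmxA [B t *m (K2 t *m _)]mulmxA.
by rewrite [LHS]addrC [RHS]addrC.
Qed.

Hypotheses (bK1 : bounded_fun K1) (bK2 : bounded_fun K2) (bQ2 : bounded_fun Q2).
Hypotheses (stab1 : exponentially_stable (closed_loop A B K1))
           (stab2 : exponentially_stable (closed_loop A B K2)).
Hypothesis obsq2 : exists2 D : R, 0 <= D & forall (p : R -> 'cV[R]_n) (t0 e : R), 0 <= e ->
    (forall t, is_derive t (1 : R) p (- (A t - B t *m K2 t)^T *m p t)) ->
    (forall t, t0 <= t <= t0 + s -> forall j, `|((B t)^T *m p t) j 0| <= e) ->
  forall i, (p t0 i 0) ^+ 2 <= D * e ^+ 2.

(* A trajectory with zero costate decays, hence so does [B^T p'] for its other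
   costate [p']; by observability [p'] itself decays, whereas a nonzero costate
   of a stable closed loop cannot. *)
Lemma stable_costate0 x x' p' : (forall t, state1 x 0 t = state2 x' p' t) -> p' = 0.
Proof.
move=> E; have [D D0 HD] := obsq2.
have [al [la [al0 la0 V1b]]] := stable_fundamental FP1 stab1.
have [al2 [la2 [al20 la20 V2b]]] := stable_fundamental FP2 stab2.
have [k1 k10 K1b] := bounded_fun_coord bK1.
have [k2 k20 K2b] := bounded_fun_coord bK2.
have [q q0 Q2b] := bounded_fun_coord bQ2.
(* With zero costate the first control is [- K1 x], so equality of controls makes the second
   extremal control [(K2 - K1) x]; weighting it by [Q2] gives [B^T] times its costate. *)
have BpE t : (B t)^T *m costate Vi2 p' t = Q2 t *m ((K2 t - K1 t) *m (V1 t *m x)).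
  rewrite -(@control_costate _ _ _ B Q2 Vi2 posQ2).
  congr (_ *m _); have := state_eq_control E t.
  rewrite /ext_control !mulmx0 add0r -/(ext_control B Q2 Vi2 p' t) => /eqP.
  rewrite eq_sym subr_eq => /eqP ->; rewrite /ext_state mulmx0 addr0.
  by rewrite mulmxBl addrC.
pose C := m%:R * (q * (n%:R * ((k2 + k1) * (n%:R * (al * `|x|))))).
have C0 : 0 <= C by rewrite !mulr_ge0// ?addr_ge0// ltW.
have Bpb t : 0 <= t -> forall j, `|((B t)^T *m costate Vi2 p' t) j 0| <= C * expR (- (la * t)).
  move=> t0 j; rewrite BpE.
  have -> : C * expR (- (la * t)) =
    m%:R * (q * (n%:R * ((k2 + k1) * (n%:R * ((al * expR (- (la * t))) * `|x|))))).
    by rewrite /C; ring.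
  apply: mulmx_coord_le; [exact: ltW|by move=> *; exact: Q2b|].
  apply: mulmx_coord_le; [by rewrite addr_ge0// ltW| |].
    move=> i l; rewrite mxBE; apply: le_trans (ler_normB _ _) _.
    by apply: lerD; [exact: K2b|exact: K1b].
  apply: mulmx_coord_le; [by rewrite mulr_ge0 ?expR_ge0// ltW|exact: V1b|].
  by move=> i l; exact: coord_le_norm.
have pb t : 0 <= t -> forall i,
    `|costate Vi2 p' t i 0| <= Num.sqrt D * (C * expR (- (la * t))).
  move=> t0 i; set e := C * _.
  have e0 : 0 <= e by rewrite mulr_ge0// expR_ge0.
  have : costate Vi2 p' t i 0 ^+ 2 <= D * e ^+ 2.
    apply: (HD (costate Vi2 p')) => //; first exact: (is_derive_costate FP2).
    move=> r /andP[tr _] j; apply: le_trans (Bpb r (le_trans t0 tr) j) _.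
    by rewrite /e ler_wpM2l// ler_expR lerN2 ler_pM2l.
  move=> /ler_wsqrtr; rewrite sqrtr_sqr sqrtrM// sqrtr_sqr.
  by rewrite (ger0_norm e0).
apply/matrixP => i j; rewrite ord1 [RHS]mxE.
have C'0 : 0 <= n%:R * (al2 * (Num.sqrt D * C)).
  by rewrite mulr_ge0// mulr_ge0 ?(ltW al20)// mulr_ge0 ?sqrtr_ge0.
apply: (exp_small_eq0 la0 C'0) => t t0.
(* The constant [p'] is recovered from the decaying costate through [V2^T], which is bounded in
   forward time, so it is arbitrarily small. *)
have -> : p' = (V2 t)^T *m costate Vi2 p' t.
  by rewrite /costate mulmxA -trmx_mul; have [_ -> _ _] := FP2; rewrite trmx1 mul1mx.
have -> : n%:R * (al2 * (Num.sqrt D * C)) * expR (- (la * t)) =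
   n%:R * (al2 * (Num.sqrt D * (C * expR (- (la * t))))) by ring.
apply: mulmx_coord_le; first exact: ltW.
  move=> a b; rewrite mxE; apply: le_trans (V2b t t0 b a) _.
  by rewrite ger_pMr// expR_le1 oppr_le0 mulr_ge0// ltW.
by move=> a b; rewrite ord1; exact: pb.
Qed.

Lemma equivalent_feedback :
  optimal_synthesis A B (quadratic_cost K1 Q1) `<=` optimal_synthesis A B (quadratic_cost K2 Q2) ->
  K1 = K2.
Proof.
move=> syn; apply/funext => t.
have Kx (x : 'cV[R]_n) : K1 t *m (V1 t *m x) = K2 t *m (V1 t *m x).
  have [x' [p' E]] := extremal_transfer syn x 0.
  have p0 := stable_costate0 E; have := state_eq_control E t.
  rewrite p0 /ext_control !mulmx0 !add0r /ext_state mulmx0 addr0.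
  exact: oppr_inj.
have KV : K1 t *m V1 t = K2 t *m V1 t.
  apply/matrixP => i j; have := Kx (delta_mx j 0); rewrite !mulmxA => /matrixP/(_ i 0).
  by rewrite -!colE !mxE.
have := congr1 (mulmxr (Vi1 t)) KV; rewrite /= -!mulmxA (fundamental_mulV FP1).
by rewrite !mulmx1.
Qed.

End TwoCosts.
End EquivalentCosts.

(** * The product structure of an equivalent cost *)

Section KatoFrame.
Variable R : realType.

Lemma smooth_horner n (F : R -> 'M[R]_n.+1) (q : {poly R}) : smooth F ->
  smooth (fun t => horner_mx (F t) q).
Proof.
move=> sF; elim/poly_ind: q => [|q c IH].
  by under eq_fun do rewrite rmorph0; exact: smooth_cst.
under eq_fun do rewrite rmorphD rmorphM /= horner_mx_X horner_mx_C.
by apply: smoothD; [exact: smoothM|exact: smooth_cst].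
Qed.

(* Kato's transport: the flow of the commutator [E' E - E E'] conjugates [E 0]
   to [E t]. *)
Lemma projection_frame n (E : R -> 'M[R]_n) : smooth E ->
  (forall t, E t *m E t = E t) ->
  exists V W : R -> 'M[R]_n, [/\ smooth V, forall t, W t *m V t = 1%:M &
    forall t, E t *m V t = V t *m E 0].
Proof.
move=> sE EE; have sdE := smooth_derive1 sE.
pose dE := derive1 E; have dEE t : is_derive t (1 : R) E (dE t) by exact: smooth_derive.
have EdE t : dE t = dE t *m E t + E t *m dE t.
  have := is_derive_derive1 (is_derive_mulmx (dEE t) (dEE t)).
  by under [X in derive1 X]eq_fun do rewrite EE.
have EdEE t : E t *m dE t *m E t = 0.
  have := congr1 (fun Y => E t *m Y *m E t) (EdE t).
  rewrite /= mulmxDr mulmxDl !mulmxA EE -[_ *m E t *m E t]mulmxA EE.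
  by rewrite -[LHS]addr0 => /addrI.
pose X t := dE t *m E t - E t *m dE t.
have sX : smooth X by apply: smoothB; apply: smoothM.
have [V [W [V0 WV dV dW]]] := linear_ode_exists sX.
have VW t : V t *m W t = 1%:M by exact/mulmx1C.
have WEV t : W t *m E t *m V t = E 0.
  have -> : E 0 = W 0 *m E 0 *m V 0.
    by have := WV 0; rewrite V0 !mulmx1 => ->; rewrite mul1mx.
  apply: (@is_derive_mx_cst _ _ _ (fun t => W t *m E t *m V t)) => r.
  apply: eq_is_derive (is_derive_mulmx (is_derive_mulmx (dW r) (dEE r)) (dV r)) _.
  (* That is, [E' = X E - E X]: differentiating [E E = E] gives [E' = E' E + E E'] and [E E' E = 0].
     Conjugation by the flow of [X] then freezes [E]. *)
  have key : dE r + E r *m X r - X r *m E r = 0.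
    rewrite /X mulmxBr mulmxBl !mulmxA EdEE EE -[_ *m E r *m E r]mulmxA EE.
    by rewrite sub0r subr0 {1}EdE addrK subrr.
  move: (X r) key => Y key.
  transitivity (W r *m (dE r + E r *m Y - Y *m E r) *m V r).
    by rewrite mulmxBr mulmxDr !mulmxBl !mulmxDl !mulNmx !mulmxA [RHS]addrC addrA.
  by rewrite key mulmx0 mul0mx.
exists V, W; split; [exact: (smooth_ode sX)|exact: WV|].
by move=> t; rewrite -(WEV t) !mulmxA VW mul1mx.
Qed.

End KatoFrame.

Section ProductStructureConstruction.
Variable R : realType.

Lemma mulmx_inj_rank n m (b : 'M[R]_(n, m)) (X : 'M[R]_m) :
  injective (fun v : 'cV[R]_m => b *m v) -> \rank (b *m X) = \rank X.
Proof.
move=> binj; rewrite -mxrank_tr trmx_mul mxrankMfree ?mxrank_tr//.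
apply: inj_row_free => v vb; apply: trmx_inj; rewrite trmx0.
by apply: binj; rewrite mulmx0 -[b]trmxK -trmx_mul vb trmx0.
Qed.

Lemma mulmx_inj n m p (b : 'M[R]_(n, m)) (X Y : 'M[R]_(m, p)) :
  injective (fun v : 'cV[R]_m => b *m v) -> b *m X = b *m Y -> X = Y.
Proof.
move=> binj bXY; apply/matrixP => i j.
have : col j X = col j Y.
  by apply: binj; rewrite /= !colE !mulmxA bXY.
by move=> /colP/(_ i); rewrite !mxE.
Qed.

Definition split2 (n k : nat) (i : 'I_2) : nat := if i == ord0 then k else (n - k)%N.

Lemma sum_split2 n k : (k <= n)%N -> (\sum_i split2 n k i)%N = n.
Proof. by move=> kn; rewrite !big_ord_recl big_ord0 /split2 /= addn0 subnKC. Qed.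

Variables (n m : nat) (A : R -> 'M[R]_n.+1) (B : R -> 'M[R]_(n.+1, m.+1)).
Variables (K : R -> 'M[R]_(m.+1, n.+1)) (Q : R -> 'M[R]_m.+1) (V Vi : R -> 'M[R]_n.+1).
Hypotheses (sV : smooth V) (FP : fundamental_pair (closed_loop A B K) V Vi).
Hypothesis injB : forall t, injective (fun v : 'cV[R]_m.+1 => B t *m v).

Let injVB t : injective (fun v : 'cV[R]_m.+1 => Vi t *m B t *m v).
Proof.
move=> v w /= /(congr1 (mulmx (V t))); rewrite !mulmxA (fundamental_mulV FP) !mul1mx.
exact: injB.
Qed.

(* In the frame [V M0], where [V] is the flow of the closed loop, the drift
   vanishes, so that only [B] and [Q] remain to be split. *)
Lemma product_structure_of_projection (E : 'M[R]_n.+1) (S : R -> 'M[R]_m.+1) :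
  smooth S -> E *m E = E ->
  (forall t, E *m (Vi t *m B t) = Vi t *m B t *m S t) ->
  (forall t, Q t *m S t = (S t)^T *m Q t) ->
  (exists t, E *m (Vi t *m B t) != 0) ->
  (exists t, (1%:M - E) *m (Vi t *m B t) != 0) ->
  admits_product_structure A B K Q.
Proof.
move=> sS EE ES QS nz nz1.
have SS t : S t *m S t = S t.
  by apply: (mulmx_inj (@injVB t)); rewrite mulmxA -ES -mulmxA -ES mulmxA EE.
have [L [Li [sL LL SL]]] := projection_frame sS SS.
have LLi t : L t *m Li t = 1%:M by exact/mulmx1C.
have StE t : S t = L t *m S 0 *m Li t by rewrite -SL -mulmxA LLi mulmx1.
have [M0 uM0 EM0] := idempotent_pid EE.
have [U0 uU0 SU0] := idempotent_pid (SS 0).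
set k := \rank E in EM0; set l := \rank (S 0) in SU0.
have kn : (k <= n.+1)%N by exact: rank_leq_row.
have lm : (l <= m.+1)%N by exact: rank_leq_row.
(* The frame makes every [S t] similar to [S 0], so being nonzero at one time is enough. *)
have l0 : (0 < l)%N.
  rewrite lt0n mxrank_eq0; case: nz => t; apply: contra_neq => S0.
  by rewrite ES StE S0 mulmx0 mul0mx mulmx0.
(* The required inequality between input and state dimensions: injectivity preserves the rank of
   [S 0], and [E] intertwines with it. The complementary projections give the other block. *)
have lk : (l <= k)%N.
  rewrite /l -(mulmx_inj_rank _ (@injVB 0)) -ES; exact: mxrankM_maxl.
have rS1 : \rank (1%:M - S 0) = (m.+1 - l)%N by exact: rank_compl_idempotent.
have ES1 t : (1%:M - E) *m (Vi t *m B t) = Vi t *m B t *m (1%:M - S t).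
  by rewrite mulmxBl mulmxBr mul1mx mulmx1 ES.
have ml0 : (0 < m.+1 - l)%N.
  rewrite -rS1 lt0n mxrank_eq0; case: nz1 => t; apply: contra_neq => /eqP.
  rewrite subr_eq0 => /eqP S1.
  by rewrite ES1 StE -S1 mulmx1 LLi subrr mulmx0.
have mlnk : (m.+1 - l <= n.+1 - k)%N.
  rewrite -rS1 -(mulmx_inj_rank _ (@injVB 0)) -ES1 -(rank_compl_idempotent EE).
  exact: mxrankM_maxl.
exists 2, (split2 n.+1 k), (split2 m.+1 l), (sum_split2 kn), (sum_split2 lm).
exists (fun t => V t *m M0), (fun t => L t *m U0).
have uV t : V t \in unitmx.
  by have [_ VV _ _] := FP; have [] := mulmx1_unit (VV t).
have uL t : L t \in unitmx by have [] := mulmx1_unit (LL t).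
split.
- by [].
- by move=> i; rewrite /split2; case: ifP => _; apply/andP; split.
- split; first by apply: smoothM; [exact: sV|exact: smooth_cst].
  by move=> t; rewrite unitmx_mul uV uM0.
- split; first by apply: smoothM; [exact: sL|exact: smooth_cst].
  by move=> t; rewrite unitmx_mul uL uU0.
move=> t.
have invV : invmx (V t) = Vi t.
  have [_ VV _ _] := FP.
  by rewrite -[LHS]mul1mx -(VV t) -mulmxA mulmxV// mulmx1.
have SU : S t *m (L t *m U0) = L t *m U0 *m pid_mx l.
  by rewrite mulmxA SL -!mulmxA SU0.
have EM : pid_mx k *m invmx M0 = invmx M0 *m E.
  by rewrite -[RHS](mulmxK uM0) -[_ *m E *m M0]mulmxA EM0 mulKmx.
split; apply: block_diagonal2.
- have [_ _ dV _] := FP.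
  have dVM : is_derive t (1 : R) (fun t => V t *m M0) (closed_loop A B K t *m V t *m M0).
    exact: is_derive_mulmx1.
  rewrite (is_derive_derive1 dVM) -[X in _ + X]/(closed_loop A B K t *m (V t *m M0)).
  by rewrite [closed_loop A B K t *m (_ *m _)]mulmxA addNr !mulmx0 mul0mx.
- have invM : invmx (V t *m M0) = invmx M0 *m Vi t.
    have uM : V t *m M0 \in unitmx by rewrite unitmx_mul uV uM0.
    have E1 : invmx M0 *m Vi t *m (V t *m M0) = 1%:M.
      rewrite -mulmxA [Vi t *m _]mulmxA.
      by have [_ -> _ _] := FP; rewrite mul1mx mulVmx.
    by rewrite -[LHS]mul1mx -E1 mulmxK.
  rewrite invM /split2 /= !mulmxA EM.
  have -> : invmx M0 *m E *m Vi t *m B t *m L t *m U0 =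
      invmx M0 *m (E *m (Vi t *m B t)) *m (L t *m U0) by rewrite !mulmxA.
  rewrite ES -[invmx M0 *m (_ *m S t) *m _]mulmxA -[_ *m S t *m _]mulmxA SU.
  by rewrite !mulmxA.
- rewrite /split2 /=.
  have -> : (pid_mx l : 'M[R]_m.+1) *m ((L t *m U0)^T *m Q t *m (L t *m U0)) =
      (L t *m U0 *m pid_mx l)^T *m Q t *m (L t *m U0).
    by rewrite [(_ *m pid_mx l)^T]trmx_mul tr_pid_mx !mulmxA.
  rewrite -SU [(S t *m _)^T]trmx_mul -[(L t *m U0)^T *m (S t)^T *m Q t]mulmxA -QS.
  by rewrite -[RHS]mulmxA -SU !mulmxA.
Qed.

End ProductStructureConstruction.

(** * The constant intertwiner of two equivalent weights *)

Section Necessity.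
Variable R : realType.
Variables (n m : nat) (A : R -> 'M[R]_n.+1) (B : R -> 'M[R]_(n.+1, m.+1)).
Hypotheses (sA : smooth A) (sB : smooth B).
Hypothesis injB : forall t, injective (fun v : 'cV[R]_m.+1 => B t *m v).
Variables (K : R -> 'M[R]_(m.+1, n.+1)) (Q1 Q2 : R -> 'M[R]_m.+1) (V Vi : R -> 'M[R]_n.+1).
Hypotheses (sK : smooth K) (sQ1 : smooth Q1) (sQ2 : smooth Q2).
Hypotheses (posQ1 : forall t, posdefmx (Q1 t)) (posQ2 : forall t, posdefmx (Q2 t)).
Hypothesis FP : fundamental_pair (closed_loop A B K) V Vi.

Local Notation beta t := (Vi t *m B t).

(** With a common feedback, equal curves have equal extremal controls. Transferring the costates of
    the standard basis with [x = 0] gives the columns of a matrix [L] independent of time, and [P]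
    is its transpose. *)
Lemma intertwiner_of_transfer :
  (forall x p, exists x' p', forall t,
     ext_state B Q1 V Vi x p t = ext_state B Q2 V Vi x' p' t) ->
  exists P : 'M[R]_n.+1, forall t, P *m beta t = beta t *m (invmx (Q1 t) *m Q2 t).
Proof.
move=> transfer.
have /boolp.choice[p_ p_E] : forall i : 'I_n.+1, exists p' : 'cV[R]_n.+1, forall t,
    ext_control B Q1 Vi (delta_mx i 0) t = ext_control B Q2 Vi p' t.
  move=> i; have [x' [p' E]] := transfer 0 (delta_mx i 0); exists p' => t.
  by have := state_eq_control sB injB sQ1 sQ2 posQ1 posQ2 FP FP E t => /addIr.
pose L : 'M[R]_n.+1 := \matrix_(a, i) p_ i a 0.
have LE i : L *m delta_mx i 0 = p_ i.
  by rewrite -colE; apply/colP => a; rewrite !mxE.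
have E t : invmx (Q1 t) *m (beta t)^T = invmx (Q2 t) *m (beta t)^T *m L.
  apply/matrixP => a i.
  have /colP/(_ a) := p_E i t; rewrite /ext_control -LE !mulmxA -!colE.
  by rewrite mxE => ->; rewrite mxE.
exists L^T => t.
have uQ1 := posdefmx_unit (posQ1 t); have uQ2 := posdefmx_unit (posQ2 t).
have := congr1 trmx (E t).
rewrite [LHS]trmx_mul [RHS]trmx_mul [(invmx (Q2 t) *m _)^T]trmx_mul !trmxK.
rewrite !trmx_inv (posQ1 t).1 (posQ2 t).1 => E'.
by rewrite [RHS]mulmxA E' -!mulmxA mulVmx// mulmx1.
Qed.

Variable s : R.
Hypotheses (s0 : 0 < s) (obs : costate_observable A B K s).

(** Such an [E] kills the Gramian as well, which is invertible on [[0, s + 1]]. Applied to a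
    projection and its complement, it shows that both blocks receive inputs. *)
Lemma gramian_annihilator (E : 'M[R]_n.+1) : (forall t, E *m beta t = 0) -> E = 0.
Proof.
move=> Eb; have sG : s < (s + 1) - 0 by rewrite subr0 ltrDl.
have posG := gramian_posdef sB sQ1 posQ1 FP obs (ltW s0) sG.
set G := _ - _ in posG.
have EG : E *m G = 0.
  rewrite /G mulmxBr; apply/eqP; rewrite subr_eq0; apply/eqP.
  apply: (@is_derive_mx_cst _ _ _ (fun t => E *m ext_gramian B Q1 Vi t)) => t.
  apply: eq_is_derive (is_derive_mul1mx E (is_derive_gramian sB sQ1 posQ1 FP t)) _.
  by rewrite !mulmxA -[E *m _ *m B t]mulmxA Eb !mul0mx.
by apply: (posdef_row0 posG); rewrite EG mul0mx.
Qed.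

(** [P] turns the integrand of the Gramian into [beta Q1^-1 Q2 Q1^-1 beta^T], which is symmetric at
    each time. *)
Lemma intertwiner_selfadjoint (P : 'M[R]_n.+1) :
  (forall t, P *m beta t = beta t *m (invmx (Q1 t) *m Q2 t)) ->
  exists2 G : 'M[R]_n.+1, posdefmx G & P *m G = G *m P^T.
Proof.
move=> Pb; have sG : s < (s + 1) - 0 by rewrite subr0 ltrDl.
have posG := gramian_posdef sB sQ1 posQ1 FP obs (ltW s0) sG.
eexists; first exact: posG; have [Gs _] := posG.
set G := _ - _ in Gs *.
rewrite -[in RHS]Gs -trmx_mul.
pose g := ext_gramian B Q1 Vi.
have dPg t : is_derive t (1 : R) (fun t => P *m g t - (P *m g t)^T) 0.
  have d1 := is_derive_mul1mx P (is_derive_gramian sB sQ1 posQ1 FP t).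
  apply: eq_is_derive (is_derive_mxB d1 (is_derive_trmx d1)) _.
  have -> : P *m (beta t *m invmx (Q1 t) *m (beta t)^T) =
      beta t *m (invmx (Q1 t) *m Q2 t *m invmx (Q1 t)) *m (beta t)^T.
    by rewrite [P *m _]mulmxA [P *m _]mulmxA Pb !mulmxA.
  rewrite [(_ *m (beta t)^T)^T]trmx_mul [(beta t *m _)^T]trmx_mul trmxK.
  rewrite [(_ *m invmx (Q1 t))^T]trmx_mul [(_ *m Q2 t)^T]trmx_mul.
  by rewrite !trmx_inv (posQ1 t).1 (posQ2 t).1 !mulmxA subrr.
have := is_derive_mx_cst dPg (s + 1) 0; rewrite /G -/g mulmxBr.
move: (P *m g (s + 1)) (P *m g 0) => Y X /matrixP E.
by apply/matrixP => i j; have := E i j; rewrite !mxE; lra.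
Qed.

Lemma intertwiner_nonscalar (P : 'M[R]_n.+1) :
  (forall t, P *m beta t = beta t *m (invmx (Q1 t) *m Q2 t)) ->
  \det (Q1 0) = 1 -> \det (Q2 0) = 1 -> Q1 <> Q2 -> forall a, P <> a%:M.
Proof.
move=> Pb d1 d2 Q12 a Pa; apply: Q12.
have Q2E t : Q2 t = a *: Q1 t.
  have uQ1 := posdefmx_unit (posQ1 t).
  have injVB : injective (fun v : 'cV[R]_m.+1 => beta t *m v).
    move=> v w /= /(congr1 (mulmx (V t))).
    by rewrite !mulmxA (fundamental_mulV FP) !mul1mx; exact: injB.
  have : invmx (Q1 t) *m Q2 t = a%:M.
    by apply: (mulmx_inj injVB); rewrite -Pb Pa scalar_mxC.
  by move=> /(congr1 (mulmx (Q1 t))); rewrite mulKVmx// mul_mx_scalar.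
have a1 : a ^+ m.+1 = 1.
  by have := d2; rewrite Q2E detZ d1 mulr1.
(* The determinants only give [a ^+ m.+1 = 1]; positivity of both weights excludes the root -1. *)
have a0 : 0 <= a.
  pose e : 'cV[R]_m.+1 := delta_mx 0 0.
  have e0 : e != 0.
    apply/eqP => /colP/(_ 0); rewrite !mxE => /eqP; rewrite oner_eq0. by [].
  have h1 := (posQ1 0).2 e e0; have := (posQ2 0).2 e e0.
  by rewrite Q2E -scalemxAr -scalemxAl mxE pmulr_lgt0// => /ltW.
have {}a1 : a = 1 by apply/eqP; rewrite -(@pexpr_eq1 _ a m.+1)//; apply/eqP.
by apply/funext => t; rewrite Q2E a1 scale1r.
Qed.

Lemma product_structure_necessary (P : 'M[R]_n.+1) :
  (forall t, P *m beta t = beta t *m (invmx (Q1 t) *m Q2 t)) ->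
  (forall a, P <> a%:M) -> admits_product_structure A B K Q1.
Proof.
move=> Pb Pns; have [G posG PG] := intertwiner_selfadjoint Pb.
have [q] := selfadjoint_projection posG PG Pns; set E := horner_mx P q => -[EE E0 E1].
pose Th t := invmx (Q1 t) *m Q2 t.
have sTh : smooth Th.
  apply: smoothM; [apply: smooth_inv; [|exact: sQ1]|exact: sQ2].
  by move=> t; exact/posdefmx_unit/posQ1.
have sV : smooth V.
  by have [_ _ dV _] := FP; apply: (smooth_ode _ dV); exact: smooth_closed_loop.
apply: (@product_structure_of_projection _ _ _ A B K Q1 V Vi sV FP injB E
  (fun t => horner_mx (Th t) q)).
- exact: smooth_horner.
- exact: EE.
- by move=> t; apply: horner_mx_intertwine; exact: Pb.
- move=> t; rewrite horner_mx_tr; apply/esym/horner_mx_intertwine.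
  rewrite /Th trmx_mul trmx_inv (posQ1 t).1 (posQ2 t).1.
  by rewrite mulmxKV ?mulKVmx// ?posdefmx_unit.
- apply: contrapT => H; apply: E0; apply: gramian_annihilator => t.
  by apply/eqP; apply: contrapT => /negP H'; apply: H; exists t.
- apply: contrapT => H; apply: E1; apply/esym/eqP; rewrite -subr_eq0; apply/eqP.
  apply: gramian_annihilator => t.
  by apply/eqP; apply: contrapT => /negP H'; apply: H; exists t.
Qed.

End Necessity.

(** * Equivalent costs of a product structure *)

Section Sufficiency.
Variable R : realType.
Local Notation mu := (@lebesgue_measure R).
Local Notation J a b f := (\int[mu]_(s in `[a, b]) f s).

Section WeightedProjections.
Variables (k : nat) (Q S : 'M[R]_k) (c d : R).
Hypotheses (Qs : Q^T = Q) (SS : S *m S = S) (QS : Q *m S = S^T *m Q).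

(** Under [QS] the projection [S] is [Q]-orthogonal, so the quadratic form is multiplied by [c] on
    its image and by [d] on its kernel. *)
Definition reweight := Q *m (c *: S + d *: (1%:M - S)).

Lemma quad_adj v w : quad Q v (S *m w) = quad Q (S *m v) w.
Proof. by rewrite /quad trmx_mul mulmxA -[v^T *m Q *m S]mulmxA QS !mulmxA. Qed.

Lemma quadZr (Q' : 'M[R]_k) a v w : quad Q' v (a *: w) = a * quad Q' v w.
Proof. by rewrite /quad -scalemxAr mxE. Qed.

Lemma quadNr (Q' : 'M[R]_k) v w : quad Q' v (- w) = - quad Q' v w.
Proof. by rewrite -scaleN1r quadZr mulN1r. Qed.

Lemma quad_reweight v w :
  quad reweight v w = c * quad Q v (S *m w) + d * quad Q v (w - S *m w).
Proof.
have -> : c * quad Q v (S *m w) + d * quad Q v (w - S *m w) =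
    quad Q v ((c *: S + d *: (1%:M - S)) *m w).
  by rewrite mulmxDl -!scalemxAl mulmxBl mul1mx [in RHS]quadDr !quadZr.
by rewrite /quad /reweight !mulmxA.
Qed.

Lemma quadNl (Q' : 'M[R]_k) v w : quad Q' (- v) w = - quad Q' v w.
Proof.
have -> : - v = (-1) *: v by rewrite scaleN1r.
by rewrite /quad linearZ /= -!scalemxAl mxE mulN1r.
Qed.

Lemma quad_cross v w : quad Q (S *m v) (w - S *m w) = 0.
Proof. by rewrite quadDr quadNr -!quad_adj mulmxA SS subrr. Qed.

Lemma quad_reweight_diag v :
  quad reweight v v = c * quad Q (S *m v) (S *m v) + d * quad Q (v - S *m v) (v - S *m v).
Proof.
rewrite quad_reweight; congr (_ * _ + _ * _); first by rewrite -quad_adj mulmxA SS.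
by rewrite quadDl quadNl quad_cross subr0.
Qed.

Lemma quad_split v :
  quad Q v v = quad Q (S *m v) (S *m v) + quad Q (v - S *m v) (v - S *m v).
Proof.
have E : v = S *m v + (v - S *m v) by rewrite addrC subrK.
by rewrite {1 2}E [LHS](quad_sqrD _ _ Qs) quad_cross mulr0 add0r.
Qed.

(** The point of the splitting: the increment of the new cost along [w] is the combination, with
    coefficients [c] and [d], of the increments of the old cost along [S w] and [w - S w].
    Minimality for the old cost, applied in these two directions, is therefore enough. *)
Lemma quad_reweight_incr v w :
  quad reweight (v + w) (v + w) = quad reweight v v
   + (c * (quad Q (v + S *m w) (v + S *m w) - quad Q v v)
   + d * (quad Q (v + (w - S *m w)) (v + (w - S *m w)) - quad Q v v)).
Proof.
rewrite !quad_reweight_diag mulmxDr opprD addrACA.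
rewrite (quad_sqrD (S *m v) (S *m w) Qs) (quad_sqrD (v - S *m v) (w - S *m w) Qs).
rewrite (quad_sqrD v (S *m w) Qs) (quad_sqrD v (w - S *m w) Qs).
have -> : quad Q (S *m v) (S *m w) = quad Q v (S *m w).
  by rewrite -quad_adj mulmxA SS.
have -> : quad Q (v - S *m v) (w - S *m w) = quad Q v (w - S *m w).
  by rewrite quadDl quadNl quad_cross subr0.
ring.
Qed.

Lemma tr_reweight : reweight^T = reweight.
Proof.
rewrite /reweight trmx_mul Qs linearD /= ![(_ *: _)^T]linearZ /= [(_ - _)^T]linearB /=.
rewrite trmx1 mulmxDl mulmxDr -!scalemxAl -!scalemxAr -QS mulmxBl mulmxBr.
by rewrite mul1mx mulmx1 QS.
Qed.

Lemma reweight_adj : reweight *m S = S^T *m reweight.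
Proof.
rewrite /reweight mulmxA -QS -!mulmxA; congr (_ *m _).
rewrite mulmxDl mulmxDr -!scalemxAl -!scalemxAr mulmxBl mulmxBr.
by rewrite mul1mx mulmx1.
Qed.

End WeightedProjections.

(** Reweighting can be undone by another reweighting, so one transfer of minimizers yields both
    inclusions of syntheses. *)
Lemma reweightK k (Q S : 'M[R]_k) c d : c != 0 -> d != 0 -> S *m S = S ->
  reweight (reweight Q S c d) S c^-1 d^-1 = Q.
Proof.
move=> c0 d0 SS; rewrite /reweight -mulmxA.
have -> : (c *: S + d *: (1%:M - S)) *m (c^-1 *: S + d^-1 *: (1%:M - S)) = 1%:M.
  rewrite mulmxDl !mulmxDr -!scalemxAl -!scalemxAr !scalerA divff// divff//.
  have S1 : S *m (1%:M - S) = 0 by rewrite mulmxBr mulmx1 SS subrr.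
  have S2 : (1%:M - S) *m S = 0 by rewrite mulmxBl mul1mx SS subrr.
  have S3 : (1%:M - S) *m (1%:M - S) = 1%:M - S.
    by rewrite mulmxBl mul1mx S1 subr0.
  by rewrite S1 S2 S3 SS !scaler0 addr0 add0r !scale1r addrC subrK.
by rewrite mulmx1.
Qed.

Lemma succmx_scalarP k (Q : 'M[R]_k) a : Q^T = Q ->
  succmx Q a%:M <-> forall x : 'cV[R]_k, x != 0 -> a * \sum_i x i 0 ^+ 2 < quad Q x x.
Proof.
move=> Qs; have qa (x : 'cV[R]_k) : (x^T *m (Q - a%:M) *m x) 0 0 =
    quad Q x x - a * \sum_i x i 0 ^+ 2.
  by rewrite mulmxBr mulmxBl mxBE mul_mx_scalar -scalemxAl [X in _ - X]mxE normsq_coef.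
split=> [[_ H] x x0|H]; first by have := H x x0; rewrite qa subr_gt0.
split=> [|x x0]; first by rewrite linearB /= Qs tr_scalar_mx.
by rewrite qa subr_gt0; exact: H.
Qed.

Section ReweightBounds.
Variables (k : nat) (Q S : 'M[R]_k) (c d : R).
Hypotheses (Qp : posdefmx Q) (SS : S *m S = S) (QS : Q *m S = S^T *m Q).
Hypotheses (d0 : 0 < d) (dc : d <= c).

Lemma quad_reweight_ge v : d * quad Q v v <= quad (reweight Q S c d) v v.
Proof.
have [Qs _] := Qp; rewrite (quad_reweight_diag c d SS QS) (quad_split Qs SS QS v) mulrDr.
by rewrite lerD2r ler_wpM2r// quad_ge0.
Qed.

Lemma quad_reweight_le v : quad (reweight Q S c d) v v <= c * quad Q v v.
Proof.
have [Qs _] := Qp; rewrite (quad_reweight_diag c d SS QS) (quad_split Qs SS QS v) mulrDr.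
by rewrite lerD2l ler_wpM2r// quad_ge0.
Qed.

Lemma reweight_posdef : posdefmx (reweight Q S c d).
Proof.
split=> [|x x0]; first exact: (tr_reweight c d Qp.1 QS).
apply: lt_le_trans (quad_reweight_ge x); rewrite mulr_gt0//.
exact: Qp.2.
Qed.

Lemma reweight_coercive al : succmx Q al%:M -> succmx (reweight Q S c d) (d * al)%:M.
Proof.
move=> /(succmx_scalarP _ Qp.1) H; apply/succmx_scalarP => [|x x0].
  exact: (tr_reweight c d Qp.1 QS).
by apply: lt_le_trans (quad_reweight_ge x); rewrite -mulrA ltr_pM2l// H.
Qed.

End ReweightBounds.

Lemma quad_delta k (Q : 'M[R]_k) i j : quad Q (delta_mx i 0) (delta_mx j 0) = Q i j.
Proof. by rewrite /quad trmx_delta -rowE -colE !mxE. Qed.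

(** Positivity on the sum and difference of two basis vectors bounds an off-diagonal coefficient by
    the mean of two diagonal ones. *)
Lemma posdef_coef_le k (Q : 'M[R]_k) C : posdefmx Q -> (forall i, Q i i <= C) ->
  forall i j, `|Q i j| <= C.
Proof.
move=> Qp QC i j; have Qs := Qp.1.
have h1 := quad_ge0 Qp (delta_mx i 0 + delta_mx j 0).
have h2 := quad_ge0 Qp (delta_mx i 0 - delta_mx j 0).
rewrite (quad_sqrD _ _ Qs) !quad_delta in h1.
rewrite (quad_sqrD _ _ Qs) !quadNr !quadNl !quad_delta in h2.
have := QC i; have := QC j; rewrite ler_norml => h3 h4; apply/andP; split; lra.
Qed.

Variables (n m : nat) (A : R -> 'M[R]_n) (B : R -> 'M[R]_(n, m)).
Variables (K : R -> 'M[R]_(m, n)).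
Hypotheses (sA : smooth A) (sB : smooth B) (sK : smooth K).

(** The difference [z] between a competitor and the minimizer vanishes at both ends, and so do [P z]
    and [z - P z], which are driven by [S e] and [e - S e]. Comparing along each of them makes the
    integrals of [f1] and [f2] nonnegative, and the new cost increases by [c f1 + d f2]. *)
Lemma reweight_minimizer (Q S : R -> 'M[R]_m) (P P' : R -> 'M[R]_n) (c d : R)
    a b xa xb x u :
  smooth Q -> smooth S -> continuous P' -> 0 <= c -> 0 <= d -> a <= b ->
  (forall t, (Q t)^T = Q t) -> (forall t, S t *m S t = S t) ->
  (forall t, Q t *m S t = (S t)^T *m Q t) ->
  (forall t, is_derive t (1 : R) P (P' t)) ->
  (forall t, P' t = closed_loop A B K t *m P t - P t *m closed_loop A B K t) ->
  (forall t, P t *m B t = B t *m S t) ->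
  minimizer A B (quadratic_cost K Q) a b xa xb x u ->
  minimizer A B (quadratic_cost K (fun t => reweight (Q t) (S t) c d)) a b xa xb x u.
Proof.
move=> sQ sS cP' c0 d0 ab Qs SS QS dP P'E PB [tx xaE xbE xmin].
split=> // y w ty yaE ybE.
have cB := smooth_cts sB; have cK := smooth_cts sK; have cQ := smooth_cts sQ.
have cS := smooth_cts sS; have cF := smooth_cts (smooth_closed_loop sA sB sK).
have sW : smooth (fun t => reweight (Q t) (S t) c d).
  apply: smoothM; [exact: sQ|apply: smoothD; apply: smoothZ; first exact: sS].
  by apply: smoothB; [exact: smooth_cst|exact: sS].
have fx := trajectory_feedback cK tx; have fy := trajectory_feedback cK ty.
pose v t := u t + K t *m x t.
pose e t := w t + K t *m y t + (-1) *: v t.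
pose z t := y t + (-1) *: x t.
have tz : trajectory (closed_loop A B K) B a b z e.
  exact: trajectory_comb cF cB fy fx.
have tPz := trajectory_intertwine cF cB cS cP' dP P'E PB tz.
have tRz := trajectory_comb (-1) cF cB tz tPz.
have za : z a = 0 by rewrite /z yaE xaE scaleN1r subrr.
have zb : z b = 0 by rewrite /z ybE xbE scaleN1r subrr.
have costE Q' x' u' : smooth Q' -> trajectory A B a b x' u' ->
    total_cost (quadratic_cost K Q') a b x' u' =
    (J a b (fun t => quad (Q' t) (u' t + K t *m x' t) (u' t + K t *m x' t)))%:E.
  by move=> sQ' [uL2 cx _]; apply: total_costE => //; exact: smooth_cts.
have compete h g : trajectory (closed_loop A B K) B a b h g -> h a = 0 -> h b = 0 ->
    J a b (fun t => quad (Q t) (v t) (v t)) <=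
    J a b (fun t => quad (Q t) (v t + g t) (v t + g t)).
  move=> th ha hb.
  have tc := trajectory_comb 1 cF cB fx th.
  pose u' t := v t + 1 *: g t - K t *m (x t + 1 *: h t).
  have u'E : (fun t => u' t + K t *m (x t + 1 *: h t)) = (fun t => v t + 1 *: g t).
    by apply/funext => t; rewrite /u' subrK.
  have tu' : trajectory A B a b (fun t => x t + 1 *: h t) u'.
    by apply: (trajectory_feedback_inv cK); rewrite u'E.
  have := xmin _ _ tu'; rewrite ha hb scaler0 !addr0 => /(_ xaE xbE).
  rewrite !costE// lee_fin => /le_trans; apply.
  rewrite le_eqVlt; apply/orP; left; apply/eqP; apply: Rintegral_eq => t _.
  by rewrite /u' subrK scale1r.
have c1 := compete _ _ tPz; rewrite za zb !mulmx0 in c1; have {}c1 := c1 erefl erefl.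
have c2 := compete _ _ tRz; rewrite za zb !mulmx0 scaler0 addr0 in c2.
have {}c2 := c2 erefl erefl.
rewrite !costE// lee_fin.
have vL2 : mxL2 a b v := trajectory_mxL2 fx.
have eL2 := trajectory_mxL2 tz; have SeL2 := trajectory_mxL2 tPz.
have ReL2 := trajectory_mxL2 tRz.
have cW := smooth_cts sW.
have Iv := quad_L1 cQ vL2 vL2; have IWv := quad_L1 cW vL2 vL2.
have v1L2 := mxL2D vL2 SeL2; have v2L2 := mxL2D vL2 ReL2.
have I1 := quad_L1 cQ v1L2 v1L2; have I2 := quad_L1 cQ v2L2 v2L2.
pose f1 t := quad (Q t) (v t + S t *m e t) (v t + S t *m e t) + (-1) * quad (Q t) (v t) (v t).
pose f2 t := quad (Q t) (v t + (e t + (-1) *: (S t *m e t))) (v t + (e t + (-1) *: (S t *m e t)))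
   + (-1) * quad (Q t) (v t) (v t).
have If1 : L1 a b f1 by apply: L1D => //; exact: L1Z.
have If2 : L1 a b f2 by apply: L1D => //; exact: L1Z.
have -> : J a b (fun t => quad (reweight (Q t) (S t) c d) (w t + K t *m y t) (w t + K t *m y t)) =
   J a b (fun t => quad (reweight (Q t) (S t) c d) (v t) (v t) + (c * f1 t + d * f2 t)).
  apply: Rintegral_eq => t _.
  have -> : w t + K t *m y t = v t + e t by rewrite /e scaleN1r [RHS]addrC subrK.
  rewrite (quad_reweight_incr c d (Qs t) (SS t) (QS t)) /f1 /f2 !mulN1r scaleN1r.
  by [].
have J1 : 0 <= J a b f1.
  by rewrite /f1 RintegralD//; [rewrite RintegralZl// mulN1r subr_ge0|exact: L1Z].
have J2 : 0 <= J a b f2.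
  by rewrite /f2 RintegralD//; [rewrite RintegralZl// mulN1r subr_ge0|exact: L1Z].
rewrite RintegralD//; last by apply: L1D; exact: L1Z.
rewrite lerDl RintegralD//; [|exact: L1Z|exact: L1Z].
by rewrite !RintegralZl// addr_ge0// mulr_ge0.
Qed.

End Sufficiency.

(** * Assembly of the two implications *)

Section MainTheorem.
Variable R : realType.

Lemma equivalent_cost_of_product n m (A : R -> 'M[R]_n) (B : R -> 'M[R]_(n, m))
    (K : R -> 'M[R]_(m, n)) (W : R -> 'M[R]_m) :
  smooth A -> smooth B -> admissible_weights A B K W ->
  admits_product_structure A B K W ->
  exists c', [/\ canonical_cost A B c', c' <> quadratic_cost K W
    & equivalent_costs A B c' (quadratic_cost K W)].
Proof.
move=> sA sB [[Ws sW bW [al al0 Wal] W1] sK bK stab].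
move=> [N [n_ [m_ [en [em [M [U [N1 nm [sM uM] [sU uU] blocks]]]]]]]].
pose i0 := Ordinal (ltnW N1); pose i1 := Ordinal N1.
(* The projections onto block [i0], carried back from the block coordinates to the original inputs
   and, for [P], to the original states. *)
pose S t := U t *m (block_scaling em i0 1 0 : 'M[R]_m) *m invmx (U t).
pose P t := M t *m (block_scaling en i0 1 0 : 'M[R]_n) *m invmx (M t).
have posW t : posdefmx (W t) by apply: succmx_scalar_posdef (Wal t) => //; exact: ltW.
have SS t : S t *m S t = S t.
  rewrite /S -!mulmxA mulKmx// [block_scaling _ _ _ _ *m (_ *m invmx _)]mulmxA.
  by rewrite block_scalingM !mulr1 mulr0.
have DT (c d : R) : ((block_scaling em i0 c d : 'M[R]_m))^T = block_scaling em i0 c d.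
  by rewrite /block_scaling tr_diag_mx.
have sS : smooth S.
  apply: smoothM; first by apply: smoothM; [exact: sU|exact: smooth_cst].
  exact: smooth_inv.
have WS t : W t *m S t = (S t)^T *m W t.
  have [_ _ /(@block_diagonal_scaling _ _ _ _ _ _ _ _ _ i0 1 0)/esym E] := blocks t.
  have E2 := congr1 (fun X => invmx (U t)^T *m X *m invmx (U t)) E.
  have uUT : (U t)^T \in unitmx by rewrite unitmx_tr.
  rewrite /S !trmx_mul DT trmx_inv.
  by move: E2; rewrite /= !mulmxA mulVmx// mul1mx mulmxK// => ->.
have PB t : P t *m B t = B t *m S t.
  have [_ /(@block_diagonal_scaling _ _ _ _ _ _ _ _ _ i0 1 0) E _] := blocks t.
  have E2 := congr1 (fun X => M t *m X *m invmx (U t)) E.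
  by move: E2; rewrite /P /S /= !mulmxA mulmxK// mulmxV// mul1mx.
pose P' t := closed_loop A B K t *m P t - P t *m closed_loop A B K t.
(* The block-diagonal drift [X] commutes with the constant projection [D]; substituting
   [M' = F M - M X], with [F] the closed loop, cancels the terms in [X]. *)
have dP t : is_derive t (1 : R) P (P' t).
  have dM := smooth_derive sM.
  have d1 := is_derive_mulmx (is_derive_mulmx1 ((block_scaling en i0 1 0 : 'M[R]_n)) (dM t))
    (is_derive_invmx uM sM dM t).
  apply: eq_is_derive d1 _.
  have [/(@block_diagonal_scaling _ _ _ _ _ _ _ _ _ i0 1 0) E _ _] := blocks t.
  set D := (block_scaling en i0 1 0 : 'M[R]_n) in E *; set X := _ *m (_ + _) in E.
  have M'E : derive1 M t = closed_loop A B K t *m M t - M t *m X.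
    rewrite /X mulKVmx// opprD opprK addrCA subrr addr0. by [].
  rewrite M'E /P' /P -/D; set Fc := closed_loop A B K t.
  transitivity (Fc *m (M t *m D *m invmx (M t)) - M t *m (X *m D) *m invmx (M t)
      + (M t *m (D *m X) *m invmx (M t) - M t *m D *m invmx (M t) *m Fc)).
    congr (_ + _); first by rewrite !mulmxBl !mulmxA.
    have -> : invmx (M t) *m (Fc *m M t - M t *m X) *m invmx (M t) =
        invmx (M t) *m Fc - X *m invmx (M t).
      rewrite mulmxBr mulmxBl [invmx (M t) *m (M t *m X)]mulmxA mulVmx// mul1mx.
      by rewrite mulmxA mulmxK.
    by rewrite opprB mulmxBr !mulmxA.
  by rewrite E addrA subrK.
pose b := #|[pred k | block_of em k != i0]|.
pose a := #|[pred k | block_of em k == i0]|.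
have [k0 k0E] : exists k, block_of em k = i0 by apply: block_of_surj; have /andP[] := nm i0.
have [k1 k1E] : exists k, block_of em k = i1 by apply: block_of_surj; have /andP[] := nm i1.
have a0 : (0 < a)%N by apply/card_gt0P; exists k0; rewrite inE k0E.
have b0 : (0 < b)%N by apply/card_gt0P; exists k1; rewrite inE k1E.
(* Block [i0] has [a] inputs and the others together have [b], so [c ^+ a * d ^+ b = 1]; as [b] is
   positive, [c] differs from 1. *)
pose c : R := 2 ^+ b; pose d : R := (2 ^+ a)^-1.
have d0 : 0 < d by rewrite invr_gt0 exprn_gt0.
have c1 : 1 < c by rewrite exprn_egt1 ?ltr1n// -lt0n.
have dc : d <= c.
  apply: le_trans (ltW c1); rewrite invf_le1 ?exprn_gt0//.
  by rewrite exprn_ege1// ler1n.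
have c0 : 0 < c by exact: lt_trans c1.
pose W' t := reweight (W t) (S t) c d.
have sW' : smooth W'.
  apply: smoothM; first exact: sW.
  apply: smoothD; apply: smoothZ; first exact: sS.
  by apply: smoothB; [exact: smooth_cst|exact: sS].
have posW' t : posdefmx (W' t) by exact: (reweight_posdef (posW t) (SS t) (WS t) d0 dc).
have DE : (block_scaling em i0 c d : 'M[R]_m) = c *: (block_scaling em i0 1 0 : 'M[R]_m) +
    d *: (1%:M - (block_scaling em i0 1 0 : 'M[R]_m)) by exact: block_scalingE.
have detW' : \det (W' 0) = 1.
  rewrite /W' /reweight det_mulmx W1 mul1r.
  have -> : c *: S 0 + d *: (1%:M - S 0) = U 0 *m (block_scaling em i0 c d : 'M[R]_m) *m invmx (U 0).
    rewrite DE mulmxDr mulmxDl -!scalemxAr -!scalemxAl mulmxBr mulmxBl mulmx1 mulmxV//.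
  rewrite !det_mulmx mulrAC -det_mulmx mulmxV// det1 mul1r det_block_scaling.
  by rewrite -/a -/b /c /d exprVn -!exprM mulnC divff// expf_neq0.
have bW' : bounded_fun W'.
  have [C C0 WC] := bounded_fun_coord bW.
  have W'C t i j : `|W' t i j| <= c * C.
    apply: posdef_coef_le => // {}i; rewrite -quad_delta.
    apply: le_trans (quad_reweight_le (posW t) (SS t) (WS t) dc _) _.
    rewrite quad_delta ler_pM2l//; apply: le_trans (WC t i i); exact: ler_norm.
  exists (c * C); split=> [|M' CM' t _]; first exact: num_real.
  apply: norm_le_coord => [|i j].
    by apply: le_trans (ltW CM'); rewrite mulr_ge0// ltW.
  by apply: le_trans (W'C t i j) (ltW CM').
exists (quadratic_cost K W'); split.
- exists K, W'; split=> //; split=> //; split=> //.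
  + by move=> t; exact: (posW' t).1.
  + exists (d * al); first exact: mulr_gt0.
    by move=> t; apply: (reweight_coercive (posW t) (SS t) (WS t) d0 dc); exact: Wal.
(* The costs are separated at time 0 and state 0 by an input from block [i0], on which the new cost
   is [c] times the old one. *)
- move=> /(congr1 (fun f => f 0 0 (U 0 *m delta_mx k0 0))).
  rewrite /quadratic_cost mulmx0 addr0 -/(quad (W' 0) _ _) -/(quad (W 0) _ _).
  set v := U 0 *m _.
  have Sv : S 0 *m v = v.
    rewrite /S /v -!mulmxA mulKmx//.
    congr (_ *m _); rewrite /block_scaling mul_diag_mx; apply/matrixP => i j.
    by rewrite !mxE; case: (eqVneq i k0) => [->|_]; rewrite ?k0E ?eqxx ?mul1r// mulr0.
  rewrite /W' quad_reweight Sv subrr /quad mulmx0 [X in d * X]mxE mulr0 addr0.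
  rewrite -/(quad (W 0) v v) => E.
  have v0 : v != 0.
    apply/eqP => /(congr1 (mulmx (invmx (U 0)))); rewrite mulKmx// mulmx0.
    by move=> /matrixP/(_ k0 0); rewrite !mxE !eqxx => /eqP; rewrite oner_eq0.
  have q0 := (posW 0).2 v v0.
  have : quad (W 0) v v * (c - 1) = 0 by rewrite mulrBr mulr1 mulrC E subrr.
  by move=> /eqP; rewrite mulf_eq0 subr_eq0 !gt_eqF.
- have cP' : continuous P'.
    have cP : continuous P by move=> t; exact: is_derive_cts (dP t).
    have cF := smooth_cts (smooth_closed_loop sA sB sK).
    by move=> t; apply: cvgB; exact: cts_mulmx.
  have P'E t : P' t = closed_loop A B K t *m P t - P t *m closed_loop A B K t by [].
  rewrite /equivalent_costs; apply/seteqP; split=> -[[t0 t1] x] [t01 [x0 [x1 [u umin]]]];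
    split=> //; exists x0, x1, u.
  (* The same transfer of minimizers run backwards, from [W'] to [W], with the inverse weights. *)
  + have W'S t : W' t *m S t = (S t)^T *m W' t by exact: reweight_adj.
    have ci : 0 <= c^-1 by rewrite invr_ge0 ltW.
    have di : 0 <= d^-1 by rewrite invr_ge0 ltW.
    have := reweight_minimizer sA sB sK sW' sS cP' ci di (ltW t01)
      (fun t => (posW' t).1) SS W'S dP P'E PB umin.
    have -> // : (fun t => reweight (W' t) (S t) c^-1 d^-1) = W.
    by apply/funext => t; rewrite /W' reweightK// gt_eqF.
  + exact: (reweight_minimizer sA sB sK sW sS cP' (ltW c0) (ltW d0) (ltW t01)
      Ws SS WS dP P'E PB umin).
Qed.

Lemma product_of_equivalent_cost n m (A : R -> 'M[R]_n) (B : R -> 'M[R]_(n, m))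
    (K : R -> 'M[R]_(m, n)) (W : R -> 'M[R]_m) c' :
  standing_assumptions A B -> admissible_weights A B K W ->
  canonical_cost A B c' -> c' <> quadratic_cost K W ->
  equivalent_costs A B c' (quadratic_cost K W) ->
  admits_product_structure A B K W.
Proof.
(* Polynomials of matrices are used in positive dimension only. Without inputs all canonical costs
   coincide; with inputs but no state, [B] cannot be injective. *)
case: n A B K W c' => [|n]; case: m => [|m] A B K W c'
  [[sA sB bA bB] injB _ ctrl] adm [K2 [W2 [adm2 ->]]] neq eqv.
- exfalso; apply: neq; congr quadratic_cost; apply/funext => t; apply/matrixP; case; by [].
- have /matrixP/(_ 0 0)/eqP : (delta_mx 0 0 : 'cV[R]_m.+1) = 0.
    by apply: (@injB 0); apply/matrixP; case.
  by rewrite !mxE oner_eq0.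
- exfalso; apply: neq; congr quadratic_cost; apply/funext => t; apply/matrixP; case; by [].
have [[Ws sW bW [al al0 Wal] W1] sK bK stab] := adm.
have [[W2s sW2 bW2 [al2 al20 W2al] W21] sK2 bK2 stab2] := adm2.
have posW t : posdefmx (W t) by apply: succmx_scalar_posdef (Wal t) => //; exact: ltW.
have posW2 t : posdefmx (W2 t) by apply: succmx_scalar_posdef (W2al t) => //; exact: ltW.
have coW2 : exists2 al : R, 0 < al & forall t, succmx (W2 t) al%:M by exists al2.
have [s s0 obs] := costate_observability sA sB bA bB ctrl.
(* The quantitative estimate at [e = 0] is the qualitative observability. *)
have obs0 K' : bounded_fun K' -> costate_observable A B K' s.
  move=> bK' p t0 dp Bp; have [D _ HD] := obs K' bK'.
  apply/colP => i; rewrite [RHS]mxE; apply/eqP; rewrite -sqrf_eq0 eq_le sqr_ge0 andbT.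
  have := HD p t0 0 (lexx 0) dp; rewrite expr0n mulr0; apply=> t tt j.
  by rewrite Bp// mxE normr0.
have [V [Vi FP]] := linear_ode_exists (smooth_closed_loop sA sB sK).
have [V2 [Vi2 FP2]] := linear_ode_exists (smooth_closed_loop sA sB sK2).
have syn : optimal_synthesis A B (quadratic_cost K W) `<=`
    optimal_synthesis A B (quadratic_cost K2 W2) by rewrite -[X in X `<=` _]eqv.
have KK : K = K2.
  exact: (equivalent_feedback sA sB injB sK sK2 sW sW2 posW posW2 coW2 FP FP2 s0
    (obs0 _ bK2) bK bK2 bW2 stab stab2 (obs _ bK2) syn).
subst K2.
have WW : W <> W2 by move=> E; apply: neq; rewrite E.
have transfer := extremal_transfer sA sB injB sK sK sW sW2 posW posW2 coW2 FP FP s0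
  (obs0 _ bK) syn.
have [P Pb] := intertwiner_of_transfer sB injB sW sW2 posW posW2 FP transfer.
apply: (product_structure_necessary sA sB injB sK sW sW2 posW posW2 FP s0 (obs0 _ bK) Pb).
exact: (intertwiner_nonscalar injB posW posW2 FP Pb W1 W21 WW).
Qed.

End MainTheorem.

Theorem theorem3p5 (R : realType) (n m : nat)
    (A : R -> 'M[R]_n) (B : R -> 'M[R]_(n, m))
    (hAB : standing_assumptions A B)
    (K : R -> 'M[R]_(m, n)) (W : R -> 'M[R]_m)
    (hKW : admissible_weights A B K W) :
  (exists c' : R -> 'cV[R]_n -> 'cV[R]_m -> R,
     [/\ canonical_cost A B c',
         c' <> quadratic_cost K W
       & equivalent_costs A B c' (quadratic_cost K W)])
  <-> admits_product_structure A B K W.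
Proof.
split=> [[c' [can neq eqv]]|ps].
  exact: product_of_equivalent_cost hAB hKW can neq eqv.
have [[sA sB _ _] _ _ _] := hAB.
exact: equivalent_cost_of_product.
Qed.
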